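(* Let $0<\alpha<1$, $0<\epsilon<1$ and $0<\varepsilon<1$ (with $\epsilon$ and $\varepsilon$ two separate numbers). In the errors-in-variables model of the context, let $\widehat T\subseteq\{1,\dots,p\}$ be a (possibly data-driven) selected support, let $\hat k=|\widehat T|$, and let $(\tilde\beta,\tilde t)$ be a solution of $$\min_{\beta,t\in\mathbb R^p}\|t\|_\infty\quad\text{subject to}\quad\Big|\tfrac1n\sum_{i=1}^nz_{ij}(y_i-z_i^T\beta)+\hat\Gamma_{jj}\beta_j\Big|\le t_j\ \ (j\in\widehat T),\qquad\beta_j=t_j=0\ \ (j\notin\widehat T).$$ There exist constants $C_{\xi w}>0$ and $c'>0$ depending only on $\sigma_w$ and $\sigma_\xi$ such that, if Conditions A and B (see context) hold and $$b_\epsilon+2\{\sigma_wm_2^{1/2}+C_{\xi w}\}\sqrt{\frac{2\log(2p^2/\varepsilon)}{n}}\le\frac{\phi_{\min}(\hat k+s)}{2\{\hat k+s\}},$$ then with probability at least $1-2\epsilon-9\varepsilon$, $$\|\tilde\beta-\beta_0\|_2\le\frac{\{\hat k+s\}^{1/2}}{c'\phi_{\min}(\hat k+s)}\Big\{(1+\|\beta_0\|_2)(1+m_2^{1/2})\sqrt{\frac{\log(2p/\varepsilon)}{n}}+b_\epsilon\|\beta_0\|_\infty\Big\}+\|\beta_{0\widehat T^c}\|_2\,\frac{\phi_{\max}^{1/2}(s)}{\phi_{\min}^{1/2}(\hat k+s)}.$$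
   Context: Model. For $i=1,\dots,n$: $y_i=x_i^T\beta_0+\xi_i$ and $z_i=x_i+w_i$, where $y_i\in\mathbb R$ and $z_i\in\mathbb R^p$ are observed, $x_i\in\mathbb R^p$ is not observed, $\beta_0\in\mathbb R^p$ is unknown, and $(y_i,z_i)$ are independent across $i$. $\Gamma=\frac1n\sum_{i=1}^n\mathrm E[w_iw_i^T]$ is diagonal. Here $p$, $s\ge1$ and all model quantities may depend on $n$. Notation. $\|\cdot\|_q$ is the $\ell_q$-norm and $\|\cdot\|_0$ the number of non-zero components of a vector; for a matrix $\|A\|_\infty=\max_{i,j}|a_{ij}|$; $\theta_J$ is $\theta$ with the components outside $J$ set to zero, and $\beta_{0\widehat T^c}=(\beta_0)_{\widehat T^c}$; $\Phi$ is the standard normal c.d.f. A centered random variable $\zeta$ is zero-mean subgaussian with variance parameter $\sigma^2$ if $\mathrm E[\exp(t\zeta)]\le\exp(t^2\sigma^2/2)$ for all $t\in\mathbb R$; a random vector $w$ is zero-mean subgaussian with variance parameter $\sigma^2$ if every $v^Tw$ with $\|v\|_2=1$ is. Estimator of $\Gamma$. $\hat\Gamma$ is a given (random) estimator of $\Gamma$ and $b_\epsilon$ is a number such that, for any $n$, $\mathrm P(\|\hat\Gamma-\Gamma\|_\infty>b_\epsilon)\le\epsilon$. Further quantities. $m_2=\max_{1\le j\le p}\frac1n\sum_{i=1}^nx_{ij}^2$. With $\Psi=\frac1nX^TX$ and $C_J(0)=\{\Delta\in\mathbb R^p:\Delta_{J^c}=0\}$ for $J\subseteq\{1,\dots,p\}$,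 the sparse eigenvalues are $$\phi_{\min}(k)=\min_{J:|J|\le k}\ \min_{\Delta\in C_J(0),\|\Delta\|_2=1}\Delta^T\Psi\Delta,\qquad\phi_{\max}(k)=\max_{J:|J|\le k}\ \max_{\Delta\in C_J(0),\|\Delta\|_2=1}\Delta^T\Psi\Delta.$$ Condition A. (i) The $n\times p$ matrix $X=[x_1;\dots;x_n]^T$ is deterministic and $\|\beta_0\|_0\le s$. (ii) $\xi_1,\dots,\xi_n$ are independent zero-mean subgaussian with variance parameter $\sigma_\xi^2\le C$. (iii) $w_1,\dots,w_n$ are independent zero-mean subgaussian random vectors with variance parameter $\sigma_w^2\le C$, with $\mathrm E[w_{ij}w_{ik}]=0$ for all $1\le j<k\le p$ and all $i$; and $(w_i)_{i=1}^n$ is independent of $(\xi_i)_{i=1}^n$. Here $C$ is a positive constant. Condition B. Let $U_{ij}=z_{ij}(\xi_i-w_i^T\beta_0)+\mathrm E[w_{ij}^2]\beta_{0j}$, $\mathcal U_{jk}=\{\frac1n\sum_{i=1}^n\mathrm E[|U_{ij}|^k]\}^{1/k}$, $\Delta_j=|\beta_{0j}|\max_{1\le i\le n}|\mathrm E[w_{ij}^2]-\Gamma_{jj}|$. (i) $\hat\Gamma$ is diagonal and $b_\epsilon$ satisfies $\mathrm P(\|\hat\Gamma-\Gamma\|_\infty>b_\epsilon)\le\epsilon$. Moreover, for some sequence $\ell_n\ge2$ tending to infinity: (ii) $\max_{1\le j\le p}\{\mathcal U_{j3}/\mathcal U_{j2}\}\,\Phi^{-1}(1-\alpha/(2pn))\le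 n^{1/6}/\ell_n$; (iii) $\max_{j:\Delta_j>0}\{n^{-1/6}(\Delta_j/\mathcal U_{j2})\}\,\Phi^{-1}(1-\alpha/(2pn))\le1/\ell_n$, and $n\ge4\log(2pn/\alpha)$. (The ratios presuppose $\mathcal U_{j2}>0$.) *)

(* Defs.v *)
From HB Require Import structures.
From mathcomp Require Import all_boot all_order all_algebra.
From mathcomp Require Import all_classical all_reals all_analysis.
Set Implicit Arguments.
Unset Strict Implicit.
Unset Printing Implicit Defensive.
Import Order.TTheory GRing.Theory Num.Theory.
Import numFieldNormedType.Exports.
Local Open Scope classical_set_scope.
Local Open Scope ring_scope.

(* For a matrix or a vector A, the library norm `|A| is max_{i,j} |A i j|: it
   is both the entrywise matrix norm ||A||_oo and the vector norm ||v||_oo. *)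

Definition norm2 (R : realType) (p : nat) (v : 'cV[R]_p) : R :=
  Num.sqrt (\sum_j v j 0 ^+ 2).

Definition norm0 (R : realType) (p : nat) (v : 'cV[R]_p) : nat :=
  #|[pred j : 'I_p | v j 0 != 0]|.

Definition restr (R : realType) (p : nat) (J : {set 'I_p}) (v : 'cV[R]_p)
    : 'cV[R]_p :=
  \col_j (if j \in J then v j 0 else 0).

Section std_normal.
Variable R : realType.

Definition std_normal_cdf (x : R) : R := fine (normal_prob (0 : R) 1 `]-oo, x]).

(* For 0 < u < 1 this is the inverse of the (continuous, strictly increasing)
   function std_normal_cdf at u. *)
Definition std_normal_quantile (u : R) : R :=
  inf [set x : R | u <= std_normal_cdf x].

End std_normal.

Section probability_notions.
Context {R : realType} {d : measure_display} {Omega : measurableType d}.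
Variable P : probability Omega R.

Definition sigma_mx (m k : nat) (M : Omega -> 'M[R]_(m, k))
    : set_system Omega :=
  <<s [set A | exists i j, exists2 B : set R,
         measurable B & A = (fun omega => M omega i j) @^-1` B] >>.

Definition random_mx (m k : nat) (M : Omega -> 'M[R]_(m, k)) : Prop :=
  forall i j, measurable_fun setT (fun omega => M omega i j).

(* The product rule for subfamilies of 'I_m is the case A i = setT for the
   indices i outside the subfamily. *)
Definition independent_family (m : nat) (F : 'I_m -> set_system Omega) : Prop :=
  forall A : 'I_m -> set Omega, (forall i, F i (A i)) ->
    P (\bigcap_i A i) = (\prod_(i < m) P (A i))%E.

Definition independent_rows (m k : nat) (M : Omega -> 'M[R]_(m, k)) : Prop :=
  independent_family (fun i => sigma_mx (fun omega => row i (M omega))).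

Definition independent_mx (m k m' k' : nat)
    (M : Omega -> 'M[R]_(m, k)) (N : Omega -> 'M[R]_(m', k')) : Prop :=
  forall A B, sigma_mx M A -> sigma_mx N B -> P (A `&` B) = (P A * P B)%E.

Definition subgaussian (zeta : Omega -> R) (s2 : R) : Prop :=
  ('E_P[zeta] = 0)%E /\
  forall t : R, ('E_P[(fun omega => expR (t * zeta omega))%R]
                  <= (expR (t ^+ 2 * s2 / 2))%:E)%E.

Definition subgaussian_vec (p : nat) (w : Omega -> 'rV[R]_p) (s2 : R) : Prop :=
  forall v : 'cV[R]_p, norm2 v = 1 ->
    subgaussian (fun omega => (w omega *m v) 0 0) s2.

End probability_notions.

Section design.
Context {R : realType} {n p : nat}.
Variable X : 'M[R]_(n, p).

Definition m2 : R :=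
  \big[Num.max/0]_(j < p) (n%:R^-1 * \sum_(i < n) X i j ^+ 2).

Definition Psi : 'M[R]_p := n%:R^-1 *: (X^T *m X).

(* The values Delta^T Psi Delta over all J with |J| <= k and all unit vectors
   Delta supported in J.  The two nested extrema are taken at once over this
   set: J = set0 carries no unit vector, and must not contribute the
   conventional value inf set0 = 0. *)
Definition sparse_values (k : nat) : set R :=
  [set r | exists2 J : {set 'I_p}, (#|J| <= k)%N &
     exists2 D : 'cV[R]_p, (forall j, j \notin J -> D j 0 = 0) /\ norm2 D = 1 &
       r = (D^T *m Psi *m D) 0 0].

Definition phi_min (k : nat) : R := inf (sparse_values k).
Definition phi_max (k : nat) : R := sup (sparse_values k).

End design.

(* Row i of X, W and xi is x_i, w_i and xi_i. *)
Section errors_in_variables.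
Context {R : realType} {n p : nat} {d : measure_display}
        {Omega : measurableType d}.
Variables (P : probability Omega R) (X : 'M[R]_(n, p)) (beta0 : 'cV[R]_p)
          (xi : Omega -> 'cV[R]_n) (W : Omega -> 'M[R]_(n, p)).

Definition obs_y (omega : Omega) : 'cV[R]_n := X *m beta0 + xi omega.
Definition obs_z (omega : Omega) : 'M[R]_(n, p) := X + W omega.

Definition Ew (i : 'I_n) (j k : 'I_p) : R :=
  fine 'E_P[(fun omega => W omega i j * W omega i k)].

Definition Gamma : 'M[R]_p :=
  \matrix_(j, k) (n%:R^-1 * \sum_(i < n) Ew i j k).

Definition eiv_model : Prop :=
  [/\ random_mx xi, random_mx W,
      independent_rows P (fun omega => row_mx (obs_y omega) (obs_z omega))
    & is_diag_mx Gamma].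

Record condition_A (s : nat) (C sigma_w sigma_xi : R) : Prop := {
  A_sparse : (norm0 beta0 <= s)%N;
  A_xi_indep : independent_rows P xi;
  A_xi_subgaussian :
    forall i, subgaussian P (fun omega => xi omega i 0) (sigma_xi ^+ 2);
  A_sigma_xi : sigma_xi ^+ 2 <= C;
  A_w_indep : independent_rows P W;
  A_w_subgaussian :
    forall i, subgaussian_vec P (fun omega => row i (W omega)) (sigma_w ^+ 2);
  A_sigma_w : sigma_w ^+ 2 <= C;
  A_w_uncorrelated : forall i (j k : 'I_p), (j < k)%N ->
    ('E_P[(fun omega => W omega i j * W omega i k)%R] = 0)%E;
  A_w_xi_indep : independent_mx P W xi
}.

Definition score_U (i : 'I_n) (j : 'I_p) (omega : Omega) : R :=
  obs_z omega i j * (xi omega i 0 - (W omega *m beta0) i 0)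
  + Ew i j j * beta0 j 0.

Definition calU (j : 'I_p) (k : nat) : R :=
  (n%:R^-1 *
   \sum_(i < n) fine 'E_P[(fun omega => `|score_U i j omega| ^+ k)])
  `^ (k%:R^-1).

Definition DeltaB (j : 'I_p) : R :=
  `|beta0 j 0| * \big[Num.max/0]_(i < n) `|Ew i j j - Gamma j j|.

(* The argument l is the value at n of the sequence l_n. *)
Record condition_B (hGamma : Omega -> 'M[R]_p) (b eps alpha l : R) : Prop := {
  B_diag : forall omega, is_diag_mx (hGamma omega);
  B_Gamma : (P [set omega | (b < `|hGamma omega - Gamma|)%R] <= eps%:E)%E;
  B_calU_pos : forall j, 0 < calU j 2;
  B_ratio :
    \big[Num.max/0]_(j < p) (calU j 3 / calU j 2) *
    std_normal_quantile (1 - alpha / (2 * p%:R * n%:R))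
      <= n%:R `^ (6^-1) / l;
  B_Delta :
    \big[Num.max/0]_(j < p | 0 < DeltaB j)
       (n%:R `^ (- 6^-1) * (DeltaB j / calU j 2)) *
    std_normal_quantile (1 - alpha / (2 * p%:R * n%:R))
      <= l^-1;
  B_n : 4 * ln (2 * p%:R * n%:R / alpha) <= n%:R
}.

End errors_in_variables.

Section refitted_estimator.
Context {R : realType} {n p : nat}.
Variables (y : 'cV[R]_n) (Z : 'M[R]_(n, p)) (hG : 'M[R]_p) (T : {set 'I_p}).

Definition refit_feasible (beta t : 'cV[R]_p) : Prop :=
  (forall j, j \in T ->
     `|n%:R^-1 * \sum_(i < n) Z i j * (y i 0 - (Z *m beta) i 0)
       + hG j j * beta j 0| <= t j 0) /\
  (forall j, j \notin T -> beta j 0 = 0 /\ t j 0 = 0).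

Definition refit_solution (beta t : 'cV[R]_p) : Prop :=
  refit_feasible beta t /\
  forall beta' t', refit_feasible beta' t' -> `|t| <= `|t'|.

End refitted_estimator.

(* Main.v *)
(* On an event of large probability the entrywise errors of the Gram matrix are
   at most a fraction of phi_min / (khat + s), so the normal equations restricted
   to the selected support have an exact solution; the minimum is then 0 and the
   error v - e (v supported on T, e the missed part of beta0) satisfies
   <v, Psi (v - e)> = <v, E (v - e)> + <v, r> with r a pure noise term.
   Cauchy-Schwarz for the form Psi - phi_min gives
   <v, Psi e>^2 <= (<v, Psi v> - phi_min |v|^2) (phi_max - phi_min) |e|^2,
   which leaves enough room below the constant 1 in front of |e| to absorb the
   perturbation E, except when phi_max <= 20 phi_min.  In that case <v, E e> must
   be of the order of the noise, uniformly over the data-driven support: one uses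
   |E e|_2^2 <= |E e|_oo |E e|_1, the entrywise bound for the first factor, and
   for the second one Chernoff bounds and a union bound over all triples (sign
   vector, support, missed set), the cost of each of the at most khat + s
   coordinates being log p. *)

Require Import Defs.
From HB Require Import structures.
From mathcomp Require Import all_boot all_order all_algebra.
From mathcomp Require Import all_classical all_reals all_analysis.
From mathcomp Require Import measurable_realfun ring lra.
Set Implicit Arguments.
Unset Strict Implicit.
Unset Printing Implicit Defensive.
Import Order.TTheory GRing.Theory Num.Theory.
Import numFieldNormedType.Exports.
Local Open Scope classical_set_scope.
Local Open Scope ring_scope.

(** * Expectations of independent products *)

(** The constant 1 in front of |e| shapes the proof: nothing proportional to |e| may be lost. As v
    and e have disjoint supports, |v - e|^2 = |v|^2 + |e|^2, so the target is |v|^2 <= (phi_max /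
    phi_min - 1) |e|^2 up to noise. For E = 0 this holds with a spare factor 1/4, and that factor
    pays for <v, E v>, which may reach 3/5 phi_min |v|^2. The cross term <v, E e> is the obstacle:
    the threshold condition only makes it a fixed fraction of phi_min |v| |e|, while the room
    vanishes as phi_max / phi_min tends to 1. Moreover the selected support depends on the noise,
    hence e does too, and no tail bound for a fixed vector applies. A bounded ratio helps in turn,
    since it bounds phi_max by a multiple of m_2. The union bound leaves a surplus factor khat + s
    in the l1 norm; the sup norm, of order phi_min / (khat + s), cancels it, so that only (khat +
    s)^{1/2} and log p remain. *)

Section integral_factorization.
Local Open Scope ereal_scope.
Context {R : realType} {d : measure_display} {Omega : measurableType d}.
Variable P : probability Omega R.
Import HBNNSimple.

Lemma expectationE (f : Omega -> R) : 'E_P[f] = \int[P]_w (f w)%:E.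
Proof. by rewrite unlock. Qed.

Lemma ge0_expectationZl (k : R) (f : Omega -> R) : (0 <= k)%R ->
  measurable_fun setT f -> (forall w, 0 <= f w)%R ->
  'E_P[(fun w => k * f w)%R] = k%:E * 'E_P[f].
Proof.
move=> k0 mf f0; rewrite !expectationE; under eq_integral do rewrite EFinM.
by rewrite ge0_integralZl_EFin// => [w _|]; [rewrite lee_fin|exact/measurable_EFinP].
Qed.

Lemma ge0_expectationD (f g : Omega -> R) :
  measurable_fun setT f -> (forall w, 0 <= f w)%R ->
  measurable_fun setT g -> (forall w, 0 <= g w)%R ->
  'E_P[(fun w => f w + g w)%R] = 'E_P[f] + 'E_P[g].
Proof.
move=> mf f0 mg g0; rewrite !expectationE; under eq_integral do rewrite EFinD.
by rewrite ge0_integralD// => [w _||w _|]; rewrite ?lee_fin//; exact/measurable_EFinP.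
Qed.

Lemma ge0_expectation_le (f g : Omega -> R) :
  measurable_fun setT f -> (forall w, 0 <= f w)%R ->
  measurable_fun setT g -> (forall w, f w <= g w)%R ->
  'E_P[f] <= 'E_P[g].
Proof.
move=> mf f0 mg fg; rewrite !expectationE; apply: ge0_le_integral => //.
- by move=> w _; rewrite lee_fin.
- exact/measurable_EFinP.
- exact/measurable_EFinP.
- by move=> w _; rewrite lee_fin.
Qed.

(** Here [c] is the mean of [G]. Once [G] factors against the indicators of the generated
    sigma-algebra, linearity on simple functions and monotone convergence extend this to every
    nonnegative [f] measurable for it. *)
Lemma ge0_integral_factor (F : set_system Omega) (G : Omega -> R)
    (c : R) (f : Omega -> R) :
  F `<=` measurable ->
  measurable_fun setT G -> (forall w, 0 <= G w)%R -> (0 <= c)%R ->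
  (forall A, <<s F >> A -> \int[P]_w (G w * \1_A w)%:E = c%:E * P A) ->
  measurable_fun setT (f : g_sigma_algebraType F -> R) ->
  (forall w, (0 <= f w)%R) ->
  \int[P]_w (G w * f w)%:E = c%:E * \int[P]_w (f w)%:E.
Proof.
move=> Fm mG G0 c0 H mf f0.
have Fs A : <<s F >> A -> measurable A.
  exact: (smallest_sub (@sigma_algebra_measurable _ Omega) Fm).
have mfE : measurable_fun setT (EFin \o f : g_sigma_algebraType F -> \bar R).
  exact/measurable_EFinP.
(* The approximants are built on the space carrying the generated sigma-algebra, so their level sets
   belong to it and the product rule applies to them. *)
pose h := nnsfun_approx measurableT mfE.
have hA n r : <<s F >> (h n @^-1` [set r]).
  by rewrite -[X in <<s _ >> X]setTI; exact: (measurable_funP (h n)).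
have mA n r : measurable (h n @^-1` [set r] : set Omega) by exact: (Fs _ (hA n r)).
have mh n : measurable_fun setT (h n : Omega -> R).
  move=> _ B mB; rewrite setTI; apply: Fs.
  by rewrite -[X in <<s _ >> X]setTI; exact: (measurable_funP (h n)).
have hcvg w : EFin \o h ^~ w @ \oo --> (f w)%:E.
  by apply: (cvg_nnsfun_approx measurableT mfE) => // x _; rewrite /= lee_fin.
have hnd w : nondecreasing_seq (fun n => (h n w)%:E).
  by move=> a b ab; rewrite lee_fin; exact/lefP/nd_nnsfun_approx.
have cv : \int[P]_w (h n w)%:E @[n --> \oo] --> \int[P]_w (f w)%:E.
  rewrite (eq_integral (fun w : Omega => limn (fun n => (h n w)%:E))); last first.
    by move=> w _; apply/esym/cvg_lim => //; exact: hcvg.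
  apply: cvg_monotone_convergence => //.
  - by move=> n; exact/measurable_EFinP.
  - by move=> n w _; rewrite lee_fin.
have cvG : \int[P]_w (G w * h n w)%:E @[n --> \oo] --> \int[P]_w (G w * f w)%:E.
  rewrite (eq_integral (fun w : Omega => limn (fun n => (G w * h n w)%:E))); last first.
    move=> w _; apply/esym/cvg_lim => //.
    by rewrite EFinM; under eq_fun do rewrite EFinM; apply: cvgeZl => //; exact: hcvg.
  apply: cvg_monotone_convergence => //.
  - by move=> n; apply/measurable_EFinP; exact: measurable_funM.
  - by move=> n w _; rewrite lee_fin mulr_ge0.
  - by move=> w _ a b ab; rewrite !EFinM lee_wpmul2l ?lee_fin// -lee_fin; exact: hnd.
have suf n : \int[P]_w (G w * h n w)%:E = c%:E * \int[P]_w (h n w)%:E.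
  have E w : (h n w)%:E =
     \sum_(y \in range (h n)) (y * \1_(h n @^-1` [set y]) w)%:E.
    by rewrite fimfunE -fsumEFin.
  have ge0 y w : 0 <= (y * \1_(h n @^-1` [set y]) w)%:E.
    exact: nnfun_muleindic_ge0.
  have mi y : measurable_fun [set: Omega]
      (fun w : Omega => (y * \1_(h n @^-1` [set y]) w)%:E).
    by apply/measurable_EFinP; apply: measurable_funM => //; exact: measurable_indic.
  under eq_integral do rewrite EFinM E ge0_mule_fsumr//.
  under [in RHS]eq_integral do rewrite E.
  rewrite !ge0_integral_fsum//; last 2 first.
  - by move=> y; apply: emeasurable_funM => //; exact/measurable_EFinP.
  - by move=> y w _; rewrite mule_ge0// lee_fin.
  rewrite ge0_mule_fsumr; last by move=> y; apply: integral_ge0 => w _.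
  apply: eq_fsbigr => y /[!inE] -[t _ <-].
  under eq_integral do rewrite -EFinM mulrCA EFinM.
  under [in RHS]eq_integral do rewrite EFinM.
  have := mA n (h n t); have := hA n (h n t).
  set A : set Omega := h n @^-1` [set h n t] => FA mA'.
  have mi1 : measurable_fun [set: Omega] (\1_A : Omega -> R).
    exact: measurable_indic.
  rewrite [LHS]ge0_integralZl_EFin//; last 2 first.
  - by move=> w _; rewrite lee_fin mulr_ge0.
  - by apply/measurable_EFinP; exact: measurable_funM.
  rewrite [in RHS]ge0_integralZl_EFin//; last exact/measurable_EFinP.
  by rewrite H// integral_indic// setIT muleCA.
rewrite -(cvg_lim _ cvG)//; apply: cvg_lim => //.
by rewrite (eq_cvg _ _ suf); exact: cvgeZl.
Qed.

(** A hybrid argument: starting from indicators, where the claim is independence itself, the factors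
    are replaced by [f i] one index at a time. Arbitrary sets [A i] are kept in the remaining
    positions to make the induction go through. *)
Lemma independent_expectation_prod (m : nat) (F : 'I_m -> set_system Omega)
    (f : 'I_m -> Omega -> R) (c : 'I_m -> R) :
  (forall i, F i `<=` measurable) ->
  independent_family P (fun i => <<s F i >>) ->
  (forall i, measurable_fun setT (f i : g_sigma_algebraType (F i) -> R)) ->
  (forall i w, (0 <= f i w)%R) ->
  (forall i, 'E_P[f i] = (c i)%:E) ->
  'E_P[(fun w => \prod_i f i w)%R] = (\prod_i c i)%:E.
Proof.
move=> Fm indep mf f0 Ef.
have Fs i A : <<s F i >> A -> measurable A.
  exact: (smallest_sub (@sigma_algebra_measurable _ Omega) (@Fm i)).
have mfO i : measurable_fun setT (f i).
  move=> _ B mB; apply: (Fs i); exact: (mf i measurableT B mB).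
have c0 i : (0 <= c i)%R by rewrite -lee_fin -Ef expectation_ge0.
pose h (k : nat) (A : 'I_m -> set Omega) (i : 'I_m) : Omega -> R :=
  if (i < k)%N then f i else \1_(A i).
pose q (k : nat) (A : 'I_m -> set Omega) (i : 'I_m) : R :=
  if (i < k)%N then c i else fine (P (A i)).
have PA A : measurable A -> (fine (P A))%:E = P A.
  by move=> mA; rewrite fineK// fin_num_measure.
suff claim k : (k <= m)%N -> forall A, (forall i, <<s F i >> (A i)) ->
    \int[P]_w (\prod_i h k A i w)%:E = (\prod_i q k A i)%:E.
  have := claim m (leqnn m) (fun=> setT)
    (fun i => @measurableT _ (g_sigma_algebraType (F i))).
  rewrite expectationE (eq_integral (fun w => (\prod_i f i w)%:E)); last first.
    by move=> w _; congr EFin; apply: eq_bigr => i _; rewrite /h ltn_ord.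
  by move=> ->; congr EFin; apply: eq_bigr => i _; rewrite /q ltn_ord.
elim: k => [_|k IH km] A FA.
  rewrite (eq_integral (fun w => (\1_(\bigcap_i A i) w)%:E)); last first.
    move=> w _; congr EFin; rewrite indicE; have [wA|wA] := boolP (w \in _).
      rewrite big1// => i _; rewrite /h ltn0 indicE mem_set//.
      by move: wA; rewrite inE; apply.
    have /existsNP[i] : ~ (forall i, A i w).
      by move=> H; move: wA; rewrite notin_setE; apply => i _; exact: H.
    move=> wi; rewrite (bigD1 i)//= {1}/h ltn0 indicE memNset// mul0r//.
  rewrite integral_indic//; last first.
    by apply: fin_bigcap_measurable => // i _; exact: (Fs i).
  rewrite setIT; transitivity (\prod_(i < m) P (A i)); first exact: indep.
  rewrite -prodEFin. apply: eq_bigr => i _.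
  by rewrite /q ltn0 PA//; exact: (Fs i).
pose i0 := Ordinal km.
pose G w := (\prod_(i | i != i0) h k A i w)%R.
have mhi i w : (0 <= h k A i w)%R.
  by rewrite /h; case: ifP => _; rewrite ?f0// indicE.
have mh i : measurable_fun setT (h k A i).
  by rewrite /h; case: ifP => _ //; apply: measurable_indic; exact: (Fs i).
rewrite (eq_integral (fun w => (G w * f i0 w)%:E)); last first.
  move=> w _; congr EFin; rewrite (bigD1 i0)//= mulrC; congr (_ * _)%R.
    by apply: eq_bigr => i ii0; rewrite /h ltnS [(i <= k)%N]leq_eqVlt (negbTE (ii0 : nat_of_ord i != k)).
  by rewrite /h ltnS leqnn.
have mG : measurable_fun setT G.
  rewrite (_ : G = fun w => \prod_i (if i != i0 then h k A i w else 1))%R; last first.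
    by apply/funext => w; exact: big_mkcond.
  by apply: measurable_prod => i _; case: (i != i0).
rewrite (@ge0_integral_factor (F i0) G (\prod_(i | i != i0) q k A i)%R)//.
- rewrite -expectationE Ef -EFinM; congr EFin.
  rewrite [RHS](bigD1 i0)//= mulrC /q ltnS leqnn; congr (_ * _)%R.
  by apply: eq_bigr => i ii0; rewrite ltnS [(i <= k)%N]leq_eqVlt (negbTE (ii0 : nat_of_ord i != k)).
- by move=> w; apply: prodr_ge0.
- apply: prodr_ge0 => i _; rewrite /q; case: ifP => // _.
  by apply: fine_ge0.
(* Testing against [B] puts an indicator at index [k], which is an instance of the previous
   stage. *)
move=> B FB; pose A' i := if i == i0 then B else A i.
have FA' i : <<s F i >> (A' i) by rewrite /A'; case: eqP => // ->.
have := IH (ltnW km) A' FA'.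
rewrite (eq_integral (fun w => (G w * \1_B w)%:E)); last first.
  move=> w _; congr EFin; rewrite (bigD1 i0)//= mulrC; congr (_ * _)%R.
    by apply: eq_bigr => i ii0; rewrite /h /A' (negbTE ii0).
  by rewrite /h ltnn /A' eqxx.
move=> ->; rewrite -(PA B); last exact: (Fs i0).
rewrite -EFinM; congr EFin; rewrite (bigD1 i0)//= mulrC; congr (_ * _)%R.
  by apply: eq_bigr => i ii0; rewrite /q /A' (negbTE ii0).
by rewrite /q ltnn /A' eqxx.
Qed.

End integral_factorization.

(** * Exponential moments and tail bounds *)

Section exponential_bounds.
Context {R : realType}.
Implicit Types x y : R.

(** From 1 - 1/6 <= exp(-1/6) one gets exp(1/6) <= 6/5, and (6/5)^6 = 2.985984. *)
Lemma expR1_le3 : expR 1 <= 3 :> R.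
Proof.
have h : expR (6^-1) <= 6 / 5 :> R.
  have := expR_ge1Dx (- 6^-1 : R); rewrite expRN => h.
  rewrite -[leLHS]invrK -[leRHS]invrK lef_pV2 ?posrE ?invr_gt0 ?expR_gt0//; lra.
rewrite -(@mulfV R 6)// expRM_natl.
rewrite (le_trans (lerXn2r 6 _ _ h)) ?nnegrE ?expR_ge0//; lra.
Qed.

(** The linear term is kept exact, so that centring removes it after taking expectations and only a
    second-order error is left. *)
Lemma expR_le_quad x : expR x <= 1 + x + x ^+ 2 * expR `|x|.
Proof.
have h y : expR y - 1 <= y * expR y.
  have := expR_ge1Dx (- y); rewrite expRN => h.
  have e0 := expR_gt0 y.
  have := ler_wpM2r (ltW e0) h; rewrite mulVf ?gt_eqF// => {}h; lra.
suff : x * (expR x - 1) <= x ^+ 2 * expR `|x| by move: (h x) => *; lra.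
have [x0|x0] := leP 0 x.
  by rewrite ger0_norm// expr2 -mulrA ler_wpM2l.
have h1 := expR_ge1Dx x.
have h2 : 1 <= expR `|x| by rewrite -[leLHS]expR0 ler_expR.
nra.
Qed.

Lemma sqr_le_expR y : 0 <= y -> y ^+ 2 <= 2 * expR y.
Proof.
by move=> y0; have := expR_ge1Dxn 1 y0; rewrite [(2`!)%:R](_ : _ = 2) // => h; lra.
Qed.

Lemma double_fact_le n : ((n.*2)`! <= n`! * n.*2 ^ n)%N.
Proof.
have h k : (k <= n)%N -> ((n + k)`! <= n`! * n.*2 ^ k)%N.
  elim: k => [|k IH] kn; first by rewrite addn0 expn0 muln1.
  rewrite addnS factS expnS mulnCA leq_mul ?IH ?(ltnW kn)//.
  by rewrite -addnn -addnS leq_add2l.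
by have := h n (leqnn n); rewrite addnn.
Qed.

Lemma pow_fact_le_exp2 x n : `|x| ^+ n / n`!%:R <= expR x + expR (- x).
Proof.
have h y : 0 <= y -> y ^+ n / n`!%:R <= expR y.
  case: n => [|n] y0; last by have := expR_ge1Dxn n y0; move=> *; lra.
  by rewrite expr0 fact0 divr1 -[leLHS]expR0 ler_expR.
have [x0|x0] := leP 0 x.
  by rewrite ger0_norm// (le_trans (h _ x0))// lerDl expR_ge0.
have := h (- x); rewrite oppr_ge0 ltW// ltr0_norm// => /(_ isT) {}h.
by have := expR_ge0 x; lra.
Qed.

(** For the n-th power of the square only the exponents t = sqrt(2n) and -t are needed: (t x)^(2n) /
    (2n)! is at most exp(t x) + exp(-t x), and (2n)! <= n! (2n)^n = n! t^(2n). Moments of a square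
    thus follow from the moment generating function without integrating over t. *)
Lemma sq_pow_fact_le x n :
  (x ^+ 2 / 6) ^+ n / n`!%:R <=
  6^-1 ^+ n * (expR (Num.sqrt n.*2%:R * x) + expR (- Num.sqrt n.*2%:R * x)).
Proof.
have := pow_fact_le_exp2 (Num.sqrt n.*2%:R * x) n.*2; rewrite -mulNr => h.
rewrite expr_div_n mulrAC -exprVn [leLHS]mulrC ler_wpM2l ?exprn_ge0//.
apply: le_trans h; rewrite normrM (ger0_norm (sqrtr_ge0 _)).
have e2 y : y ^+ n.*2 = (y ^+ 2) ^+ n :> R by rewrite -muln2 mulnC exprM.
rewrite e2 [(_ * `|x|) ^+ 2]exprMn [in leRHS]exprMn real_normK ?num_real// sqr_sqrtr//.
have := double_fact_le n; rewrite -(ler_nat R) natrM natrX => hF.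
rewrite ler_pdivrMr ?ltr0n ?fact_gt0// mulrAC ler_pdivlMr ?ltr0n ?fact_gt0//.
have q0 : 0 <= (x ^+ 2) ^+ n by rewrite exprn_ge0 ?sqr_ge0.
by apply: le_trans (ler_wpM2l q0 hF) _; rewrite le_eqVlt; apply/orP; left; apply/eqP; ring.
Qed.

End exponential_bounds.

Section subgaussian_square.
Context {R : realType} {d : measure_display} {Omega : measurableType d}.
Variable P : probability Omega R.

(** For m >= 1, term m of the exponential series has mean at most 6^-m times 2 exp(m), hence at most
    2 times 2^-m because exp(1) <= 3. The total is at most 1 + 2, and monotone convergence passes to
    the limit. *)
Lemma expectation_exp_sq (U : Omega -> R) :
  measurable_fun setT U ->
  (forall t : R, ('E_P[(fun w => expR (t * U w))%R] <= (expR (t ^+ 2 / 2))%:E)%E) ->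
  ('E_P[(fun w => expR (U w ^+ 2 / 6))%R] <= 3%:E)%E.
Proof.
move=> mU hU.
pose S N w : R := series (exp_coeff (U w ^+ 2 / 6)) N.
pose tm (m : nat) : R := Num.sqrt (m.*2)%:R.
have mexp t : measurable_fun setT (fun w => expR (t * U w)).
  by apply: measurableT_comp => //; exact: measurable_funM.
have mS N : measurable_fun setT (S N).
  rewrite /S /series; apply: measurable_sum => i /=.
  rewrite /exp_coeff/=; apply: measurable_funM => //.
  apply: measurable_funX; apply: measurable_funM => //; exact: measurable_funX.
have S0 N w : 0 <= S N w.
  by apply: sumr_ge0 => i _; rewrite /exp_coeff/= divr_ge0// exprn_ge0// divr_ge0// sqr_ge0.
have S_le N w : S N.+1 w <= 1 + \sum_(i < N)
    6^-1 ^+ i.+1 * (expR (tm i.+1 * U w) + expR (- tm i.+1 * U w)).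
  rewrite /S /series/= big_nat_recl// big_mkord /exp_coeff/= expr0 fact0 divr1 lerD2l.
  apply: ler_sum => i _.
  exact: sq_pow_fact_le.
have Snd w a b : (a <= b)%N -> S a w <= S b w.
  move=> ab; apply: nondecreasing_series => // k _ _.
  by rewrite /exp_coeff/= divr_ge0// exprn_ge0// divr_ge0// sqr_ge0.
suff ES N : ('E_P[S N.+1] <= 3%:E)%E.
  rewrite expectationE (eq_integral (fun w => limn (fun N => (S N w)%:E))); last first.
    move=> w _; rewrite EFin_lim//; exact: is_cvg_series_exp_coeff.
  rewrite monotone_convergence//; last 3 first.
  - by move=> n; exact/measurable_EFinP.
  - by move=> n w _; rewrite lee_fin.
  - by move=> w _ a b ab; rewrite lee_fin Snd.
  under eq_fun do rewrite -expectationE.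
  apply: lime_le.
    by apply: ereal_nondecreasing_is_cvgn => a b ab; apply: ge0_expectation_le => // w; exact: Snd.
  by apply: nearW => N; apply: le_trans (ES N); apply: ge0_expectation_le => // w; exact: Snd.
pose B i w := 6^-1 ^+ i.+1 * (expR (tm i.+1 * U w) + expR (- tm i.+1 * U w)).
have mB i : measurable_fun setT (B i).
  by apply: measurable_funM => //; exact: measurable_funD.
have B0 i w : 0 <= B i w.
  by rewrite mulr_ge0 ?exprn_ge0// addr_ge0 ?expR_ge0.
have EB i : ('E_P[B i] <= (2^-1 ^+ i)%:E)%E.
  rewrite ge0_expectationZl ?exprn_ge0//; last exact: measurable_funD.
  rewrite ge0_expectationD//; try by move=> w; exact: expR_ge0.
  have h1 := hU (tm i.+1); have h2 := hU (- tm i.+1).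
  rewrite sqrrN in h2.
  have e : tm i.+1 ^+ 2 / 2 = i.+1%:R.
    by rewrite sqr_sqrtr// -muln2 natrM mulfK.
  rewrite e in h1 h2.
  apply: (@le_trans _ _ ((6^-1 ^+ i.+1)%:E * (expR i.+1%:R + expR i.+1%:R)%:E)%E).
    by rewrite lee_wpmul2l ?lee_fin ?exprn_ge0// EFinD leeD.
  rewrite -EFinM lee_fin (_ : expR i.+1%:R = expR 1 ^+ i.+1); last by rewrite -expRM_natl mulr1.
  have h : expR 1 ^+ i.+1 <= 3 ^+ i.+1 :> R.
    by rewrite lerXn2r ?nnegrE ?expR_ge0 ?expR1_le3.
  have -> : 2^-1 ^+ i = 6^-1 ^+ i.+1 * (3 ^+ i.+1 + 3 ^+ i.+1) :> R.
    rewrite -mulr2n mulrnAr -exprMn.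
    by rewrite (_ : 6^-1 * 3 = 2^-1 :> R) ?exprS; [field|lra].
  by rewrite ler_wpM2l ?exprn_ge0// lerD.
have ESb : ('E_P[(fun w => \sum_(i < N) B i w)%R] <= (\sum_(i < N) 2^-1 ^+ i)%:E)%E.
  elim: N => [|N IH].
    rewrite (_ : (fun w => _) = cst 0); last by apply/funext => w; rewrite big_ord0.
    by rewrite big_ord0 expectation_cst.
  rewrite (_ : (fun w => _) = fun w => \sum_(i < N) B i w + B N w); last first.
    by apply/funext => w; rewrite big_ord_recr.
  rewrite big_ord_recr/= ge0_expectationD// => [||w].
  - by rewrite EFinD leeD.
  - exact: measurable_sum.
  - exact: sumr_ge0.
apply: (@le_trans _ _ ('E_P[(fun w => 1 + \sum_(i < N) B i w)%R])%E).
  apply: ge0_expectation_le => //.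
  by apply: measurable_funD => //; exact: measurable_sum.
rewrite ge0_expectationD//; last 2 first.
- exact: measurable_sum.
- by move=> w; exact: sumr_ge0.
rewrite expectation_cst (_ : 3 = 1 + 2 :> R)// EFinD leeD2l// (le_trans ESb)// lee_fin.
elim: N {ESb} => [|N IH]; first by rewrite big_ord0.
rewrite big_ord_recl expr0; under eq_bigr do rewrite lift0 exprS.
by rewrite -mulr_sumr; lra.
Qed.
End subgaussian_square.

Section product_mgf.
Context {R : realType} {d : measure_display} {Omega : measurableType d}.
Variable P : probability Omega R.

(** With y = |u v| / 12 one has |t u v| <= y; the square is absorbed by y^2 <= 2 exp(y), and exp(2
    y) = exp(|u v| / 6) is at most the average of the two square exponentials, whose means are
    bounded by [expectation_exp_sq]. *)
Lemma expR_mul_le (t u v : R) : `|t| <= 12^-1 ->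
  expR (t * (u * v)) <=
  1 + (t * (u * v) + 144 * t ^+ 2 * (expR (u ^+ 2 / 6) + expR (v ^+ 2 / 6))).
Proof.
move=> t12; set a := expR (u ^+ 2 / 6); set b := expR (v ^+ 2 / 6).
apply: le_trans (expR_le_quad _) _; rewrite -addrA lerD2l lerD2l.
pose y := `|u * v| / 12.
have y0 : 0 <= y by rewrite divr_ge0.
have ty : `|t * (u * v)| <= y by rewrite normrM mulrC ler_wpM2l.
have h1 : expR y * expR y <= (a + b) / 2.
  have ab : expR y * expR y <= expR (u ^+ 2 / 12) * expR (v ^+ 2 / 12).
    rewrite -!expRD ler_expR /y normrM.
    have := sqr_ge0 (`|u| - `|v|); rewrite sqrrB !real_normK ?num_real// => h.
    lra.
  apply: le_trans ab _.
  have -> : a = expR (u ^+ 2 / 12) ^+ 2.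
    by rewrite -expRM_natl; congr expR; field.
  have -> : b = expR (v ^+ 2 / 12) ^+ 2.
    by rewrite -expRM_natl; congr expR; field.
  have := sqr_ge0 (expR (u ^+ 2 / 12) - expR (v ^+ 2 / 12)); nra.
have h2 : (t * (u * v)) ^+ 2 = 144 * t ^+ 2 * y ^+ 2.
  by rewrite /y expr_div_n real_normK ?num_real//; field.
have h3 := sqr_le_expR y0.
have h4 : expR `|t * (u * v)| <= expR y by rewrite ler_expR.
have c0 : 0 <= 144 * t ^+ 2 by rewrite mulr_ge0 ?sqr_ge0.
rewrite h2 -(mulrA (144 * t ^+ 2)) ler_wpM2l//.
have e0 := expR_gt0 y.
apply: (@le_trans _ _ (2 * expR y * expR y)); last by rewrite -mulrA; lra.
by rewrite ler_pM ?expR_ge0 ?sqr_ge0.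
Qed.

Variables (U V : Omega -> R).
Hypotheses (mU : measurable_fun setT U) (mV : measurable_fun setT V).
Hypothesis hU : forall t : R,
  ('E_P[(fun w => expR (t * U w))%R] <= (expR (t ^+ 2 / 2))%:E)%E.
Hypothesis hV : forall t : R,
  ('E_P[(fun w => expR (t * V w))%R] <= (expR (t ^+ 2 / 2))%:E)%E.

Let mexp (f : Omega -> R) : measurable_fun setT f ->
  measurable_fun setT (fun w => expR (f w ^+ 2 / 6)).
Proof.
by move=> mf; apply: measurableT_comp => //; apply: measurable_funM => //; exact: measurable_funX.
Qed.

Let E6 w := expR (U w ^+ 2 / 6) + expR (V w ^+ 2 / 6).

Let mE6 : measurable_fun setT E6.
Proof. by apply: measurable_funD; exact: mexp. Qed.

Let EE6 : ('E_P[E6] <= 6%:E)%E.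
Proof.
rewrite ge0_expectationD//; try exact: mexp.
rewrite (_ : (6%:E = 3%:E + 3%:E :> \bar R)%E).
  by apply: leeD; exact: expectation_exp_sq.
by rewrite -EFinD; congr EFin; lra.
Qed.

Let iE6 : E6 \in Lfun P 1.
Proof.
apply/Lfun1_integrable/integrableP; split; first exact/measurable_EFinP.
rewrite (eq_integral (fun w => (E6 w)%:E)); last first.
  by move=> w _; rewrite /= ger0_norm// addr_ge0 ?expR_ge0.
by rewrite -expectationE (le_lt_trans EE6)// ltry.
Qed.

Lemma mul_Lfun1 : (fun w => U w * V w) \in Lfun P 1.
Proof.
apply/Lfun1_integrable; apply: (@le_integrable _ _ _ _ _ measurableT _ (EFin \o (3 \o* E6))) => //.
- by apply/measurable_EFinP; exact: measurable_funM.
- move=> w _ /=; rewrite lee_fin [leRHS]ger0_norm ?mulr_ge0 ?addr_ge0 ?expR_ge0// /E6.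
  rewrite normrM.
  have h1 := expR_ge1Dx (U w ^+ 2 / 6); have h2 := expR_ge1Dx (V w ^+ 2 / 6).
  have := sqr_ge0 (`|U w| - `|V w|); rewrite sqrrB !real_normK ?num_real// => h.
  lra.
- by apply/Lfun1_integrable; exact: Lfun_scale.
Qed.

(** A product of two subgaussian variables is subexponential, whatever the dependence between them.
    The constant is 864 = 144 * 6, with 6 = 3 + 3 from the two square exponentials. *)
Lemma product_mgf (m t : R) : ('E_P[(fun w => U w * V w)%R] = m%:E)%E ->
  `|t| <= 12^-1 ->
  ('E_P[(fun w => expR (t * (U w * V w - m)))%R] <= (expR (864 * t ^+ 2))%:E)%E.
Proof.
move=> Em t12.
have mUV : measurable_fun setT (fun w => U w * V w) by exact: measurable_funM.
have mex : measurable_fun setT (fun w => expR (t * (U w * V w))).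
  by apply: measurableT_comp => //; exact: measurable_funM.
rewrite (_ : (fun w => _) = fun w => expR (- (t * m)) * expR (t * (U w * V w))); last first.
  by apply/funext => w; rewrite -expRD; congr expR; ring.
rewrite ge0_expectationZl ?expR_ge0//.
rewrite (_ : expR (864 * t ^+ 2) = expR (- (t * m)) * expR (t * m + 864 * t ^+ 2)); last first.
  by rewrite -expRD; congr expR; ring.
rewrite EFinM lee_wpmul2l ?lee_fin ?expR_ge0//.
apply: le_trans (_ : (1 + (t * m + 864 * t ^+ 2))%:E <= _)%E; last first.
  by rewrite lee_fin expR_ge1Dx.
apply: (@le_trans _ _ ('E_P[(cst 1 \+ (t \o* (fun w => U w * V w) \+ (144 * t ^+ 2) \o* E6))%R])%E).
  apply: ge0_expectation_le => //.
  - apply: measurable_funD => //; apply: measurable_funD; exact: measurable_funM.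
  - move=> w /=; have := @expR_mul_le t (U w) (V w) t12; rewrite /E6; lra.
rewrite expectationD; last 2 first.
- exact: Lfun_cst.
- by apply: rpredD; apply: Lfun_scale => //; exact: mul_Lfun1.
rewrite expectationD; last 2 first.
- by apply: Lfun_scale => //; exact: mul_Lfun1.
- exact: Lfun_scale.
rewrite expectation_cst !expectationZl//; last exact: mul_Lfun1.
rewrite Em !EFinD leeD2l// leeD2l//.
apply: (@le_trans _ _ ((144 * t ^+ 2)%:E * 6%:E)%E); last first.
  by rewrite -EFinM lee_fin; lra.
by rewrite lee_wpmul2l// lee_fin mulr_ge0 ?sqr_ge0.
Qed.

End product_mgf.

Section tails.
Context {R : realType} {d : measure_display} {Omega : measurableType d}.
Variables (P : probability Omega R) (n : nat).
Variable F : 'I_n -> set_system Omega.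
Hypothesis Fm : forall i, F i `<=` measurable.
Hypothesis indep : independent_family P (fun i => <<s F i >>).

Let mF (i : 'I_n) (f : Omega -> R) :
  measurable_fun setT (f : g_sigma_algebraType (F i) -> R) ->
  measurable_fun setT f.
Proof.
move=> mf _ B mB.
have Fs A : <<s F i >> A -> measurable A.
  exact: (smallest_sub (@sigma_algebra_measurable _ Omega) (@Fm i)).
by apply: Fs; exact: mf.
Qed.

Lemma expectation_fin_ge0 (f : Omega -> R) (c : R) : (forall w, 0 <= f w) ->
  ('E_P[f] <= c%:E)%E -> 'E_P[f]%E = (fine 'E_P[f])%:E.
Proof.
move=> f0 fc; rewrite fineK// ge0_fin_numE ?expectation_ge0//.
by rewrite (le_lt_trans fc)// ltry.
Qed.

Lemma chernoff_sum (f : 'I_n -> Omega -> R) (g : 'I_n -> R) (t x : R) :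
  (forall i, measurable_fun setT (f i : g_sigma_algebraType (F i) -> R)) ->
  0 < t ->
  (forall i, ('E_P[(fun w => expR (t * f i w))%R] <= (expR (g i))%:E)%E) ->
  (P [set w | (x <= \sum_i f i w)%R] <= (expR (\sum_i g i - t * x))%:E)%E.
Proof.
move=> mf t0 Ef.
have mS : measurable_fun setT (fun w => \sum_i f i w).
  by apply: measurable_sum => i; exact: (@mF i).
pose X : {RV P >-> R} := HB.pack (fun w => \sum_i f i w)
  (isMeasurableFun.Build _ _ _ _ _ mS).
have := @chernoff _ _ _ P X t x t0.
move=> /le_trans; apply.
rewrite expRD muleC EFinM [leRHS]muleC lee_wpmul2l ?lee_fin ?expR_ge0//.
rewrite /mmt_gen_fun (_ : _ \o _ = fun w => \prod_i expR (t * f i w)); last first.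
  apply/funext => w /=; rewrite mulr_suml expR_sum; apply: eq_bigr => i _.
  by rewrite mulrC.
pose c i := fine ('E_P[(fun w => expR (t * f i w))%R])%E.
have Ec i : 'E_P[(fun w => expR (t * f i w))%R]%E = (c i)%:E.
  by apply: expectation_fin_ge0 (Ef i) => w; exact: expR_ge0.
rewrite (@independent_expectation_prod _ _ _ P _ F _ c)//; last first.
  move=> i; apply: measurableT_comp => //; exact: measurable_funM.
rewrite lee_fin expR_sum; apply: ler_prod => i _.
by rewrite -!lee_fin -Ec Ef expectation_ge0.
Qed.

Lemma abs_tail_le (S : Omega -> R) (x e : R) : measurable_fun setT S ->
  (P [set w | (x <= S w)%R] <= e%:E)%E ->
  (P [set w | (x <= - S w)%R] <= e%:E)%E ->
  (P [set w | (x < `|S w|)%R] <= (2 * e)%:E)%E.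
Proof.
move=> mS h1 h2.
have mN : measurable_fun setT (fun w => - S w) by exact: measurableT_comp.
have mA : measurable_fun setT (fun w => `|S w|) by exact: measurableT_comp.
have mge (g : Omega -> R) : measurable_fun setT g -> measurable [set w | x <= g w].
  move=> mg; have := mg measurableT _ (measurable_itv `[x, +oo[); rewrite setTI.
  by congr measurable; apply/seteqP; split => w /=; rewrite in_itv/= andbT.
have mgt (g : Omega -> R) : measurable_fun setT g -> measurable [set w | x < g w].
  move=> mg; have := mg measurableT _ (measurable_itv `]x, +oo[); rewrite setTI.
  by congr measurable; apply/seteqP; split => w /=; rewrite in_itv/= andbT.
rewrite mulr_natl mulr2n EFinD.
apply: le_trans (leeD h1 h2).
apply: le_trans (measureU2 _ (mge _ mS) (mge _ mN)).
apply: le_measure; rewrite ?inE; [exact: mgt|by apply: measurableU; exact: mge|].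
by move=> w /=; rewrite ltr_normr => /orP[] /ltW; [left|right].
Qed.

Lemma linear_tail (f : 'I_n -> Omega -> R) (v : 'I_n -> R) (D L : R) :
  (forall i, measurable_fun setT (f i : g_sigma_algebraType (F i) -> R)) ->
  (forall i t, ('E_P[(fun w => expR (t * f i w))%R] <=
                (expR (t ^+ 2 * v i / 2))%:E)%E) ->
  0 < D -> \sum_i v i <= D ^+ 2 -> 0 < L ->
  (P [set w | (Num.sqrt (2 * L) * D < `|\sum_i f i w|)%R] <= (2 * expR (- L))%:E)%E.
Proof.
move=> mf Ef D0 vD L0.
have mS : measurable_fun setT (fun w => \sum_i f i w).
  by apply: measurable_sum => i; exact: (@mF i).
have s0 : 0 < Num.sqrt (2 * L) by rewrite sqrtr_gt0 mulr_gt0.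
(* The minimiser of t^2 D^2 / 2 - t sqrt(2 L) D, whose minimum is -L. *)
pose t := Num.sqrt (2 * L) / D.
have t0 : 0 < t by rewrite divr_gt0.
have tx : t * (Num.sqrt (2 * L) * D) = 2 * L.
  transitivity (Num.sqrt (2 * L) ^+ 2); last by rewrite sqr_sqrtr// mulr_ge0// ltW.
  by rewrite /t; field; rewrite gt_eqF.
have le : \sum_i t ^+ 2 * v i / 2 - t * (Num.sqrt (2 * L) * D) <= - L.
  rewrite tx -mulr_suml -mulr_sumr.
  have e : t * D = Num.sqrt (2 * L) by rewrite /t divfK ?gt_eqF.
  have := ler_wpM2l (sqr_ge0 t) vD.
  by rewrite -exprMn e sqr_sqrtr ?mulr_ge0 ?(ltW L0)// => h; lra.
apply: abs_tail_le => //.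
- apply: le_trans (chernoff_sum _ mf t0 (fun i => Ef i t)) _.
  by rewrite lee_fin ler_expR.
- under eq_set => w do rewrite -sumrN.
  apply: le_trans (@chernoff_sum (fun i w => - f i w) (fun i => t ^+ 2 * v i / 2) t _ _ t0 _) _.
  + by move=> i; exact: measurableT_comp.
  + move=> i; have := Ef i (- t); rewrite sqrrN.
    rewrite (_ : (fun w => expR (- t * f i w)) = fun w => expR (t * - f i w))//.
    by apply/funext => w; rewrite mulrN mulNr.
  + by rewrite lee_fin ler_expR.
Qed.

(** Bernstein's inequality: the term in sqrt(n L) belongs to the Gaussian regime, the term 12 L
    comes from the restriction [|t| <= 12^-1]. *)
Lemma quadratic_tail (f : 'I_n -> Omega -> R) (L : R) :
  (0 < n)%N ->
  (forall i, measurable_fun setT (f i : g_sigma_algebraType (F i) -> R)) ->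
  (forall i t, `|t| <= 12^-1 ->
     ('E_P[(fun w => expR (t * f i w))%R] <= (expR (864 * t ^+ 2))%:E)%E) ->
  0 < L ->
  (P [set w | (60 * Num.sqrt (n%:R * L) + 12 * L < `|\sum_i f i w|)%R]
     <= (2 * expR (- L))%:E)%E.
Proof.
move=> n0 mf Ef L0.
have mS : measurable_fun setT (fun w => \sum_i f i w).
  by apply: measurable_sum => i; exact: (@mF i).
pose N : R := n%:R; have N0 : 0 < N by rewrite ltr0n.
pose r := Num.sqrt (N * L).
have r0 : 0 < r by rewrite sqrtr_gt0 mulr_gt0.
have r2 : r ^+ 2 = N * L by rewrite sqr_sqrtr// mulr_ge0// ltW.
pose x := 60 * r + 12 * L.
have [t [t0 t12 le]] : exists t, [/\ 0 < t, t <= 12^-1 &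
    N * (864 * t ^+ 2) - t * x <= - L].
  (* The near-optimal t = r / (30 N) is admissible when L <= 6 N, since then r <= 5/2 N; its
     exponent is at most 864/900 L - 2 L. Otherwise t = 1/12 is used: 864 N t^2 = 6 N is covered by
     60 r t = 5 r, because r >= 2 N. *)
  have [LN|LN] := leP L (6 * N).
    exists (r / (30 * N)); split.
    - by rewrite divr_gt0// mulr_gt0.
    - have rN : r <= 5 / 2 * N.
        rewrite -ler_sqr ?nnegrE ?(ltW r0)//; last by rewrite mulr_ge0// ltW.
        by rewrite r2; nra.
      by rewrite ler_pdivrMr ?mulr_gt0//; lra.
    - have -> : N * (864 * (r / (30 * N)) ^+ 2) = 864 / 900 * L.
        by rewrite expr_div_n r2; field; rewrite gt_eqF.
      have -> : r / (30 * N) * x = 2 * L + 12 * L * (r / (30 * N)).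
        rewrite /x mulrDr; congr (_ + _); last by rewrite mulrC.
        transitivity (60 * r ^+ 2 / (30 * N)); first by rewrite expr2; field; rewrite gt_eqF.
        by rewrite r2; field; rewrite gt_eqF.
      have : 0 <= 12 * L * (r / (30 * N)) by rewrite mulr_ge0 ?divr_ge0 ?mulr_ge0 ?ltW.
      lra.
  exists 12^-1; split => //.
  have : N * 6 <= 60 / 12 * r.
    have : (2 * N) ^+ 2 <= r ^+ 2 by rewrite r2; nra.
    by rewrite ler_sqr ?nnegrE ?mulr_ge0 ?(ltW r0) ?(ltW N0)// => h; lra.
  rewrite /x; lra.
have nt : `|t| <= 12^-1 by rewrite gtr0_norm.
have leS : \sum_(i < n) 864 * t ^+ 2 - t * x <= - L.
  by rewrite sumr_const card_ord -[X in X - _]mulr_natl.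
apply: abs_tail_le => //.
- apply: le_trans (chernoff_sum _ mf t0 (fun i => Ef i t nt)) _.
  by rewrite lee_fin ler_expR.
- under eq_set => w do rewrite -sumrN.
  apply: le_trans (@chernoff_sum (fun i w => - f i w) (fun i => 864 * t ^+ 2) t _ _ t0 _) _.
  + by move=> i; exact: measurableT_comp.
  + move=> i; have := Ef i (- t); rewrite normrN sqrrN => /(_ nt).
    rewrite (_ : (fun w => expR (- t * f i w)) = fun w => expR (t * - f i w))//.
    by apply/funext => w; rewrite mulrN mulNr.
  + by rewrite lee_fin ler_expR.
Qed.

End tails.

(** * Integrability and uncorrelatedness *)

Section uncorrelated.
Context {R : realType} {d : measure_display} {Omega : measurableType d}.
Variable P : probability Omega R.

Lemma Lfun1_le (f g : Omega -> R) : measurable_fun setT f ->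
  (forall w, `|f w| <= `|g w|) -> g \in Lfun P 1 -> f \in Lfun P 1.
Proof.
move=> mf fg /Lfun1_integrable ig; apply/Lfun1_integrable.
apply: (le_integrable measurableT _ _ ig); first exact/measurable_EFinP.
by move=> w _; rewrite /= lee_fin.
Qed.

Lemma ge0_Lfun1 (f : Omega -> R) (c : R) : measurable_fun setT f ->
  (forall w, 0 <= f w) -> ('E_P[f] <= c%:E)%E -> f \in Lfun P 1.
Proof.
move=> mf f0 fc; apply/Lfun1_integrable/integrableP; split; first exact/measurable_EFinP.
rewrite (eq_integral (fun w => (f w)%:E)); last first.
  by move=> w _; rewrite /= ger0_norm.
by rewrite -expectationE (le_lt_trans fc)// ltry.
Qed.

(** The dominating function is exp(f) + exp(-f). *)
Lemma mgf_Lfun1 (f : Omega -> R) (g : R -> R) : measurable_fun setT f ->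
  (forall t, ('E_P[(fun w => expR (t * f w))%R] <= (expR (g t))%:E)%E) ->
  f \in Lfun P 1.
Proof.
move=> mf Ef.
have me t : measurable_fun setT (fun w => expR (t * f w)).
  by apply: measurableT_comp => //; exact: measurable_funM.
apply: (@Lfun1_le _ (fun w => expR (1 * f w) + expR (-1 * f w))) => //; last first.
  by apply: rpredD; apply: ge0_Lfun1 (Ef _) => // w; exact: expR_ge0.
move=> w; rewrite [leRHS]ger0_norm ?addr_ge0 ?expR_ge0// mul1r mulN1r.
have := expR_ge1Dx (f w); have := expR_ge1Dx (- f w).
have := expR_gt0 (f w); have := expR_gt0 (- f w).
by have [fw|fw] := leP 0 (f w); [rewrite ger0_norm//|rewrite ltr0_norm//]; lra.
Qed.

Variables (F G : set_system Omega).
Hypotheses (Fm : F `<=` measurable) (Gm : G `<=` measurable).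
Hypothesis FG : forall A B, <<s F >> A -> <<s G >> B -> P (A `&` B) = (P A * P B)%E.

Lemma independent_expectation_mul (f g : Omega -> R) (a b : R) :
  measurable_fun setT (f : g_sigma_algebraType F -> R) ->
  measurable_fun setT (g : g_sigma_algebraType G -> R) ->
  (forall w, 0 <= f w) -> (forall w, 0 <= g w) ->
  'E_P[f]%E = a%:E -> 'E_P[g]%E = b%:E ->
  'E_P[(fun w => f w * g w)]%R%E = (a * b)%:E.
Proof.
move=> mf mg f0 g0 Ef Eg.
pose H (i : 'I_2) : set_system Omega := if i == ord0 then F else G.
pose h (i : 'I_2) := if i == ord0 then f else g.
pose c (i : 'I_2) := if i == ord0 then a else b.
have := @independent_expectation_prod _ _ _ P 2 H h c.
rewrite big_ord_recl big_ord1 /c/= => <-.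
- congr expectation; apply/funext => w.
  by rewrite big_ord_recl big_ord1.
- by move=> i; rewrite /H; case: ifP.
- move=> A HA; rewrite big_ord_recl big_ord1.
  rewrite -FG; [|exact: (HA ord0)|exact: (HA (lift ord0 ord0))].
  congr (P _); apply/seteqP; split => w.
    by move=> h'; split; apply: h'.
  by move=> [h1 h2] [[|[|//]] i2] _; [rewrite (_ : Ordinal i2 = ord0)//|
    rewrite (_ : Ordinal i2 = lift ord0 ord0)//]; exact/val_inj.
- by move=> i; rewrite /H /h; case: ifP.
- by move=> i w; rewrite /h; case: ifP.
- by move=> i; rewrite /h /c; case: ifP.
Qed.

(** The product rule above is for nonnegative functions, hence the split into positive and negative
    parts. A zero mean says that the two parts of [f] have equal means, so the four products cancel
    in pairs. *)
Lemma independent_uncorrelated (f g : Omega -> R) :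
  measurable_fun setT (f : g_sigma_algebraType F -> R) ->
  measurable_fun setT (g : g_sigma_algebraType G -> R) ->
  measurable_fun setT f -> measurable_fun setT g ->
  f \in Lfun P 1 -> g \in Lfun P 1 -> (fun w => f w * g w) \in Lfun P 1 ->
  ('E_P[f] = 0)%E -> 'E_P[(fun w => f w * g w)]%R%E = 0%:E.
Proof.
move=> Ff Gg mf mg lf lg lfg Ef0.
pose pos (u : Omega -> R) w := Num.max (u w) 0.
pose neg (u : Omega -> R) w := Num.max (- u w) 0.
have pos0 u w : 0 <= pos u w by rewrite /pos le_max lexx orbT.
have neg0 u w : 0 <= neg u w by rewrite /neg le_max lexx orbT.
have posneg u w : u w = pos u w - neg u w.
  rewrite /pos /neg; have [h|h] := boolP (0 <= u w).
    by rewrite max_l// max_r ?subr0// oppr_le0.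
  rewrite -ltNge in h.
  by rewrite max_r ?ltW// max_l ?oppr_ge0 ?ltW// sub0r opprK.
have pos_le u w : `|pos u w| <= `|u w|.
  rewrite ger0_norm// /pos ge_max normr_ge0 andbT; exact: ler_norm.
have neg_le u w : `|neg u w| <= `|u w|.
  rewrite ger0_norm// /neg ge_max normr_ge0 andbT -normrN; exact: ler_norm.
have mpos d' (T : measurableType d') (u : T -> R) :
    measurable_fun setT u -> measurable_fun setT (fun w => Num.max (u w) 0).
  by move=> mu; apply: measurable_maxr.
have mneg d' (T : measurableType d') (u : T -> R) :
    measurable_fun setT u -> measurable_fun setT (fun w => Num.max (- u w) 0).
  by move=> mu; apply: measurable_maxr => //; exact: measurableT_comp.
have Lp u : measurable_fun setT u -> u \in Lfun P 1 -> pos u \in Lfun P 1.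
  by move=> mu; apply: Lfun1_le => //; exact: mpos.
have Ln u : measurable_fun setT u -> u \in Lfun P 1 -> neg u \in Lfun P 1.
  by move=> mu; apply: Lfun1_le => //; exact: mneg.
have finE u : u \in Lfun P 1 -> 'E_P[u]%E = (fine 'E_P[u])%:E.
  by move=> lu; rewrite fineK// expectation_fin_num.
set ap := fine ('E_P[pos f])%E; set an := fine ('E_P[neg f])%E.
have Ep : 'E_P[pos f]%E = ap%:E by apply: finE; exact: Lp.
have En : 'E_P[neg f]%E = an%:E by apply: finE; exact: Ln.
have apn : ap = an.
  have : 'E_P[f]%E = (ap - an)%:E.
    transitivity ('E_P[(pos f \- neg f)%R])%E.
      by congr expectation; apply/funext => w; exact: posneg.
    by rewrite expectationB ?Ep ?En//; [exact: Lp|exact: Ln].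
  by rewrite Ef0 => -[] /eqP; rewrite eq_sym subr_eq0 => /eqP.
have Gp : 'E_P[pos g]%E = (fine 'E_P[pos g])%:E by apply: finE; exact: Lp.
have Gn : 'E_P[neg g]%E = (fine 'E_P[neg g])%:E by apply: finE; exact: Ln.
have Epp := independent_expectation_mul (mpos _ _ _ Ff) (mpos _ _ _ Gg) (pos0 f) (pos0 g) Ep Gp.
have Epn := independent_expectation_mul (mpos _ _ _ Ff) (mneg _ _ _ Gg) (pos0 f) (neg0 g) Ep Gn.
have Enp := independent_expectation_mul (mneg _ _ _ Ff) (mpos _ _ _ Gg) (neg0 f) (pos0 g) En Gp.
have Enn := independent_expectation_mul (mneg _ _ _ Ff) (mneg _ _ _ Gg) (neg0 f) (neg0 g) En Gn.
have Lprod (u v : Omega -> R) : measurable_fun setT u -> measurable_fun setT v ->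
    (forall w, `|u w| <= `|f w|) -> (forall w, `|v w| <= `|g w|) ->
    (fun w => u w * v w) \in Lfun P 1.
  move=> mu mv uf vg; apply: Lfun1_le lfg; first exact: measurable_funM.
  by move=> w; rewrite !normrM ler_pM.
pose pp w := pos f w * pos g w. pose pn w := pos f w * neg g w.
pose np w := neg f w * pos g w. pose nn w := neg f w * neg g w.
have lpp : pp \in Lfun P 1 by apply: Lprod => //; exact: mpos.
have lpn : pn \in Lfun P 1 by apply: Lprod => //; [exact: mpos|exact: mneg].
have lnp : np \in Lfun P 1 by apply: Lprod => //; [exact: mneg|exact: mpos].
have lnn : nn \in Lfun P 1 by apply: Lprod => //; exact: mneg.
rewrite (_ : (fun w => _) = (pp \- pn) \- (np \- nn)); last first.
  by apply/funext => w /=; rewrite (posneg f w) (posneg g w) /pp /pn /np /nn; ring.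
rewrite !expectationB//; [|exact: rpredB|exact: rpredB].
by rewrite Epp Epn Enp Enn apn -!EFinB subrr.
Qed.

End uncorrelated.

Section quadratic_event.
Context {R : realType} {d : measure_display} {Omega : measurableType d}.
Variables (P : probability Omega R) (n : nat).
Variable F : 'I_n -> set_system Omega.
Hypothesis Fm : forall i, F i `<=` measurable.
Hypothesis indep : independent_family P (fun i => <<s F i >>).
Hypothesis n0 : (0 < n)%N.

Lemma mgf_scale (f : Omega -> R) (a : R) : 0 < a ->
  (forall t, ('E_P[(fun w => expR (t * f w))%R] <= (expR (t ^+ 2 * a ^+ 2 / 2))%:E)%E) ->
  forall t, ('E_P[(fun w => expR (t * (a^-1 * f w)))%R] <= (expR (t ^+ 2 / 2))%:E)%E.
Proof.
move=> a0 h t; have := h (t * a^-1); rewrite exprMn exprVn mulfVK ?expf_neq0 ?gt_eqF//.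
by under [X in expectation _ X]eq_fun do rewrite -mulrA.
Qed.

Lemma subgaussian_mul_Lfun1 (U V : Omega -> R) (a c : R) :
  measurable_fun setT U -> measurable_fun setT V -> 0 < a -> 0 < c ->
  (forall t, ('E_P[(fun w => expR (t * U w))%R] <= (expR (t ^+ 2 * a ^+ 2 / 2))%:E)%E) ->
  (forall t, ('E_P[(fun w => expR (t * V w))%R] <= (expR (t ^+ 2 * c ^+ 2 / 2))%:E)%E) ->
  (fun w => U w * V w) \in Lfun P 1.
Proof.
move=> mU mV a0 c0 hU hV.
have mUa : measurable_fun setT (fun w => a^-1 * U w) by exact: measurable_funM.
have mVc : measurable_fun setT (fun w => c^-1 * V w) by exact: measurable_funM.
have := mul_Lfun1 mUa mVc (mgf_scale a0 hU) (mgf_scale c0 hV).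
move=> /(Lfun_scale (a * c) (lexx 1)).
rewrite (_ : _ \o* _ = fun w => U w * V w)//.
by apply/funext => w /=; field; rewrite !gt_eqF.
Qed.

Lemma product_event (U V : 'I_n -> Omega -> R) (mu : 'I_n -> R) (a c L : R) :
  (forall i, measurable_fun setT (U i : g_sigma_algebraType (F i) -> R)) ->
  (forall i, measurable_fun setT (V i : g_sigma_algebraType (F i) -> R)) ->
  (forall i, measurable_fun setT (U i)) -> (forall i, measurable_fun setT (V i)) ->
  0 < a -> 0 < c ->
  (forall i t, ('E_P[(fun w => expR (t * U i w))%R] <= (expR (t ^+ 2 * a ^+ 2 / 2))%:E)%E) ->
  (forall i t, ('E_P[(fun w => expR (t * V i w))%R] <= (expR (t ^+ 2 * c ^+ 2 / 2))%:E)%E) ->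
  (forall i, 'E_P[(fun w => U i w * V i w)]%R%E = (mu i)%:E) ->
  0 < L ->
  (P [set w | (a * c * (60 * Num.sqrt (n%:R * L) + 12 * L) <
     `|\sum_i (U i w * V i w - mu i)|)%R] <= (2 * expR (- L))%:E)%E.
Proof.
move=> FU FV mU mV a0 c0 hU hV hmu L0.
pose f i w := a^-1 * U i w * (c^-1 * V i w) - a^-1 * c^-1 * mu i.
have ac0 : 0 < a * c by rewrite mulr_gt0.
have fE i w : f i w = (a * c)^-1 * (U i w * V i w - mu i).
  by rewrite /f invfM; ring.
rewrite (_ : [set w | _] = [set w | (60 * Num.sqrt (n%:R * L) + 12 * L < `|\sum_i f i w|)%R]).
  apply: (quadratic_tail Fm indep n0 _ _ L0).
    move=> i; apply: measurable_funB => //.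
    by apply: measurable_funM; exact: measurable_funM.
  move=> i t t12; apply: product_mgf => //.
  - exact: measurable_funM.
  - exact: measurable_funM.
  - exact: mgf_scale.
  - exact: mgf_scale.
  - rewrite (_ : (fun w => _) = (a^-1 * c^-1) \o* (fun w => U i w * V i w)).
      by rewrite expectationZl ?hmu//; exact: (subgaussian_mul_Lfun1 _ _ a0 c0).
    by apply/funext => w /=; ring.
apply/seteqP; split => w /=; rewrite (eq_bigr _ (fun i _ => fE i w)) -mulr_sumr;
  by rewrite normrM gtr0_norm ?invr_gt0// ltr_pdivlMl.
Qed.
End quadratic_event.

(** * Sparse vectors and the design matrix *)

Section vectors.
Context {R : realType}.

Definition dot (m : nat) (u v : 'cV[R]_m) : R := \sum_j u j 0 * v j 0.
Definition norm1 (m : nat) (u : 'cV[R]_m) : R := \sum_j `|u j 0|.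
Definition supported (m : nat) (J : {set 'I_m}) (u : 'cV[R]_m) : Prop :=
  forall j, j \notin J -> u j 0 = 0.

Variable m : nat.
Implicit Types u v w : 'cV[R]_m.

Lemma dotC u v : dot u v = dot v u.
Proof. by apply: eq_bigr => j _; rewrite mulrC. Qed.

Lemma dotDr u v w : dot u (v + w) = dot u v + dot u w.
Proof. by rewrite -big_split; apply: eq_bigr => j _; rewrite mxE mulrDr. Qed.

Lemma dotZr (a : R) u v : dot u (a *: v) = a * dot u v.
Proof. by rewrite mulr_sumr; apply: eq_bigr => j _; rewrite mxE mulrCA. Qed.

Lemma dotNr u v : dot u (- v) = - dot u v.
Proof. by rewrite -scaleN1r dotZr mulN1r. Qed.

Lemma dotBr u v w : dot u (v - w) = dot u v - dot u w.
Proof. by rewrite dotDr dotNr. Qed.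

Lemma dotDl u v w : dot (u + v) w = dot u w + dot v w.
Proof. by rewrite dotC dotDr !(dotC w). Qed.

Lemma dotBl u v w : dot (u - v) w = dot u w - dot v w.
Proof. by rewrite dotC dotBr !(dotC w). Qed.

Lemma dotZl (a : R) u v : dot (a *: u) v = a * dot u v.
Proof. by rewrite dotC dotZr dotC. Qed.

Lemma norm2_ge0 u : 0 <= norm2 u. Proof. exact: sqrtr_ge0. Qed.

Lemma norm2_sqr u : norm2 u ^+ 2 = dot u u.
Proof.
rewrite sqr_sqrtr; first by apply: eq_bigr => j _; rewrite expr2.
by apply: sumr_ge0 => j _; exact: sqr_ge0.
Qed.

Lemma dot_ge0 u : 0 <= dot u u. Proof. by rewrite -norm2_sqr sqr_ge0. Qed.

Lemma norm2_eq0 u : norm2 u = 0 -> u = 0.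
Proof.
move=> u0; have /eqP := norm2_sqr u; rewrite u0 expr0n/= eq_sym.
rewrite psumr_eq0 => [/allP h|j _]; last by rewrite -expr2 sqr_ge0.
apply/matrixP => j k; rewrite ord1 mxE; apply/eqP.
by have := h j; rewrite mem_index_enum mulf_eq0 orbb => /(_ isT).
Qed.

Lemma norm2_0 : norm2 (0 : 'cV[R]_m) = 0.
Proof.
by apply/eqP; rewrite -sqrf_eq0 norm2_sqr -(scale0r (0 : 'cV[R]_m)) dotZr mul0r.
Qed.

Lemma norm2Z (a : R) u : norm2 (a *: u) = `|a| * norm2 u.
Proof.
rewrite -sqrtr_sqr -sqrtrM ?sqr_ge0// mulr_sumr.
by congr Num.sqrt; apply: eq_bigr => j _; rewrite mxE exprMn.
Qed.

Lemma discriminant_le (a g c : R) : 0 <= a -> 0 <= c ->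
  (forall t, 0 <= a * t ^+ 2 - 2 * g * t + c) -> g ^+ 2 <= a * c.
Proof.
move=> a0 c0 h.
have [a1|a1] := eqVneq a 0.
  subst a; have [->|g0] := eqVneq g 0; first by rewrite expr0n/= mul0r.
  (* At this t the degenerate form takes the value -1. *)
  have := h ((c + 1) / (2 * g)).
  rewrite mul0r sub0r -mulrA mulrC.
  have -> : g * ((c + 1) / (2 * g)) * 2 = c + 1 by field.
  by lra.
have {}a0 : 0 < a by rewrite lt_neqAle eq_sym a1.
have := h (g / a); have -> : a * (g / a) ^+ 2 - 2 * g * (g / a) + c = (a * c - g ^+ 2) / a.
  by field.
by rewrite pmulr_lge0 ?invr_gt0// subr_ge0.
Qed.

Lemma cauchy_schwarz u v : `|dot u v| <= norm2 u * norm2 v.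
Proof.
rewrite -ler_sqr ?nnegrE ?mulr_ge0 ?norm2_ge0//.
rewrite exprMn !norm2_sqr real_normK ?num_real//.
apply: discriminant_le; rewrite ?dot_ge0// => t.
have := dot_ge0 (t *: u - v).
rewrite dotBl !dotBr !dotZl !dotZr (dotC v u) => h.
by apply: le_trans h _; rewrite le_eqVlt; apply/orP; left; apply/eqP; ring.
Qed.

Lemma ler_norm2D u v : norm2 (u + v) <= norm2 u + norm2 v.
Proof.
rewrite -ler_sqr ?nnegrE ?addr_ge0 ?norm2_ge0//.
rewrite norm2_sqr dotDl !dotDr sqrrD !norm2_sqr (dotC v u).
have := ler_norm (dot u v); have := cauchy_schwarz u v; lra.
Qed.

Lemma norm2_pencil (t : R) u v : norm2 (t *: u - v) ^+ 2 =
  t ^+ 2 * norm2 u ^+ 2 - 2 * t * dot u v + norm2 v ^+ 2.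
Proof.
by rewrite !norm2_sqr dotBl !dotBr !dotZl !dotZr (dotC v u); ring.
Qed.

Lemma dot_mulmx (k : nat) (A : 'M[R]_(m, k)) u (v : 'cV[R]_k) :
  dot u (A *m v) = dot (A^T *m u) v.
Proof.
rewrite /dot; under eq_bigr do rewrite mxE mulr_sumr.
rewrite exchange_big; apply: eq_bigr => j _; rewrite mxE mulr_suml.
by apply: eq_bigr => i _; rewrite mxE; ring.
Qed.

Lemma norm1_ge0 u : 0 <= norm1 u. Proof. exact: sumr_ge0. Qed.

Lemma norm1_le (J : {set 'I_m}) u : supported J u ->
  norm1 u <= Num.sqrt #|J|%:R * norm2 u.
Proof.
move=> uJ.
pose a : 'cV[R]_m := \col_j `|u j 0|.
pose o : 'cV[R]_m := \col_j (j \in J)%:R.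
have -> : norm1 u = dot o a.
  apply: eq_bigr => j _; rewrite !mxE; case: (boolP (j \in J)) => [_|/uJ ->].
    by rewrite mul1r.
  by rewrite normr0 mulr0.
have -> : norm2 u = norm2 a.
  by congr Num.sqrt; apply: eq_bigr => j _; rewrite mxE real_normK ?num_real.
have -> : Num.sqrt #|J|%:R = norm2 o.
  congr Num.sqrt; rewrite -sum1_card natr_sum [RHS](bigID (mem J))/=.
  rewrite [X in _ + X]big1 ?addr0 => [|j /negbTE jJ]; last by rewrite mxE jJ expr0n.
  by apply: eq_bigr => j jJ; rewrite mxE jJ expr1n.
exact: le_trans (ler_norm _) (cauchy_schwarz _ _).
Qed.

Lemma entrywise_form_le (E : 'M[R]_m) (B : R) u v :
  (forall j k, `|E j k| <= B) -> `|dot u (E *m v)| <= B * norm1 u * norm1 v.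
Proof.
move=> EB; apply: le_trans (ler_norm_sum _ _ _) _.
rewrite mulrAC mulr_sumr; apply: ler_sum => j _.
rewrite normrM mulrC ler_wpM2r//.
rewrite mxE; apply: le_trans (ler_norm_sum _ _ _) _.
by rewrite mulr_sumr; apply: ler_sum => k _; rewrite normrM ler_wpM2r.
Qed.

Lemma norm2_sqr_le_sup_norm1 u (B : R) :
  (forall j, `|u j 0| <= B) -> norm2 u ^+ 2 <= B * norm1 u.
Proof.
move=> uB; rewrite norm2_sqr mulr_sumr; apply: ler_sum => j _.
by rewrite -expr2 -real_normK ?num_real// expr2 ler_wpM2r.
Qed.

Lemma norm2_restr_le (J : {set 'I_m}) u : norm2 (restr J u) <= norm2 u.
Proof.
rewrite ler_sqrt; last by apply: sumr_ge0 => j _; exact: sqr_ge0.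
by apply: ler_sum => j _; rewrite mxE; case: ifP => // _; rewrite expr0n sqr_ge0.
Qed.

Lemma supported_restr (J : {set 'I_m}) u : supported J (restr J u).
Proof. by move=> j /negbTE jJ; rewrite mxE jJ. Qed.

Lemma dot_disjoint (J1 J2 : {set 'I_m}) u v :
  supported J1 u -> supported J2 v ->
  (forall j, j \in J1 -> j \notin J2) -> dot u v = 0.
Proof.
move=> u1 v2 J12; apply: big1 => j _; have [jJ|jJ] := boolP (j \in J1).
  by rewrite (v2 j) ?mulr0// J12.
by rewrite u1// mul0r.
Qed.

Lemma supportedD (J : {set 'I_m}) u v :
  supported J u -> supported J v -> supported J (u + v).
Proof. by move=> uJ vJ j jJ; rewrite mxE uJ// vJ// addr0. Qed.

Lemma supportedN (J : {set 'I_m}) u : supported J u -> supported J (- u).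
Proof. by move=> uJ j jJ; rewrite mxE uJ// oppr0. Qed.

Lemma supportedS (J1 J2 : {set 'I_m}) u : J1 \subset J2 ->
  supported J1 u -> supported J2 u.
Proof. by move=> /fintype.subsetP J12 uJ j jJ; apply: uJ; apply: contraNN jJ => /J12. Qed.

End vectors.

Section design_facts.
Context {R : realType} {n p : nat}.
Variable X : 'M[R]_(n, p).
Implicit Types u v D : 'cV[R]_p.

Lemma Psi_form D : (D^T *m Psi X *m D) 0 0 = n%:R^-1 * norm2 (X *m D) ^+ 2.
Proof.
rewrite norm2_sqr /Psi -scalemxAr -scalemxAl mxE; congr (_ * _).
rewrite !mulmxA -trmx_mul -mulmxA mxE; apply: eq_bigr => i _.
by rewrite mxE.
Qed.

Let sparse_value (k : nat) (J : {set 'I_p}) D :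
  supported J D -> (#|J| <= k)%N -> norm2 D = 1 ->
  sparse_values X k (n%:R^-1 * norm2 (X *m D) ^+ 2).
Proof. by move=> DJ Jk D1; exists J => //; exists D; rewrite ?Psi_form. Qed.

(** A Frobenius bound. It makes the set of sparse values bounded above, so that [phi_max] is a
    genuine supremum and not a default value. *)
Lemma norm2_mulmx_le D :
  norm2 (X *m D) ^+ 2 <= (\sum_i norm2 (row i X)^T ^+ 2) * norm2 D ^+ 2.
Proof.
rewrite [leLHS]norm2_sqr mulr_suml; apply: ler_sum => i _.
rewrite -exprMn -expr2 -[leLHS]real_normK ?num_real// ler_sqr ?nnegrE ?mulr_ge0 ?norm2_ge0//.
apply: le_trans (cauchy_schwarz _ _); rewrite mxE le_eqVlt; apply/orP; left; apply/eqP.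
by congr `|_|; apply: eq_bigr => j _; rewrite !mxE.
Qed.

Let normalize D : D != 0 -> norm2 ((norm2 D)^-1 *: D) = 1.
Proof.
move=> D0; have d0 : norm2 D != 0 by apply: contra_neq D0; exact: norm2_eq0.
by rewrite norm2Z ger0_norm ?invr_ge0 ?norm2_ge0// mulVf.
Qed.

Lemma phi_min_le (k : nat) (J : {set 'I_p}) D : supported J D -> (#|J| <= k)%N ->
  phi_min X k * norm2 D ^+ 2 <= n%:R^-1 * norm2 (X *m D) ^+ 2.
Proof.
move=> DJ Jk; have [->|D0] := eqVneq D 0.
  by rewrite mulmx0 !norm2_0 expr0n/= !mulr0.
have d0 : norm2 D != 0 by apply: contra_neq D0; exact: norm2_eq0.
have DJ' : supported J ((norm2 D)^-1 *: D) by move=> j /DJ; rewrite mxE => ->; rewrite mulr0.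
have : phi_min X k <= n%:R^-1 * norm2 (X *m ((norm2 D)^-1 *: D)) ^+ 2.
  apply: ge_inf; last exact: sparse_value DJ' Jk (normalize D0).
  by exists 0 => _ [J' _ [D' _ ->]]; rewrite Psi_form mulr_ge0 ?invr_ge0 ?sqr_ge0.
rewrite -scalemxAr norm2Z ger0_norm ?invr_ge0 ?norm2_ge0// exprMn exprVn mulrCA.
by rewrite mulrC ler_pdivlMr// lt_neqAle sqr_ge0 eq_sym sqrf_eq0 d0.
Qed.

Lemma phi_max_ge (k : nat) (J : {set 'I_p}) D : supported J D -> (#|J| <= k)%N ->
  n%:R^-1 * norm2 (X *m D) ^+ 2 <= phi_max X k * norm2 D ^+ 2.
Proof.
move=> DJ Jk; have [->|D0] := eqVneq D 0.
  by rewrite mulmx0 !norm2_0 expr0n/= !mulr0.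
have d0 : norm2 D != 0 by apply: contra_neq D0; exact: norm2_eq0.
have DJ' : supported J ((norm2 D)^-1 *: D) by move=> j /DJ; rewrite mxE => ->; rewrite mulr0.
have : n%:R^-1 * norm2 (X *m ((norm2 D)^-1 *: D)) ^+ 2 <= phi_max X k.
  apply: ub_le_sup; last exact: sparse_value DJ' Jk (normalize D0).
  exists (n%:R^-1 * \sum_i norm2 (row i X)^T ^+ 2) => _ [J' _ [D' [_ D1] ->]].
  rewrite Psi_form ler_wpM2l ?invr_ge0//.
  by apply: le_trans (norm2_mulmx_le _) _; rewrite D1 expr1n mulr1.
rewrite -scalemxAr norm2Z ger0_norm ?invr_ge0 ?norm2_ge0// exprMn exprVn mulrCA.
by rewrite mulrC ler_pdivrMr// lt_neqAle sqr_ge0 eq_sym sqrf_eq0 d0.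
Qed.

Lemma norm2_delta (j : 'I_p) : norm2 (delta_mx j 0 : 'cV[R]_p) = 1.
Proof.
rewrite -[RHS]sqrtr1; congr Num.sqrt; rewrite (bigD1 j)//= big1 ?addr0.
  by rewrite mxE !eqxx expr1n.
by move=> i ij; rewrite mxE (negbTE ij) expr0n.
Qed.

Lemma mulmx_delta (j : 'I_p) : X *m delta_mx j 0 = col j X.
Proof. by rewrite colE. Qed.

Lemma supported_delta (j : 'I_p) : supported [set j]%SET (delta_mx j 0 : 'cV[R]_p).
Proof. by move=> i; rewrite finset.inE mxE => /negbTE ->. Qed.

Lemma norm2_col_le (j : 'I_p) : n%:R^-1 * norm2 (col j X) ^+ 2 <= m2 X.
Proof.
rewrite /m2; apply: le_trans (le_bigmax _ _ j); rewrite norm2_sqr.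
by apply: ler_wpM2l; rewrite ?invr_ge0//; apply: ler_sum => i _; rewrite mxE expr2.
Qed.

Lemma phi_min_le_m2 (k : nat) : (0 < p)%N -> (0 < k)%N -> phi_min X k <= m2 X.
Proof.
move=> p0 k0; pose j := Ordinal p0.
have := phi_min_le (@supported_delta j) (_ : #|[set j]%SET| <= k)%N.
rewrite cards1 => /(_ k0); rewrite norm2_delta expr1n mulr1 mulmx_delta => h.
exact: le_trans h (norm2_col_le j).
Qed.

Lemma phi_min_le_max (k s : nat) : (0 < p)%N -> (0 < k)%N -> (0 < s)%N ->
  phi_min X k <= phi_max X s.
Proof.
move=> p0 k0 s0; pose j := Ordinal p0.
have := phi_min_le (@supported_delta j) (_ : #|[set j]%SET| <= k)%N.
have := phi_max_ge (@supported_delta j) (_ : #|[set j]%SET| <= s)%N.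
rewrite cards1 => /(_ s0) h1 /(_ k0) h2.
by have := le_trans h2 h1; rewrite norm2_delta expr1n !mulr1.
Qed.

Lemma phi_max_ge0 (s : nat) : (0 < p)%N -> (0 < s)%N -> 0 <= phi_max X s.
Proof.
move=> p0 s0; pose j := Ordinal p0.
have := phi_max_ge (@supported_delta j) (_ : #|[set j]%SET| <= s)%N.
rewrite cards1 => /(_ s0); rewrite norm2_delta expr1n mulr1.
by apply: le_trans; rewrite mulr_ge0 ?invr_ge0 ?sqr_ge0.
Qed.

(** [phi_max X s] controls [s]-sparse vectors only, whereas a sign vector has as many entries as the
    selected support. Cutting the support into [a] blocks of at most [s] indices costs the factor
    [a] by the triangle inequality; each block has norm at most sqrt(s) because its entries are
    bounded by 1. *)
Lemma norm2_mulmx_block (s a : nat) (J : {set 'I_p}) u :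
  (0 < n)%N -> (0 < p)%N -> (0 < s)%N ->
  supported J u -> (forall j, `|u j 0| <= 1) -> (#|J| <= a * s)%N ->
  norm2 (X *m u) <= a%:R * Num.sqrt (n%:R * s%:R * phi_max X s).
Proof.
move=> n0 p0 s0; elim: a J u => [|a IH] J u uJ u1 Ja.
  have J0 : J = finset.set0 by apply: cards0_eq; apply/eqP; rewrite -leqn0.
  have -> : u = 0.
    by apply/matrixP => j k; rewrite ord1 mxE uJ// J0 finset.inE.
  by rewrite mulmx0 norm2_0 mul0r.
have [J1 [J1J J1s J1a]] : exists J1 : {set 'I_p},
    [/\ J1 \subset J, #|J1| <= s & #|J :\: J1| <= a * s]%N.
  have [sJ|Js] := leqP s #|J|.
    have /card_geqP[t [tu ts tJ]] := sJ.
    exists [set x in t]%SET; split.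
    - by apply/fintype.subsetP => x; rewrite finset.inE => /tJ.
    - by rewrite cardsE (leq_trans (card_size _))// ts.
      rewrite cardsDS ?cardsE; last by apply/fintype.subsetP => x; rewrite finset.inE => /tJ.
      by rewrite (card_uniqP tu) ts leq_subLR -mulSn.
  exists J; split => //; first exact: ltnW.
  by rewrite finset.setDv cards0.
have -> : u = restr J1 u + restr (J :\: J1)%SET u.
  apply/matrixP => j k; rewrite ord1 !mxE finset.in_setD.
  case: (boolP (j \in J1)) => /= [_|_]; first by rewrite addr0.
  by rewrite add0r; case: ifPn => // /uJ.
rewrite mulmxDr; apply: le_trans (ler_norm2D _ _) _.
rewrite -natr1 mulrDl addrC mul1r; apply: lerD.
  apply: IH J1a; first exact: supported_restr.
  by move=> j; rewrite mxE; case: ifP => // _; rewrite normr0.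
rewrite -ler_sqr ?nnegrE ?norm2_ge0 ?sqrtr_ge0// [leRHS]sqr_sqrtr; last first.
  by rewrite mulr_ge0 ?phi_max_ge0.
have := phi_max_ge (@supported_restr _ _ J1 u) J1s.
rewrite ler_pdivrMl ?ltr0n// => /le_trans; apply.
rewrite -mulrA ler_wpM2l// mulrC ler_wpM2r ?phi_max_ge0//.
rewrite norm2_sqr.
apply: (@le_trans _ _ (\sum_j (j \in J1)%:R)); last first.
  rewrite -natr_sum ler_nat.
  by apply: leq_trans J1s; rewrite -sum1_card [leqRHS]big_mkcond leq_sum// => j _; case: (j \in J1).
apply: ler_sum => j _; rewrite mxE; case: ifP => _; last by rewrite mulr0.
by rewrite -expr2 -real_normK ?num_real// exprn_ile1.
Qed.

End design_facts.

(** * Solvability of the normal equations on a support *)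

Section exact_solution.
Context {R : realType} {p : nat}.

(** The block of [M] on T is completed by the identity outside T, which keeps the matrix at full
    size without reindexing. Positivity on vectors supported on T makes it injective, hence
    invertible. *)
Lemma supported_linear_solution (M : 'M[R]_p) (T : {set 'I_p}) (c : 'cV[R]_p) :
  (forall u, supported T u -> u != 0 -> 0 < dot u (M *m u)) ->
  exists2 b, supported T b & forall j, j \in T -> (M *m b) j 0 = c j 0.
Proof.
move=> Mpos.
pose N : 'M[R]_p := \matrix_(i, j)
  (if i \in T then (if j \in T then M i j else 0) else (i == j)%:R).
have NE (u : 'cV[R]_p) i : (N *m u) i 0 =
    if i \in T then (M *m restr T u) i 0 else u i 0.
  rewrite !mxE; case: ifPn => iT.
    apply: eq_bigr => j _; rewrite !mxE iT.
    by case: ifP => _; rewrite ?mul0r ?mulr0.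
  rewrite (bigD1 i)//= big1 ?addr0; first by rewrite mxE (negbTE iT) eqxx mul1r.
  by move=> j ji; rewrite mxE (negbTE iT) eq_sym (negbTE ji) mul0r.
have Ninj (u : 'cV[R]_p) : N *m u = 0 -> u = 0.
  move=> Nu0.
  have uT : supported T u.
    by move=> j jT; have := NE u j; rewrite Nu0 (negbTE jT) mxE.
  have ru : restr T u = u.
    by apply/matrixP => j k; rewrite ord1 mxE; case: ifPn => // /uT.
  apply/eqP/negPn/negP => u0; have := Mpos _ uT u0.
  rewrite [dot _ _]big1 ?ltxx// => j _; have [jT|/uT ->] := boolP (j \in T).
    by have := NE u j; rewrite Nu0 jT ru mxE => <-; rewrite mulr0.
  by rewrite mul0r.
have Nunit : N \in unitmx.
  (* [kermx] is a left kernel, so the vectors u with N u = 0 are, transposed, the elements of the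
     kernel of N^T. *)
  rewrite -unitmx_tr -row_free_unit -kermx_eq0; apply/eqP/row_matrixP => i.
  rewrite row0; apply: trmx_inj; rewrite trmx0; apply: Ninj.
  have := row_sub i (kermx N^T); rewrite sub_kermx => /eqP/(congr1 trmx).
  by rewrite trmx_mul trmxK trmx0.
exists (invmx N *m restr T c) => [j jT|j jT].
  by have := NE (invmx N *m restr T c) j; rewrite mulKVmx// (negbTE jT) mxE (negbTE jT).
have sb : restr T (invmx N *m restr T c) = invmx N *m restr T c.
  apply/matrixP => i k; rewrite ord1 mxE; case: ifPn => // iT.
  by have := NE (invmx N *m restr T c) i; rewrite mulKVmx// (negbTE iT) mxE (negbTE iT).
by have := NE (invmx N *m restr T c) j; rewrite mulKVmx// jT sb => <-; rewrite mxE jT.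
Qed.

End exact_solution.

(** * Deterministic error bound *)

Section scalar_inequalities.
Context {R : realType}.
Implicit Types x y D : R.

(** Used with a2 = <v, Psi v>, g = <v, Psi e>, x = |v|, y = |e|. For q = a2 - phi x^2 and c the
    other factor, g <= sqrt(q c) <= q + c/4, and q cancels against a2 = q + phi x^2. The 1/4 is the
    room left below the constant 1. *)
Lemma quadratic_absorb (a2 g phi Phi x y eta rho : R) :
  phi * x ^+ 2 <= a2 -> phi <= Phi ->
  g ^+ 2 <= (a2 - phi * x ^+ 2) * ((Phi - phi) * y ^+ 2) ->
  a2 <= g + 3 / 5 * phi * x ^+ 2 + x * eta + x * rho ->
  2 / 5 * phi * x ^+ 2 <= (Phi - phi) * y ^+ 2 / 4 + x * eta + x * rho.
Proof.
move=> h1 h2; set q := a2 - phi * x ^+ 2; set c := (Phi - phi) * y ^+ 2 => hg h3.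
have q0 : 0 <= q by rewrite subr_ge0.
have c0 : 0 <= c by rewrite mulr_ge0 ?sqr_ge0 ?subr_ge0.
have gq : g <= q + c / 4.
  rewrite leNgt; apply/negP => lt.
  have qc : 0 <= q + c / 4 by lra.
  have : (q + c / 4) ^+ 2 < g ^+ 2 by rewrite ltr_sqr ?nnegrE// (le_trans qc) ?ltW.
  by have := sqr_ge0 (q - c / 4); lra.
by rewrite /q in gq *; lra.
Qed.

(* The weak bound [eta <= 7/16 y] already suffices when [r ^+ 2] is large,
   because then the factor of [y ^+ 2] has room to spare. *)
Lemma refit_scalar_bound (x y D r eta rho Q : R) :
  0 <= x -> 0 <= y -> 0 <= D -> 1 <= r -> 0 <= eta -> 0 <= rho -> 0 <= Q ->
  D ^+ 2 = x ^+ 2 + y ^+ 2 ->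
  2 / 5 * x ^+ 2 <= (r ^+ 2 - 1) * y ^+ 2 / 4 + x * eta + x * rho ->
  eta <= 7 / 16 * y ->
  (r ^+ 2 <= 20 -> eta ^+ 2 <= y * Q) ->
  D <= r * y + 4 * rho + 8 * Q.
Proof.
move=> x0 y0 D0 r1 eta0 rho0 Q0 DE h hw hQ.
have xD : x <= D by rewrite -ler_sqr ?nnegrE// DE lerDl sqr_ge0.
have xrho : x * rho <= D * rho by rewrite ler_wpM2r.
(* Spending 1/8 of the 2/5 leaves 11/40, hence the factor 10/11 = (1/4)(40/11) in [key], still below
   1. *)
have h2 : x * eta <= x ^+ 2 / 8 + 2 * eta ^+ 2.
  by have := sqr_ge0 (x - 4 * eta); lra.
have h3 : D ^+ 2 <= (r * y) ^+ 2 + 8 * (y * Q) + 4 * (D * rho).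
  have yQ : 0 <= y * Q by rewrite mulr_ge0.
  have yy := sqr_ge0 y.
  have r11 : 0 <= r ^+ 2 - 1 by nra.
  have key : x ^+ 2 <= 10 / 11 * ((r ^+ 2 - 1) * y ^+ 2) + 80 / 11 * eta ^+ 2 + 40 / 11 * (D * rho).
    by lra.
  have Drho : 0 <= D * rho by rewrite mulr_ge0.
  rewrite exprMn DE.
  have [r20|r20] := leP (r ^+ 2) 20.
    have := hQ r20; have : 0 <= (r ^+ 2 - 1) * y ^+ 2 by rewrite mulr_ge0.
    lra.
  have e2 : eta ^+ 2 <= (7 / 16 * y) ^+ 2.
    by rewrite ler_sqr ?nnegrE ?mulr_ge0.
  have : 19 * y ^+ 2 <= (r ^+ 2 - 1) * y ^+ 2 by rewrite ler_wpM2r//; lra.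
  rewrite exprMn in e2; lra.
(* Since D^2 - 4 D rho = D (D - 4 rho), the negated claim makes it exceed (r y + 8 Q)^2, which is at
   least (r y)^2 + 8 y Q because y <= r y. *)
rewrite leNgt; apply/negP => lt.
have ry : 0 <= r * y by rewrite mulr_ge0// (le_trans _ r1).
have yr : y <= r * y by rewrite ler_peMl.
have yQ : y * Q <= r * y * Q by rewrite ler_wpM2r.
have a1 : r * y + 8 * Q < D - 4 * rho by lra.
have a2 : r * y + 8 * Q < D by lra.
have s0 : 0 <= r * y + 8 * Q by lra.
have : (r * y + 8 * Q) ^+ 2 < D * (D - 4 * rho) by rewrite expr2 ltr_pM.
have : 0 <= r * y * Q by rewrite mulr_ge0.
have : 0 <= Q ^+ 2 by rewrite sqr_ge0.
nra.
Qed.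

(** The threshold condition covers the terms of [B] linear in lam; the quadratic term is recovered
    from it. Its summand 2 sigma q lam and phi <= q^2 give z = sigma lam K <= q/4 and then z^2 <=
    phi/16, so K times the quadratic term is at most 3/8 phi, and 7/8 = 1/2 + 3/8. *)
Lemma error_budget (b q lam sigma phi K k : R) :
  0 <= b -> 0 <= q -> 0 < lam -> 0 < sigma -> 0 < phi -> phi <= q ^+ 2 ->
  0 <= k -> k + 1 <= K ->
  b + 2 * (sigma * q * lam) + 45 * sigma ^+ 2 * lam <= phi / (2 * K) ->
  let B := b + 2 * (sigma * q * lam) + sigma ^+ 2 * (45 * lam + 6 * lam ^+ 2) in
  [/\ sigma * lam * K <= q / 4, K * B <= 7 / 8 * phi & k * B <= 3 / 5 * phi].
Proof.
move=> b0 q0 lam0 sig0 phi0 phiq k0 kK cond B.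
have K0 : 0 < K by lra.
have q1 : 0 < q.
  by rewrite lt_neqAle q0 andbT; apply/eqP => qE; move: phiq; rewrite -qE expr0n/=; lra.
have condK : K * (b + 2 * (sigma * q * lam) + 45 * sigma ^+ 2 * lam) <= phi / 2.
  have := ler_wpM2l (ltW K0) cond.
  by have -> : K * (phi / (2 * K)) = phi / 2 by field; rewrite gt_eqF.
have s2 : 0 <= 45 * sigma ^+ 2 * lam by rewrite !mulr_ge0 ?sqr_ge0// ltW.
have c1 : sigma * lam * K * q <= phi / 4.
  have : 0 <= K * b by rewrite mulr_ge0// ltW.
  have : 0 <= K * (45 * sigma ^+ 2 * lam) by rewrite mulr_ge0// ltW.
  lra.
have c2 : sigma * lam * K <= q / 4.
  by rewrite -(ler_pM2r q1); nra.
set z := sigma * lam * K in c1 c2.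
have z0 : 0 < z by rewrite /z !mulr_gt0.
have c3 : z ^+ 2 <= phi / 16.
  have h : z * z * q <= q / 4 * (phi / 4).
    by rewrite -mulrA ler_pM// ?mulr_ge0// ltW.
  by rewrite -(ler_pM2r q1) expr2; lra.
have c4 : 6 * (sigma ^+ 2 * lam ^+ 2) * K <= 3 / 8 * phi / K.
  rewrite ler_pdivlMr//.
  have -> : 6 * (sigma ^+ 2 * lam ^+ 2) * K * K = 6 * z ^+ 2 by rewrite /z; ring.
  by lra.
have c5 : 3 / 8 * phi / K <= 3 / 8 * phi.
  by rewrite ler_pdivrMr// ler_peMr//; lra.
have BE : B = (b + 2 * (sigma * q * lam) + 45 * sigma ^+ 2 * lam) + 6 * (sigma ^+ 2 * lam ^+ 2).
  by rewrite /B; ring.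
split => //; first by rewrite BE mulrDr; lra.
have kc : k * (b + 2 * (sigma * q * lam) + 45 * sigma ^+ 2 * lam) <= phi / 2.
  apply: le_trans condK; rewrite ler_wpM2r//; last by lra.
  by rewrite !addr_ge0// !mulr_ge0// ltW.
have c6 : k * (6 * (sigma ^+ 2 * lam ^+ 2)) <= 3 / 32 * phi.
  (* A gain special to k + 1 <= K: from 4 k <= (k + 1)^2 <= K^2 the quadratic term is at most 6 z^2
     / 4 <= 3/32 phi, and 1/2 + 3/32 < 3/5. With 7/8 in place of 3/5 the factor left in front of
     |v|^2 would be too small for the constant 1. *)
  have : k * 4 <= K ^+ 2.
    apply: (@le_trans _ _ ((k + 1) ^+ 2)); first by have := sqr_ge0 (k - 1); nra.
    by rewrite ler_sqr ?nnegrE; lra.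
  set w := sigma ^+ 2 * lam ^+ 2 => kK4.
  have w0 : 0 <= w by rewrite mulr_ge0 ?sqr_ge0.
  have zw : z ^+ 2 = w * K ^+ 2 by rewrite /z /w; ring.
  have := ler_wpM2r w0 kK4; rewrite zw in c3; lra.
by rewrite BE mulrDr; lra.
Qed.

End scalar_inequalities.

Lemma norm_mx_entry_le (R : realType) (m k : nat) (A : 'M[R]_(m, k)) i j :
  `|A i j| <= `|A|.
Proof.
rewrite [leRHS]/Num.norm/= mx_normrE.
exact: (le_bigmax _ (fun i : 'I_m * 'I_k => `|A i.1 i.2|) (i, j)).
Qed.

Section column_entries.
Context {R : realType} {m : nat}.
Implicit Types u v : 'cV[R]_m.

Lemma add_colE u v j : (u + v) j 0 = u j 0 + v j 0.
Proof. by rewrite mxE. Qed.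

Lemma opp_colE u j : (- u) j 0 = - u j 0.
Proof. by rewrite mxE. Qed.

Lemma sub_colE u v j : (u - v) j 0 = u j 0 - v j 0.
Proof. by rewrite !mxE. Qed.

Lemma scale_colE (a : R) u j : (a *: u) j 0 = a * u j 0.
Proof. by rewrite mxE. Qed.

End column_entries.

Section deterministic_bound.
Context {R : realType} {n p : nat}.
Variables (X W : 'M[R]_(n, p)) (beta0 : 'cV[R]_p) (xi : 'cV[R]_n).
Variables (hG Gam : 'M[R]_p) (T : {set 'I_p}) (s : nat) (tbeta tt : 'cV[R]_p).
Variables (b sigma lam l A rho0 : R).

Let Z := X + W.
Let y := X *m beta0 + xi.
Let K := (#|T| + s)%N.
Let q := Num.sqrt (m2 X).
Let phi := phi_min X K.
Let Phi := phi_max X s.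
Let k := #|T|.
Let S : {set 'I_p} := [set j | beta0 j 0 != 0]%SET.
Let e := restr (~: T)%SET beta0.
Let v := tbeta - restr T beta0.
Let N1 : R := n%:R^-1.

Definition sign_vector (J : {set 'I_p}) (sg : 'I_p -> bool) : 'cV[R]_p :=
  \col_j (if j \in J then (-1) ^+ sg j else 0).

Hypotheses (n0 : (0 < n)%N) (p0 : (0 < p)%N) (s0 : (0 < s)%N).
Hypothesis sparse : (norm0 beta0 <= s)%N.
Hypotheses (b0 : 0 <= b) (sigma0 : 0 < sigma) (lam0 : 0 < lam) (l0 : 0 <= l).
Hypotheses (llam : l <= lam) (rho00 : 0 <= rho0) (sigmaA : sigma <= A) (A1 : 1 <= A).
Hypothesis phi0 : 0 < phi.
Hypotheses (diag_hG : is_diag_mx hG) (diag_Gam : is_diag_mx Gam).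
Hypothesis hGb : `|hG - Gam| <= b.
Hypothesis cond :
  b + 2 * (sigma * q * lam) + 45 * sigma ^+ 2 * lam <= phi / (2 * K%:R).
Hypothesis event_XW : forall j i,
  `|(X^T *m W) j i| <= n%:R * (sigma * q * lam).
Hypothesis event_WW : forall j i,
  `|(W^T *m W) j i - n%:R * Gam j i| <=
    n%:R * (sigma ^+ 2 * (45 * lam + 6 * lam ^+ 2)).
Hypothesis event_noise : forall j,
  `|(N1 *: (Z^T *m (xi - W *m beta0)) + Gam *m beta0) j 0| <= rho0.
(** For L = n l^2 the last factor is sqrt(2 * 6 K L), a linear deviation at level 6 K L. The level
    grows with K because the bound comes from a union over supports and signs. *)
Hypothesis event_WX_sign : forall sg, let u := sign_vector T sg in
  `|dot (W *m u) (X *m e)| <=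
    sigma * norm2 u * norm2 (X *m e) * (Num.sqrt (12 * (K%:R * n%:R)) * l).
Hypothesis event_XW_sign : forall sg, let u := sign_vector T sg in
  `|dot (X *m u) (W *m e)| <=
    sigma * norm2 e * norm2 (X *m u) * (Num.sqrt (12 * (K%:R * n%:R)) * l).
Hypothesis event_WW_sign : forall sg, let u := sign_vector T sg in
  `|dot (W *m u) (W *m e)| <=
    sigma ^+ 2 * norm2 u * norm2 e *
      (n%:R * (60 * (Num.sqrt (6 * K%:R) * l) + 72 * (K%:R * l ^+ 2))).
Hypothesis solution : refit_solution y Z hG T tbeta tt.

(** The sign is chosen so that [M], the corrected Gram matrix of the program, equals Psi - E. *)
Let E := hG - N1 *: (X^T *m W + W^T *m X + W^T *m W).
Let M := N1 *: (Z^T *m Z) - hG.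
Let B := b + 2 * (sigma * q * lam) + sigma ^+ 2 * (45 * lam + 6 * lam ^+ 2).

Let K0 : 0 < K%:R :> R. Proof. by rewrite ltr0n addn_gt0 s0 orbT. Qed.
Let N10 : 0 < N1. Proof. by rewrite invr_gt0 ltr0n. Qed.

Let q0 : 0 <= q. Proof. exact: sqrtr_ge0. Qed.

Let phiq : phi <= q ^+ 2.
Proof.
have h : phi <= m2 X by apply: phi_min_le_m2; rewrite // addn_gt0 s0 orbT.
by rewrite sqr_sqrtr// (le_trans _ h)// ltW.
Qed.

Let budget : [/\ sigma * lam * K%:R <= q / 4, K%:R * B <= 7 / 8 * phi &
  k%:R * B <= 3 / 5 * phi].
Proof.
apply: error_budget => //.
by rewrite /K natrD lerD2l ler1n.
Qed.

Let B0 : 0 <= B.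
Proof. by rewrite /B !addr_ge0// ?mulr_ge0 ?sqr_ge0 ?addr_ge0 ?mulr_ge0 ?sqr_ge0// ltW. Qed.

Let cardS : (#|S| <= s)%N.
Proof. by rewrite cardsE. Qed.

Let vT : supported T v.
Proof.
case: solution => -[_ h] _ j jT; rewrite !mxE (negbTE jT) subr0.
by case: (h j jT).
Qed.

Let eST : supported (S :\: T)%SET e.
Proof.
move=> j; rewrite finset.in_setD !mxE !finset.inE negb_and negbK.
by case: (j \in T) => //=; rewrite negbK => /eqP.
Qed.

Let eS : supported S e.
Proof. by apply: supportedS eST; exact: finset.subsetDl. Qed.

Let dot_ve (u : 'cV[R]_p) : supported T u -> dot u e = 0.
Proof.
move=> uT; apply: dot_disjoint uT eST _ => j jT.
by rewrite finset.in_setD jT.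
Qed.

Let delta_split : tbeta - beta0 = v - e.
Proof.
apply/matrixP => j i; rewrite ord1 !mxE finset.in_setC.
by case: (j \in T) => /=; ring.
Qed.

Let TS (u w : 'cV[R]_p) : supported T u -> supported S w -> supported (T :|: S)%SET (u + w).
Proof.
move=> uT wS; apply: supportedD.
  by apply: supportedS uT; exact: finset.subsetUl.
by apply: supportedS wS; exact: finset.subsetUr.
Qed.

Let cardTS : (#|T :|: S|%SET <= K)%N.
Proof. by rewrite (leq_trans (leq_card_setU _ _))// leq_add2l. Qed.

Let E_le j i : `|E j i| <= B.
Proof.
have -> : E j i = (hG - Gam) j i - (N1 * (X^T *m W) j i + N1 * (X^T *m W) i j
    + N1 * ((W^T *m W) j i - n%:R * Gam j i)).
  have -> : (X^T *m W) i j = (W^T *m X) j i.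
    have -> : W^T *m X = (X^T *m W)^T by rewrite trmx_mul trmxK.
    by rewrite [RHS]mxE.
  rewrite /E !mxE /N1; field; by rewrite pnatr_eq0 -lt0n.
have h0 : `|(hG - Gam) j i| <= b by apply: le_trans hGb; exact: norm_mx_entry_le.
have h (x y0 : R) : `|x| <= n%:R * y0 -> `|N1 * x| <= y0.
  by move=> hx; rewrite normrM gtr0_norm// ler_pdivrMl// ltr0n.
have h1 := h _ _ (event_XW j i); have h2 := h _ _ (event_XW i j).
have h3 := h _ _ (event_WW j i).
rewrite (le_trans (ler_normB _ _))// /B.
have := ler_normD (N1 * (X^T *m W) j i + N1 * (X^T *m W) i j) (N1 * ((W^T *m W) j i - n%:R * Gam j i)).
have := ler_normD (N1 * (X^T *m W) j i) (N1 * (X^T *m W) i j).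
lra.
Qed.

Let M_dot (u w : 'cV[R]_p) :
  dot u (M *m w) = N1 * dot (X *m u) (X *m w) - dot u (E *m w).
Proof.
have -> : M = N1 *: (X^T *m X) - E.
  rewrite /M /E /Z (_ : (X + W)^T = X^T + W^T); last exact: linearD.
  rewrite mulmxDr !mulmxDl !scalerDr.
  by apply/matrixP => i j; rewrite !mxE; ring.
by rewrite mulmxBl dotBr -scalemxAl dotZr -mulmxA (dot_mulmx X^T) trmxK.
Qed.

Let diag_mul (G : 'M[R]_p) (u : 'cV[R]_p) j : is_diag_mx G -> (G *m u) j 0 = G j j * u j 0.
Proof.
move=> /is_diag_mxP dG; rewrite mxE (bigD1 j)//= big1 ?addr0// => i ij.
by rewrite dG ?mul0r// eq_sym.
Qed.

(** Diagonality of [hG] turns the coordinatewise correction into a matrix product, so the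
    constraints compare [M *m u] with Z^T y / n on T. *)
Let residual (u : 'cV[R]_p) j :
  n%:R^-1 * \sum_(i < n) Z i j * (y i 0 - (Z *m u) i 0) + hG j j * u j 0 =
  (N1 *: (Z^T *m y)) j 0 - (M *m u) j 0.
Proof.
have -> : \sum_(i < n) Z i j * (y i 0 - (Z *m u) i 0) = (Z^T *m (y - Z *m u)) j 0.
  by rewrite [RHS]mxE; apply: eq_bigr => i _; rewrite !mxE.
rewrite -(diag_mul _ _ diag_hG) /M mulmxBl mulmxBr -scalemxAl mulmxA.
by rewrite !(sub_colE, scale_colE) -/N1; ring.
Qed.

Let E_TT (u : 'cV[R]_p) : supported T u ->
  `|dot u (E *m u)| <= 3 / 5 * phi * norm2 u ^+ 2.
Proof.
move=> uT; apply: le_trans (entrywise_form_le _ _ E_le) _.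
have h := norm1_le uT.
have h2 : norm1 u ^+ 2 <= k%:R * norm2 u ^+ 2.
  have -> : k%:R * norm2 u ^+ 2 = (Num.sqrt k%:R * norm2 u) ^+ 2.
    by rewrite exprMn (sqr_sqrtr (ler0n _ _)).
  by rewrite ler_sqr ?nnegrE ?norm1_ge0 ?mulr_ge0 ?norm2_ge0 ?sqrtr_ge0.
rewrite -mulrA -expr2; apply: le_trans (ler_wpM2l B0 h2) _.
rewrite mulrA ler_wpM2r ?sqr_ge0//; case: budget => _ _; rewrite mulrC; lra.
Qed.

Let M_pos (u : 'cV[R]_p) : supported T u -> u != 0 -> 0 < dot u (M *m u).
Proof.
move=> uT u0; rewrite M_dot -norm2_sqr.
have h1 := phi_min_le X uT (leq_addr s #|T|); rewrite -/K -/phi -/N1 in h1.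
have h2 := E_TT uT; have h3 := ler_norm (dot u (E *m u)).
have u1 : 0 < norm2 u ^+ 2.
  rewrite lt_neqAle sqr_ge0 eq_sym sqrf_eq0 andbT.
  by apply: contra_neq u0; exact: norm2_eq0.
have : 0 < phi * norm2 u ^+ 2 by rewrite mulr_gt0.
by lra.
Qed.

(* The normal equations restricted to [T] have an exact solution, so the optimal
   value of the program is 0. *)
Let tt0 : tt = 0.
Proof.
have [bb bT bM] := supported_linear_solution (N1 *: (Z^T *m y)) M_pos.
case: solution => _ /(_ bb 0) h.
apply/eqP; rewrite -normr_le0; apply: le_trans (h _) _; last by rewrite normr0.
split => [j jT|j jT]; last by rewrite bT// mxE.
by rewrite residual bM// subrr normr0 mxE.
Qed.

(** As [tt] vanishes, [tbeta] has zero residual on T. Writing y = Z beta0 + (xi - W beta0), the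
    residual at [beta0] is (hG - Gam) beta0 plus noise, where [Gam *m beta0] offsets the mean of
    -W^T W beta0 / n. *)
Let M_error j : j \in T -> `|(M *m (tbeta - beta0)) j 0| <= b * `|beta0| + rho0.
Proof.
move=> jT; case: solution => -[/(_ j jT) h _] _.
move: h; rewrite tt0 mxE residual normr_le0 subr_eq0 => /eqP h.
rewrite mulmxBr sub_colE -h.
have -> : (N1 *: (Z^T *m y)) j 0 - (M *m beta0) j 0 =
    (hG - Gam) j j * beta0 j 0
    + (N1 *: (Z^T *m (xi - W *m beta0)) + Gam *m beta0) j 0.
  have dG : is_diag_mx (hG - Gam).
    apply/is_diag_mxP => i1 i2 i12; rewrite !mxE.
    by rewrite (is_diag_mxP diag_hG)// (is_diag_mxP diag_Gam)// subr0.
  rewrite -(diag_mul _ _ dG).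
  have -> : y = Z *m beta0 + (xi - W *m beta0).
    by rewrite /Z mulmxDl /y addrACA subrr addr0.
  rewrite /M !mulmxBl mulmxDr -scalemxAl mulmxA scalerDr.
  by rewrite !(add_colE, opp_colE, scale_colE); ring.
apply: le_trans (ler_normD _ _) _; apply: lerD; last exact: event_noise.
rewrite normrM ler_pM//; last exact: norm_mx_entry_le.
by apply: le_trans hGb; exact: norm_mx_entry_le.
Qed.

Let rho := Num.sqrt k%:R * (b * `|beta0| + rho0).

Let dot_vM : `|dot v (M *m (tbeta - beta0))| <= norm2 v * rho.
Proof.
apply: (@le_trans _ _ (norm1 v * (b * `|beta0| + rho0))).
  apply: le_trans (ler_norm_sum _ _ _) _; rewrite mulr_suml; apply: ler_sum => j _.
  rewrite normrM; have [jT|jT] := boolP (j \in T).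
    by rewrite ler_wpM2l// M_error.
  by rewrite (vT jT) normr0 !mul0r.
rewrite /rho mulrCA mulrA ler_wpM2r ?norm1_le//.
by rewrite addr_ge0// mulr_ge0.
Qed.

Let h := restr T (E *m e).
Let eta := norm2 h.

Let dot_restr (u w : 'cV[R]_p) : supported T u -> dot u (restr T w) = dot u w.
Proof.
move=> uT; apply: eq_bigr => j _; rewrite mxE; case: ifPn => // /uT ->.
by rewrite !mul0r.
Qed.

Let main_inequality :
  2 / 5 * phi * norm2 v ^+ 2 <=
    (Phi - phi) * norm2 e ^+ 2 / 4 + norm2 v * eta + norm2 v * rho.
Proof.
have Phiphi : phi <= Phi by apply: phi_min_le_max; rewrite // addn_gt0 s0 orbT.
pose a2 := N1 * norm2 (X *m v) ^+ 2.
pose g := N1 * dot (X *m v) (X *m e).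
have vphi : phi * norm2 v ^+ 2 <= a2 by apply: (phi_min_le X vT); exact: leq_addr.
have eF : N1 * norm2 (X *m e) ^+ 2 <= Phi * norm2 e ^+ 2 by exact: (phi_max_ge X eS).
(* Psi - phi is nonnegative on sparse vectors only, so Cauchy-Schwarz is obtained from the
   discriminant in t: each t v - e is supported on at most K indices, and v is orthogonal to e. *)
have pencil t : phi * (t ^+ 2 * norm2 v ^+ 2 + norm2 e ^+ 2) <=
    t ^+ 2 * a2 - 2 * t * g + N1 * norm2 (X *m e) ^+ 2.
  have tv : supported T (t *: v) by move=> j jT; rewrite scale_colE vT// mulr0.
  have := phi_min_le X (TS tv (supportedN eS)) cardTS; rewrite -/phi -/N1.
  rewrite mulmxDr mulmxN -scalemxAr !norm2_pencil dot_ve//.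
  by rewrite /a2 /g; lra.
have hg : g ^+ 2 <= (a2 - phi * norm2 v ^+ 2) * ((Phi - phi) * norm2 e ^+ 2).
  have eP : 0 <= N1 * norm2 (X *m e) ^+ 2 - phi * norm2 e ^+ 2.
    by have := pencil 0; rewrite expr0n/=; lra.
  apply: (@le_trans _ _ ((a2 - phi * norm2 v ^+ 2) *
      (N1 * norm2 (X *m e) ^+ 2 - phi * norm2 e ^+ 2))).
    apply: discriminant_le => //; first by rewrite subr_ge0.
    by move=> t; have := pencil t; lra.
  by rewrite ler_wpM2l ?subr_ge0// mulrBl lerD2r.
apply: quadratic_absorb vphi Phiphi hg _.
have hM := dot_vM; rewrite delta_split mulmxBr dotBr !M_dot -norm2_sqr -/a2 -/g in hM.
have hv := E_TT vT.
have he : `|dot v (E *m e)| <= norm2 v * eta.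
  by rewrite -(dot_restr _ vT); exact: cauchy_schwarz.
move: hM hv he; rewrite !ler_norml => /andP[_ h1] /andP[_ h2] /andP[h3 _].
lra.
Qed.

Let sqrtK1 : 1 <= Num.sqrt K%:R :> R.
Proof. by rewrite -[leLHS]sqrtr1 ler_sqrt ?ler1n ?addn_gt0 ?s0 ?orbT. Qed.

Let sqrt_le (x c : R) : 0 <= c -> x <= c ^+ 2 -> Num.sqrt x <= c.
Proof. by move=> c0 xc; rewrite -(ger0_norm c0) -sqrtr_sqr ler_wsqrtr. Qed.

Let sk_le : Num.sqrt s%:R * Num.sqrt k%:R <= K%:R / 2 :> R.
Proof.
rewrite -sqrtrM//; apply: sqrt_le; first by rewrite divr_ge0.
by rewrite /K natrD -/k; have := sqr_ge0 (k%:R - s%:R : R); nra.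
Qed.

Let h_sup j : `|h j 0| <= B * (Num.sqrt s%:R * norm2 e).
Proof.
have B1 : 0 <= B * (Num.sqrt s%:R * norm2 e).
  by rewrite mulr_ge0// mulr_ge0 ?norm2_ge0 ?sqrtr_ge0.
rewrite mxE; case: ifP => _; last by rewrite normr0.
apply: (@le_trans _ _ (B * norm1 e)).
  rewrite mxE; apply: le_trans (ler_norm_sum _ _ _) _.
  by rewrite mulr_sumr; apply: ler_sum => i _; rewrite normrM ler_wpM2r.
rewrite ler_wpM2l//; apply: le_trans (norm1_le eS) _.
by rewrite ler_wpM2r ?norm2_ge0// ler_wsqrtr// ler_nat.
Qed.

(** The sup bound and |h|_1 <= sqrt(k) eta give eta <= B sqrt(s k) |e|, and sqrt(s k) <= K/2 halves
    the 7/8 of the budget. *)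
Let eta_weak : eta <= 7 / 16 * phi * norm2 e.
Proof.
have [->|eta_neq0] := eqVneq eta 0.
  by rewrite mulr_ge0 ?norm2_ge0// mulr_ge0// ltW.
have eta0 : 0 < eta by rewrite lt_neqAle eq_sym eta_neq0 norm2_ge0.
have h1 := norm2_sqr_le_sup_norm1 h_sup.
have h2 := norm1_le (@supported_restr _ _ T (E *m e)); rewrite -/h -/eta -/k in h2.
have : eta <= B * (Num.sqrt s%:R * norm2 e) * Num.sqrt k%:R.
  rewrite -(ler_pM2r eta0) -expr2; apply: le_trans h1 _.
  rewrite -[leRHS]mulrA ler_wpM2l// mulr_ge0// mulr_ge0 ?norm2_ge0 ?sqrtr_ge0//.
move=> /le_trans; apply.
have -> : B * (Num.sqrt s%:R * norm2 e) * Num.sqrt k%:R =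
    B * (Num.sqrt s%:R * Num.sqrt k%:R) * norm2 e by ring.
rewrite ler_wpM2r ?norm2_ge0//.
apply: le_trans (ler_wpM2l B0 sk_le) _.
by case: budget => _ ? _; lra.
Qed.

Let norm2_sign sg : norm2 (sign_vector T sg) <= Num.sqrt k%:R.
Proof.
rewrite ler_wsqrtr// /k -sum1_card natr_sum [leRHS]big_mkcond/=; apply: ler_sum => j _.
by rewrite mxE; case: ifP => _; rewrite ?expr0n//= -exprM mulnC exprM sqrrN !expr1n.
Qed.

Let norm2_Xe : norm2 (X *m e) <= Num.sqrt (n%:R * Phi) * norm2 e.
Proof.
have Phi0 : 0 <= Phi by exact: phi_max_ge0.
rewrite -ler_sqr ?nnegrE ?mulr_ge0 ?norm2_ge0 ?sqrtr_ge0//.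
have := phi_max_ge X eS cardS; rewrite -/Phi ler_pdivrMl ?ltr0n// => /le_trans; apply.
by rewrite exprMn (sqr_sqrtr (mulr_ge0 (ler0n _ _) Phi0)) mulrA.
Qed.

(** The number of blocks, the integer quotient of k by s plus 1, multiplied by s is at most k + s =
    K. *)
Let norm2_Xsign sg : Num.sqrt s%:R * norm2 (X *m sign_vector T sg) <=
  K%:R * Num.sqrt (n%:R * Phi).
Proof.
have Phi0 : 0 <= Phi by exact: phi_max_ge0.
have sT : supported T (sign_vector T sg) by move=> j /negbTE jT; rewrite mxE jT.
have s1 j : `|sign_vector T sg j 0| <= 1.
  by rewrite mxE; case: ifP => _; rewrite ?normr0// normrX normrN1 expr1n.
have kk : (#|T| <= (k %/ s).+1 * s)%N by rewrite ltnW// ltn_ceil.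
have := norm2_mulmx_block X n0 p0 s0 sT s1 kk; rewrite -/Phi => hb.
have sK : (k %/ s).+1%:R * s%:R <= K%:R :> R.
  by rewrite -natrM ler_nat mulSn addnC leq_add2r leq_trunc_div.
apply: le_trans (ler_wpM2l (sqrtr_ge0 _) hb) _.
have -> : Num.sqrt (n%:R * s%:R * Phi) = Num.sqrt s%:R * Num.sqrt (n%:R * Phi).
  by rewrite -sqrtrM//; congr Num.sqrt; ring.
set a := (k %/ s).+1%:R in sK *; set w := Num.sqrt (n%:R * Phi).
have -> : Num.sqrt s%:R * (a * (Num.sqrt s%:R * w)) = a * (Num.sqrt s%:R) ^+ 2 * w by ring.
by rewrite (sqr_sqrtr (ler0n _ _)) ler_wpM2r ?sqrtr_ge0.
Qed.

(** The l1 norm is attained at the signs of [h], which brings in the three sign events. The bounded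
    ratio enters through Phi <= 20 phi <= 20 q^2: it replaces phi_max by m_2 in the norms of X e and
    X u. *)
Let h_norm1 : Phi <= 20 * phi ->
  Num.sqrt s%:R * norm1 h <=
    74 * A ^+ 2 * (1 + q) * (norm2 e * l * (K%:R * Num.sqrt K%:R)).
Proof.
move=> Phi20.
have Phi0 : 0 <= Phi by exact: phi_max_ge0.
have Phiq : Phi <= 20 * q ^+ 2 by move: phiq; lra.
pose sg j := h j 0 < 0.
pose u := sign_vector T sg.
have -> : norm1 h = dot u (E *m e).
  apply: eq_bigr => j _; rewrite !mxE /sg !mxE; case: ifP => _; last by rewrite normr0 mul0r.
  by rewrite normrEsign.
(* [hG] is diagonal, and u and e have disjoint supports. *)
have uhG : dot u (hG *m e) = 0.
  apply: big1 => j _; rewrite (diag_mul _ _ diag_hG).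
  have [jT|/negbTE jT] := boolP (j \in T); last by rewrite [u j 0]mxE jT mul0r.
  by rewrite [e j 0]mxE finset.in_setC jT !mulr0.
have -> : dot u (E *m e) = - N1 * (dot (X *m u) (W *m e) + dot (W *m u) (X *m e)
    + dot (W *m u) (W *m e)).
  rewrite /E mulmxBl dotBr uhG -scalemxAl dotZr !mulmxDl !dotDr -!mulmxA.
  rewrite (dot_mulmx X^T) !(dot_mulmx W^T) !trmxK; ring.
have ha := event_WX_sign sg; have hb := event_XW_sign sg; have hc := event_WW_sign sg.
rewrite /= -/u in ha hb hc.
set F := K%:R * Num.sqrt K%:R.
have F0 : 0 <= F by rewrite mulr_ge0 ?sqrtr_ge0.
have rs0 : 0 <= Num.sqrt s%:R :> R by exact: sqrtr_ge0.
have e0 : 0 <= norm2 e by exact: norm2_ge0.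
have ns : norm2 u <= Num.sqrt k%:R by exact: norm2_sign.
have el0 : 0 <= norm2 e * l by rewrite mulr_ge0.
set S12 := Num.sqrt (12 * (K%:R * n%:R)) in ha hb.
have S120 : 0 <= S12 by exact: sqrtr_ge0.
set w := Num.sqrt (n%:R * Phi).
have w0 : 0 <= w by exact: sqrtr_ge0.
have N0 : 0 < n%:R :> R by rewrite ltr0n.
(* 16 is an upper bound for sqrt(20 * 12). *)
set G := 16 * (n%:R * q * Num.sqrt K%:R).
have G0 : 0 <= G by rewrite !mulr_ge0 ?sqrtr_ge0.
have wS : w * S12 <= G.
  rewrite /w /S12 -sqrtrM ?mulr_ge0//; apply: sqrt_le => //.
  rewrite /G !exprMn (sqr_sqrtr (ler0n _ K)).
  have h1 : Phi * (n%:R ^+ 2 * K%:R) <= 20 * q ^+ 2 * (n%:R ^+ 2 * K%:R).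
    by rewrite ler_wpM2r// mulr_ge0// exprn_ge0.
  have h2 : 0 <= q ^+ 2 * (n%:R ^+ 2 * K%:R) by rewrite !mulr_ge0 ?sqr_ge0// exprn_ge0.
  by lra.
have snu : Num.sqrt s%:R * norm2 u <= K%:R / 2.
  by apply: le_trans sk_le; rewrite ler_wpM2l.
have snu0 : 0 <= Num.sqrt s%:R * norm2 u by rewrite mulr_ge0 ?norm2_ge0.
have sl0 : 0 <= sigma * l by rewrite mulr_ge0// ltW.
have ha' : Num.sqrt s%:R * `|dot (W *m u) (X *m e)| <=
    sigma * l * (K%:R / 2 * (norm2 e * G)).
  apply: le_trans (ler_wpM2l rs0 ha) _.
  have -> : Num.sqrt s%:R * (sigma * norm2 u * norm2 (X *m e) * (S12 * l)) =
    sigma * l * ((Num.sqrt s%:R * norm2 u) * (norm2 (X *m e) * S12)) by ring.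
  rewrite ler_wpM2l// ler_pM ?mulr_ge0 ?norm2_ge0//.
  apply: le_trans (ler_wpM2r S120 norm2_Xe) _.
  by rewrite mulrAC mulrC ler_wpM2l.
have hb' : Num.sqrt s%:R * `|dot (X *m u) (W *m e)| <=
    sigma * l * (K%:R * (norm2 e * G)).
  apply: le_trans (ler_wpM2l rs0 hb) _.
  have -> : Num.sqrt s%:R * (sigma * norm2 e * norm2 (X *m u) * (S12 * l)) =
    sigma * l * (norm2 e * ((Num.sqrt s%:R * norm2 (X *m u)) * S12)) by ring.
  rewrite ler_wpM2l// [leRHS]mulrCA ler_wpM2l//.
  apply: le_trans (ler_wpM2r S120 (norm2_Xsign sg)) _.
  by rewrite -mulrA ler_wpM2l.
have s6 : Num.sqrt (6 * K%:R) <= 49 / 20 * Num.sqrt K%:R :> R.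
  apply: (@sqrt_le (6 * K%:R) (49 / 20 * Num.sqrt K%:R)); first by rewrite mulr_ge0 ?sqrtr_ge0.
  by rewrite exprMn (sqr_sqrtr (ler0n _ K)); have := ltW K0; lra.
have hc' : Num.sqrt s%:R * `|dot (W *m u) (W *m e)| <= sigma ^+ 2 * norm2 e *
    (n%:R * (K%:R / 2 * (60 * (49 / 20 * Num.sqrt K%:R * l) + 72 * (K%:R * l ^+ 2)))).
  apply: le_trans (ler_wpM2l rs0 hc) _.
  set t := 60 * (Num.sqrt (6 * K%:R) * l) + 72 * (K%:R * l ^+ 2).
  have t0 : 0 <= t by rewrite addr_ge0// !mulr_ge0 ?sqrtr_ge0 ?sqr_ge0.
  have -> : Num.sqrt s%:R * (sigma ^+ 2 * norm2 u * norm2 e * (n%:R * t)) =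
    sigma ^+ 2 * norm2 e * (n%:R * ((Num.sqrt s%:R * norm2 u) * t)) by ring.
  apply: ler_wpM2l; first by rewrite mulr_ge0 ?sqr_ge0.
  apply: ler_wpM2l => //; apply: ler_pM => //.
  by rewrite /t lerD2r; apply: ler_wpM2l => //; apply: ler_wpM2r.
have slK : sigma * l * K%:R <= q / 4.
  case: budget => bq _ _; apply: le_trans bq.
  by rewrite ler_wpM2r// ler_wpM2l// ltW.
have hc2 : sigma ^+ 2 * norm2 e * (n%:R * (K%:R / 2 *
      (60 * (49 / 20 * Num.sqrt K%:R * l) + 72 * (K%:R * l ^+ 2)))) <=
    n%:R * (norm2 e * l * F) * (147 / 2 * sigma ^+ 2 + 9 * (sigma * q)).
  have h1 : 0 <= n%:R * (norm2 e * l) * K%:R * sigma.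
    by rewrite !mulr_ge0// ltW.
  have h2 : sigma * l * K%:R <= q / 4 * Num.sqrt K%:R.
    by apply: le_trans slK _; rewrite ler_peMr// divr_ge0.
  have := ler_wpM2l h1 h2; rewrite /F; lra.
have tri : `|- N1 * (dot (X *m u) (W *m e) + dot (W *m u) (X *m e)
    + dot (W *m u) (W *m e))| <= N1 * (`|dot (X *m u) (W *m e)|
    + `|dot (W *m u) (X *m e)| + `|dot (W *m u) (W *m e)|).
  rewrite normrM normrN (gtr0_norm N10); apply: ler_wpM2l; first exact: ltW.
  by apply: le_trans (ler_normD _ _) _; rewrite lerD2r ler_normD.
apply: le_trans (ler_wpM2l rs0 (le_trans (ler_norm _) tri)) _.
rewrite mulrCA ler_pdivrMl// !mulrDr.
have efl : 0 <= n%:R * (norm2 e * l * F) by rewrite !mulr_ge0.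
have hab : sigma * l * (K%:R / 2 * (norm2 e * G)) + sigma * l * (K%:R * (norm2 e * G))
    = n%:R * (norm2 e * l * F) * (24 * (sigma * q)).
  by rewrite /G /F; field.
(* 33 = 24 + 9, where 9 = 72/8 comes from the quadratic term after sigma l K <= q/4; and 147/2 = 60
   (49/20) / 2. *)
have coef : 33 * (sigma * q) + 147 / 2 * sigma ^+ 2 <= 74 * A ^+ 2 * (1 + q).
  have sA : sigma ^+ 2 <= A ^+ 2 by rewrite ler_sqr ?nnegrE ?(ltW sigma0)// (le_trans _ A1).
  have AA : A <= A ^+ 2 by rewrite expr2 ler_peMr// (le_trans _ A1).
  have sq : sigma * q <= A ^+ 2 * q by rewrite ler_wpM2r// (le_trans sigmaA).
  have : 0 <= A ^+ 2 * q by rewrite mulr_ge0 ?sqr_ge0.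
  have := sqr_ge0 A; lra.
have := ler_wpM2l efl coef.
lra.
Qed.

(* The l2 norm of [h] is controlled by its sup norm times its l1 norm; the
   latter is a maximum over sign vectors, so that a union bound over finitely
   many sign patterns replaces an epsilon-net of the sphere. *)
Let eta_strong : Phi <= 20 * phi ->
  eta ^+ 2 <= phi * norm2 e * (65 * A ^+ 2 * (1 + q) * Num.sqrt K%:R * l * norm2 e).
Proof.
move=> /h_norm1 hn; apply: le_trans (norm2_sqr_le_sup_norm1 h_sup) _.
have Be : 0 <= B * norm2 e by rewrite mulr_ge0 ?norm2_ge0.
have -> : B * (Num.sqrt s%:R * norm2 e) * norm1 h =
  B * norm2 e * (Num.sqrt s%:R * norm1 h) by ring.
apply: le_trans (ler_wpM2l Be hn) _.
case: budget => _ KB _.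
have c2 : 0 <= A ^+ 2 * (1 + q) * Num.sqrt K%:R * l * norm2 e ^+ 2.
  apply: mulr_ge0; last exact: sqr_ge0.
  apply: mulr_ge0 => //; apply: mulr_ge0; last exact: sqrtr_ge0.
  by apply: mulr_ge0; [exact: sqr_ge0|exact: addr_ge0].
have c0 : 0 <= 74 * A ^+ 2 * (1 + q) * Num.sqrt K%:R * l * norm2 e ^+ 2.
  by have : 0 <= 74 :> R by []; lra.
have c1 : 0 <= phi * (A ^+ 2 * (1 + q) * Num.sqrt K%:R * l * norm2 e ^+ 2).
  by rewrite mulr_ge0 ?(ltW phi0).
(* 74 * 7/8 = 64.75 is rounded up to 65; the factor K of [h_norm1] is spent on K B <= 7/8 phi. *)
have := ler_wpM2r c0 KB; lra.
Qed.

(** The scalar bound is applied to |v|, |e| and |v - e| after division by phi, with r^2 = Phi / phi;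
    520 is 8 * 65. In the contribution of the cross term, |e| is finally replaced by |beta0|. *)
Lemma refit_error_bound :
  norm2 (tbeta - beta0) <=
    Num.sqrt K%:R / phi *
      (4 * (b * `|beta0| + rho0) + 520 * A ^+ 2 * (1 + q) * l * norm2 beta0)
    + norm2 e * (Num.sqrt Phi / Num.sqrt phi).
Proof.
have Phiphi : phi <= Phi by apply: phi_min_le_max; rewrite // addn_gt0 s0 orbT.
have sphi0 : 0 < Num.sqrt phi by rewrite sqrtr_gt0.
pose r := Num.sqrt Phi / Num.sqrt phi.
have r2 : r ^+ 2 = Phi / phi.
  by rewrite expr_div_n !sqr_sqrtr ?(ltW phi0)// (le_trans (ltW phi0)).
have ye : norm2 e <= norm2 beta0 by exact: norm2_restr_le.
have rho_le : rho <= Num.sqrt K%:R * (b * `|beta0| + rho0).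
  rewrite /rho ler_wpM2r ?ler_wsqrtr ?ler_nat ?leq_addr//.
  by rewrite addr_ge0// mulr_ge0.
have rho_ge0 : 0 <= rho by rewrite mulr_ge0 ?sqrtr_ge0// addr_ge0// mulr_ge0.
pose Q := 65 * A ^+ 2 * (1 + q) * Num.sqrt K%:R * l * norm2 e / phi.
have Q0 : 0 <= Q.
  rewrite /Q; apply: divr_ge0; last exact: ltW.
  apply: mulr_ge0; last exact: norm2_ge0.
  apply: mulr_ge0 => //; apply: mulr_ge0; last exact: sqrtr_ge0.
  by apply: mulr_ge0; [rewrite mulr_ge0 ?sqr_ge0|exact: addr_ge0].
have := @refit_scalar_bound R (norm2 v) (norm2 e) (norm2 (tbeta - beta0)) r
  (eta / phi) (rho / phi) Q.
have -> : r ^+ 2 - 1 = (Phi - phi) / phi by rewrite r2; field; rewrite gt_eqF.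
move=> /(_ (norm2_ge0 _) (norm2_ge0 _) (norm2_ge0 _)) hb.
apply: le_trans (hb _ _ _ Q0 _ _ _ _) _.
- by rewrite ler_pdivlMr// mul1r ler_wsqrtr.
- by rewrite divr_ge0 ?norm2_ge0// ltW.
- by rewrite divr_ge0// ltW.
- have := norm2_pencil 1 v e; rewrite scale1r dot_ve// -delta_split => ->; ring.
- rewrite -(ler_pM2r phi0).
  have := main_inequality; set z := norm2 v.
  have -> : ((Phi - phi) / phi * norm2 e ^+ 2 / 4 + z * (eta / phi) + z * (rho / phi)) * phi
    = (Phi - phi) * norm2 e ^+ 2 / 4 + z * eta + z * rho by field; rewrite gt_eqF.
  by lra.
- by rewrite ler_pdivrMr// mulrAC.
- rewrite r2 ler_pdivrMr// => /eta_strong he.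
  rewrite expr_div_n ler_pdivrMr ?exprn_gt0//.
  apply: le_trans he _; rewrite le_eqVlt; apply/orP; left; apply/eqP.
  by rewrite /Q; field; rewrite gt_eqF.
have c0 : 0 <= 520 * A ^+ 2 * (1 + q) * l * (Num.sqrt K%:R / phi).
  apply: mulr_ge0; last by rewrite divr_ge0 ?sqrtr_ge0// ltW.
  apply: mulr_ge0; last exact: l0.
  apply: mulr_ge0; last exact: addr_ge0.
  by apply: mulr_ge0; [exact: ler0n|exact: sqr_ge0].
have := ler_wpM2l c0 ye.
have : rho / phi <= Num.sqrt K%:R / phi * (b * `|beta0| + rho0).
  by rewrite ler_pdivrMr// mulrAC divfK ?gt_eqF.
have -> : 8 * Q = 520 * A ^+ 2 * (1 + q) * l * (Num.sqrt K%:R / phi) * norm2 e.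
  by rewrite /Q; field; rewrite gt_eqF.
rewrite -/r; lra.
Qed.

End deterministic_bound.

(** * Deviation events of the model *)

Section finite_union.
Context {R : realType} {d : measure_display} {Omega : measurableType d}.
Variable P : probability Omega R.

Lemma measurable_abs_gt (f : Omega -> R) (c : R) : measurable_fun setT f ->
  measurable [set w | c < `|f w|].
Proof.
move=> mf; have mA : measurable_fun setT (fun w => `|f w|) by exact: measurableT_comp.
have := mA measurableT _ (measurable_itv `]c, +oo[); rewrite setTI.
by congr measurable; apply/seteqP; split => w /=; rewrite in_itv/= andbT.
Qed.

Lemma probability_finite_union (I : finType) (A : I -> set Omega) (c : I -> R) :
  (forall i, measurable (A i)) -> (forall i, (P (A i) <= (c i)%:E)%E) ->
  (P (\bigcup_(i in setT) A i) <= (\sum_i c i)%:E)%E.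
Proof.
move=> mA Ac.
have fT : finite_set [set: I] by exact: finite_finset.
apply: (@le_trans _ _ (\sum_(i \in [set: I]) P (A i))%E).
  by apply: content_sub_fsum => //; exact: fin_bigcup_measurable.
rewrite -sumEFin (_ : [set: I] = [set` index_enum I]); last first.
  by apply/seteqP; split => i //= _; rewrite mem_index_enum.
by rewrite -fsbig_seq ?index_enum_uniq//; exact: lee_sum.
Qed.

End finite_union.

Section model_events.
Context {R : realType} {n p : nat} {d : measure_display} {Omega : measurableType d}.
Variables (P : probability Omega R) (X : 'M[R]_(n, p)) (beta0 : 'cV[R]_p).
Variables (xi : Omega -> 'cV[R]_n) (W : Omega -> 'M[R]_(n, p)).
Variables (sw sx : R).
Hypothesis n0 : (0 < n)%N.
Hypotheses (sw0 : 0 < sw) (sx0 : 0 < sx).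
Hypothesis model : eiv_model P X beta0 xi W.

Let M w := row_mx (obs_y X beta0 xi w) (obs_z X W w).
(** The generators are those of [sigma_mx] for row i of (y, z). As [X] and [beta0] are
    deterministic, w_i = z_i - x_i and xi_i = y_i - x_i^T beta0 are measurable for the generated
    sigma-algebra, so the pairs (w_i, xi_i) inherit independence across i from the observations. *)
Let F (i : 'I_n) : set_system Omega :=
  [set A | exists a b, exists2 B : set R,
     measurable B & A = (fun w => row i (M w) a b) @^-1` B].
Let Gam := Gamma P W.

Hypothesis mgf_W : forall i (u : 'cV[R]_p) (t : R),
  ('E_P[(fun w => expR (t * (W w *m u) i 0))%R] <=
   (expR (t ^+ 2 * (sw * norm2 u) ^+ 2 / 2))%:E)%E.
Hypothesis mgf_xi : forall i (t : R),
  ('E_P[(fun w => expR (t * xi w i 0))%R] <= (expR (t ^+ 2 * sx ^+ 2 / 2))%:E)%E.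
Hypothesis uncor_W : forall i (j k : 'I_p), j != k ->
  ('E_P[(fun w => W w i j * W w i k)%R] = 0)%E.
Hypothesis uncor_Wxi : forall i j,
  ('E_P[(fun w => W w i j * xi w i 0)%R] = 0)%E.

Let mW i j : measurable_fun setT (fun w => W w i j).
Proof. by case: model => _ + _ _; apply. Qed.

Let mxi i : measurable_fun setT (fun w => xi w i 0).
Proof. by case: model => + _ _ _; apply. Qed.

Let mM i j : measurable_fun setT (fun w => M w i j).
Proof.
rewrite /M -(splitK j); case: (fintype.split j) => c /=.
  under eq_fun do rewrite row_mxEl mxE; apply: measurable_funD => //.
  by rewrite ord1.
by under eq_fun do rewrite row_mxEr mxE; exact: measurable_funD.
Qed.

Let Fm i : F i `<=` measurable.
Proof.
move=> _ [a [c [B mB ->]]].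
have e : (fun w => row i (M w) a c) = fun w => M w i c.
  by apply/funext => w; rewrite [LHS]mxE.
by rewrite e -[_ @^-1` _]setTI; exact: mM.
Qed.

Let indep : independent_family P (fun i => <<s F i >>).
Proof. by case: model. Qed.

Let FM i j : measurable_fun setT ((fun w => M w i j) : g_sigma_algebraType (F i) -> R).
Proof.
move=> _ B mB; rewrite setTI; apply: sub_gen_smallest.
exists 0, j, B => //.
have e w : row i (M w) 0 j = M w i j by rewrite [LHS]mxE.
by apply/seteqP; split => w /=; rewrite e.
Qed.

Let FW i j : measurable_fun setT ((fun w => W w i j) : g_sigma_algebraType (F i) -> R).
Proof.
rewrite (_ : (fun w => W w i j) = fun w => M w i (rshift 1 j) - X i j).
  by apply: measurable_funB => //; exact: FM.
by apply/funext => w; rewrite row_mxEr mxE; ring.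
Qed.

Let Fxi i : measurable_fun setT ((fun w => xi w i 0) : g_sigma_algebraType (F i) -> R).
Proof.
rewrite (_ : (fun w => xi w i 0) = fun w => M w i (lshift p 0) - (X *m beta0) i 0).
  by apply: measurable_funB => //; exact: FM.
by apply/funext => w; rewrite row_mxEl mxE; ring.
Qed.

Let FWu i (u : 'cV[R]_p) :
  measurable_fun setT ((fun w => (W w *m u) i 0) : g_sigma_algebraType (F i) -> R).
Proof.
under eq_fun do rewrite mxE.
by apply: measurable_sum => j; apply: measurable_funM => //; exact: FW.
Qed.

Let mWu i (u : 'cV[R]_p) : measurable_fun setT (fun w => (W w *m u) i 0).
Proof.
under eq_fun do rewrite mxE.
by apply: measurable_sum => j; apply: measurable_funM => //; exact: mW.
Qed.

Lemma measurable_dot_W (a : 'cV[R]_n) (u : 'cV[R]_p) :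
  measurable_fun setT (fun w => dot a (W w *m u)).
Proof. by apply: measurable_sum => i; exact: measurable_funM. Qed.

Lemma measurable_dot_xi (a : 'cV[R]_n) : measurable_fun setT (fun w => dot a (xi w)).
Proof. by apply: measurable_sum => i; exact: measurable_funM. Qed.

Lemma measurable_dot_WW (u v : 'cV[R]_p) :
  measurable_fun setT (fun w => dot (W w *m u) (W w *m v)).
Proof. by apply: measurable_sum => i; exact: measurable_funM. Qed.

Lemma measurable_dot_Wxi (u : 'cV[R]_p) :
  measurable_fun setT (fun w => dot (W w *m u) (xi w)).
Proof. by apply: measurable_sum => i; exact: measurable_funM. Qed.

Let dot0l (m : nat) (u : 'cV[R]_m) : dot 0 u = 0.
Proof. by apply: big1 => j _; rewrite mxE mul0r. Qed.

(** Covers zero vectors, where the scale is zero and the tail bounds, stated for positive scales, do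
    not apply. *)
Let empty_event (f : Omega -> R) (c L : R) : 0 <= c -> (forall w, f w = 0) ->
  (P [set w | (c < `|f w|)%R] <= (2 * expR (- L))%:E)%E.
Proof.
move=> c0 f0; rewrite (_ : [set w | _] = set0) ?measure0 ?lee_fin ?mulr_ge0 ?expR_ge0//.
by apply/seteqP; split => // w /=; rewrite f0 normr0 ltNge c0.
Qed.

Lemma event_dot_W (a : 'cV[R]_n) (u : 'cV[R]_p) (L : R) : 0 < L ->
  (P [set w | (sw * norm2 u * norm2 a * Num.sqrt (2 * L) < `|dot a (W w *m u)|)%R]
     <= (2 * expR (- L))%:E)%E.
Proof.
move=> L0; have c0 : 0 <= sw * norm2 u * norm2 a * Num.sqrt (2 * L).
  by rewrite !mulr_ge0 ?norm2_ge0 ?sqrtr_ge0// ltW.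
have [->|a0] := eqVneq a 0.
  by apply: empty_event => [|w]; rewrite ?dot0l// norm2_0 mulr0 mul0r.
have [->|u0] := eqVneq u 0.
  by apply: empty_event => [|w]; rewrite ?mulmx0 1?dotC ?dot0l// norm2_0 mulr0 !mul0r.
have pos (m : nat) (z : 'cV[R]_m) : z != 0 -> 0 < norm2 z.
  move=> z0; rewrite lt_neqAle norm2_ge0 eq_sym andbT.
  by apply: contra_neq z0; exact: norm2_eq0.
rewrite mulrC.
apply: (@linear_tail _ _ _ _ _ F Fm indep (fun i w => a i 0 * (W w *m u) i 0)
  (fun i => (sw * norm2 u) ^+ 2 * a i 0 ^+ 2)) => //.
- by move=> i; exact: measurable_funM.
- move=> i t; under [X in expectation _ X]eq_fun do rewrite mulrA.
  apply: le_trans (mgf_W _ _ _) _; rewrite lee_fin ler_expR.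
  by rewrite le_eqVlt; apply/orP; left; apply/eqP; field.
- by rewrite !mulr_gt0 ?pos.
- rewrite -mulr_sumr [leRHS]exprMn norm2_sqr.
  by rewrite ler_wpM2l ?sqr_ge0//; apply: ler_sum => i _; rewrite expr2.
Qed.

Lemma event_dot_xi (a : 'cV[R]_n) (L : R) : 0 < L ->
  (P [set w | (sx * norm2 a * Num.sqrt (2 * L) < `|dot a (xi w)|)%R]
     <= (2 * expR (- L))%:E)%E.
Proof.
move=> L0.
have [->|a0] := eqVneq a 0.
  by apply: empty_event => [|w]; rewrite ?dot0l// norm2_0 mulr0 mul0r.
have pa : 0 < norm2 a.
  by rewrite lt_neqAle norm2_ge0 eq_sym andbT; apply: contra_neq a0; exact: norm2_eq0.
rewrite mulrC.
apply: (@linear_tail _ _ _ _ _ F Fm indep (fun i w => a i 0 * xi w i 0)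
  (fun i => sx ^+ 2 * a i 0 ^+ 2)) => //.
- by move=> i; exact: measurable_funM.
- move=> i t; under [X in expectation _ X]eq_fun do rewrite mulrA.
  apply: le_trans (mgf_xi _ _) _; rewrite lee_fin ler_expR.
  by rewrite le_eqVlt; apply/orP; left; apply/eqP; field.
- by rewrite mulr_gt0.
- rewrite -mulr_sumr [leRHS]exprMn norm2_sqr.
  by rewrite ler_wpM2l ?sqr_ge0//; apply: ler_sum => i _; rewrite expr2.
Qed.

Let W_Lfun i j k : (fun w => W w i j * W w i k) \in Lfun P 1.
Proof.
have h j' t := @mgf_W i (delta_mx j' 0) t.
have e j' w : (W w *m (delta_mx j' 0 : 'cV[R]_p)) i 0 = W w i j'.
  by rewrite mulmx_delta mxE.
apply: (subgaussian_mul_Lfun1 _ _ sw0 sw0) => // t.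
  have := h j t; rewrite norm2_delta mulr1.
  by under [X in expectation _ X]eq_fun do rewrite e.
have := h k t; rewrite norm2_delta mulr1.
by under [X in expectation _ X]eq_fun do rewrite e.
Qed.

Let expectation_lin (I : finType) (f : I -> Omega -> R) (c m : I -> R) :
  (forall i, f i \in Lfun P 1) -> (forall i, 'E_P[f i]%E = (m i)%:E) ->
  'E_P[(fun w => \sum_i c i * f i w)]%R%E = (\sum_i c i * m i)%:E.
Proof.
move=> lf Ef.
rewrite (_ : (fun w => _) = \sum_(g <- [seq c i \o* f i | i <- index_enum I]) g).
  rewrite expectation_sum ?big_map.
    rewrite -sumEFin; apply: eq_bigr => i _.
    by rewrite expectationZl// Ef.
  by move=> g /mapP[i _ ->]; exact: Lfun_scale.
by apply/funext => w; rewrite big_map fct_sumE; apply: eq_bigr => i _; rewrite mulrC.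
Qed.

(** Uncorrelated coordinates of w_i remove the off-diagonal moments. *)
Let W_second_moment i (u v : 'cV[R]_p) :
  'E_P[(fun w => (W w *m u) i 0 * (W w *m v) i 0)]%R%E =
  (\sum_j u j 0 * (Ew P W i j j * v j 0))%:E.
Proof.
have EW j k : 'E_P[(fun w => W w i j * W w i k)]%R%E = (Ew P W i j k)%:E.
  by rewrite /Ew fineK// expectation_fin_num.
pose c (jk : 'I_p * 'I_p) := u jk.1 0 * v jk.2 0.
rewrite (_ : (fun w => _) = fun w => \sum_jk c jk * (W w i jk.1 * W w i jk.2)).
  rewrite (expectation_lin c (fun jk => W_Lfun i jk.1 jk.2) (fun jk => EW jk.1 jk.2)).
  congr EFin; rewrite -(pair_bigA _ (fun j k => u j 0 * v k 0 * Ew P W i j k))/=.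
  apply: eq_bigr => j _; rewrite (bigD1 j)//= big1 ?addr0; first by ring.
  by move=> k kj; rewrite /Ew uncor_W ?mulr0// eq_sym.
apply/funext => w; rewrite !mxE big_distrlr/= pair_bigA/=.
by apply: eq_bigr => jk _; rewrite /c; ring.
Qed.

Lemma event_dot_WW (u v : 'cV[R]_p) (L : R) : 0 < L ->
  (P [set w | (sw ^+ 2 * norm2 u * norm2 v * (60 * Num.sqrt (n%:R * L) + 12 * L) <
     `|dot (W w *m u) (W w *m v) - n%:R * dot u (Gam *m v)|)%R]
   <= (2 * expR (- L))%:E)%E.
Proof.
move=> L0.
have c0 : 0 <= sw ^+ 2 * norm2 u * norm2 v * (60 * Num.sqrt (n%:R * L) + 12 * L).
  apply: mulr_ge0; first by rewrite !mulr_ge0 ?norm2_ge0// ltW.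
  by apply: addr_ge0; [rewrite mulr_ge0 ?sqrtr_ge0|rewrite mulr_ge0// ltW].
have [->|u0] := eqVneq u 0.
  apply: empty_event => [|w]; last by rewrite mulmx0 !dot0l mulr0 subrr.
  by rewrite norm2_0 mulr0 !mul0r.
have [->|v0] := eqVneq v 0.
  apply: empty_event => [|w]; last by rewrite !mulmx0 1?dotC !dot0l 1?dotC ?dot0l mulr0 subrr.
  by rewrite norm2_0 mulr0 !mul0r.
have pos (m : nat) (z : 'cV[R]_m) : z != 0 -> 0 < norm2 z.
  move=> z0; rewrite lt_neqAle norm2_ge0 eq_sym andbT.
  by apply: contra_neq z0; exact: norm2_eq0.
rewrite (_ : [set w | _] = [set w | (sw * norm2 u) * (sw * norm2 v) *
    (60 * Num.sqrt (n%:R * L) + 12 * L) <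
    `|\sum_i ((W w *m u) i 0 * (W w *m v) i 0 - \sum_j u j 0 * (Ew P W i j j * v j 0))|]).
  apply: (product_event Fm indep n0) => //.
  - by rewrite mulr_gt0 ?pos.
  - by rewrite mulr_gt0 ?pos.
have dG : is_diag_mx Gam by case: model.
have -> : sw ^+ 2 * norm2 u * norm2 v = (sw * norm2 u) * (sw * norm2 v) by ring.
have -> : n%:R * dot u (Gam *m v) = \sum_i \sum_j u j 0 * (Ew P W i j j * v j 0).
  rewrite exchange_big/= mulr_sumr; apply: eq_bigr => j _.
  rewrite mxE (bigD1 j)//= big1 ?addr0; last first.
    by move=> k kj; rewrite (is_diag_mxP dG) ?mul0r// eq_sym.
  rewrite mxE -mulr_sumr -mulr_suml; field.
  by rewrite pnatr_eq0 -lt0n.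
by apply/seteqP; split => w /=; rewrite sumrB.
Qed.

Lemma event_dot_Wxi (j : 'I_p) (L : R) : 0 < L ->
  (P [set w | (sw * sx * (60 * Num.sqrt (n%:R * L) + 12 * L) <
     `|dot (W w *m delta_mx j 0) (xi w)|)%R] <= (2 * expR (- L))%:E)%E.
Proof.
move=> L0.
have e w i : (W w *m (delta_mx j 0 : 'cV[R]_p)) i 0 = W w i j by rewrite mulmx_delta mxE.
rewrite (_ : [set w | _] = [set w | sw * sx *
    (60 * Num.sqrt (n%:R * L) + 12 * L) < `|\sum_i (W w i j * xi w i 0 - 0)|]).
  apply: (product_event Fm indep n0) => // i t.
  have := @mgf_W i (delta_mx j 0) t; rewrite norm2_delta mulr1.
  by under [X in expectation _ X]eq_fun do rewrite e.
by apply/seteqP; split => w /=; rewrite /dot; under [X in `|X|]eq_bigr do rewrite ?subr0 ?e;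
  under [X in _ -> _ < `|X|]eq_bigr do rewrite ?subr0 ?e.
Qed.

End model_events.

(** * Union bounds over events and patterns *)

Section small_events.
Context {R : realType} {d : measure_display} {Omega : measurableType d}.
Variable P : probability Omega R.

Definition small (A : set Omega) (a : R) : Prop :=
  measurable A /\ (P A <= a%:E)%E.

Lemma smallU (A B : set Omega) (a b : R) :
  small A a -> small B b -> small (A `|` B) (a + b).
Proof.
move=> [mA PA] [mB PB]; split; first exact: measurableU.
by rewrite EFinD (le_trans (measureU2 _ mA mB))// leeD.
Qed.

Lemma small_bigcup (I : finType) (A : I -> set Omega) (c : I -> R) (a : R) :
  (forall i, small (A i) (c i)) -> \sum_i c i <= a ->
  small (\bigcup_(i in setT) A i) a.
Proof.
move=> sA ca; split.
  by apply: fin_bigcup_measurable => [|i _]; [exact: finite_finset|exact: (sA i).1].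
apply: le_trans (probability_finite_union (fun i => (sA i).1) (fun i => (sA i).2)) _.
by rewrite lee_fin.
Qed.

Lemma small_const_bigcup (I : finType) (A : I -> set Omega) (c a : R) :
  (forall i, small (A i) c) -> #|I|%:R * c <= a ->
  small (\bigcup_(i in setT) A i) a.
Proof.
by move=> sA ca; apply: small_bigcup sA _; rewrite sumr_const -[leLHS]mulr_natl.
Qed.

Lemma probability_ge_of_small (A B : set Omega) (a : R) :
  small A a -> measurable B -> ~` A `<=` B -> ((1 - a)%:E <= P B)%E.
Proof.
move=> [mA PA] mB AB; apply: (@le_trans _ _ (P (~` A))).
  by rewrite probability_setC// EFinB leeB.
by apply: le_measure; rewrite ?inE//; exact: measurableC.
Qed.

End small_events.

(** Distributivity, one coordinate at a time: [z] has weight 1, every other colour has weight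
    theta. *)
Lemma sum_pattern_weights (R : realType) (p : nat) (C : finType) (z : C) (theta : R) :
  \sum_(g : {ffun 'I_p -> C}) theta ^+ #|[pred j | g j != z]| =
  (1 + (#|C|.-1)%:R * theta) ^+ p.
Proof.
pose F (i : 'I_p) (c : C) : R := if c == z then 1 else theta.
transitivity (\sum_(g : {ffun 'I_p -> C}) \prod_i F i (g i)).
  apply: eq_bigr => g _; rewrite /F -prodr_const big_mkcond/=.
  by apply: eq_bigr => i _; rewrite unfold_in/=; case: (g i == z).
rewrite -bigA_distr_bigA/= -[p in RHS]card_ord -prodr_const; apply: eq_bigr => i _.
rewrite (bigD1 z)//= /F eqxx; congr (_ + _).
rewrite (eq_bigr (fun=> theta)) => [|c /negbTE ->//].
rewrite sumr_const -[LHS]mulr_natl; congr (_%:R * _).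
by rewrite -(cardC1 z); exact: eq_card.
Qed.

Section patterns.
Context {R : realType} {p : nat}.
Implicit Types (g : {ffun 'I_p -> option (option bool)}) (b : 'cV[R]_p).

(* [Some (Some c)] marks a selected position carrying the sign (-1)^c,
   [Some None] a missed position of the support of beta0. *)
Definition pattern_sign g : 'cV[R]_p :=
  \col_j (if g j is Some (Some c) then (-1) ^+ c else 0).
Definition pattern_missed g b : 'cV[R]_p :=
  \col_j (if g j == Some None then b j 0 else 0).
Definition pattern_size g : nat := #|[pred j | g j != None]|.
Definition pattern_of (T : {set 'I_p}) b (sg : 'I_p -> bool) :
    {ffun 'I_p -> option (option bool)} :=
  [ffun j => if j \in T then Some (Some (sg j))
             else if b j 0 != 0 then Some None else None].

Lemma pattern_of_sign T b sg :
  pattern_sign (pattern_of T b sg) = sign_vector T sg.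
Proof.
by apply/matrixP => j k; rewrite !mxE ffunE; case: ifP => // _; case: ifP.
Qed.

Lemma pattern_of_missed T b sg :
  pattern_missed (pattern_of T b sg) b = restr (~: T)%SET b.
Proof.
apply/matrixP => j k; rewrite !mxE ffunE finset.in_setC.
by case: (j \in T) => //=; case: (eqVneq (b j 0) 0) => [->|].
Qed.

Lemma pattern_of_size T b sg : (pattern_size (pattern_of T b sg) <= #|T| + norm0 b)%N.
Proof.
pose S := [set j | b j 0 != 0]%SET.
rewrite [norm0 b](_ : _ = #|S|); last by rewrite cardsE.
apply: leq_trans (leq_card_setU _ _); apply: subset_leq_card.
apply/fintype.subsetP => j; rewrite !inE ffunE.
by case: (j \in T) => //=; case: (b j 0 != 0).
Qed.

(** Signed and missed positions are disjoint. For G = Gamma, this makes the mean subtracted in the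
    quadratic deviation zero for every pattern. *)
Lemma dot_pattern_diag g b (G : 'M[R]_p) : is_diag_mx G ->
  dot (pattern_sign g) (G *m pattern_missed g b) = 0.
Proof.
move=> /is_diag_mxP dG; apply: big1 => j _.
rewrite [in X in _ * X]mxE (bigD1 j)//= big1 ?addr0; last first.
  by move=> k kj; rewrite dG ?mul0r// eq_sym.
by rewrite !mxE; case: (g j) => [[c|]|]; rewrite /= ?mulr0 ?mul0r// mulr0.
Qed.

(** A pattern of size m is taken at level 3 (m + 1) L and so weighs theta^(m + 1) with theta = (veps
    / 2p)^3. With three non-trivial colours the total is 2 theta (1 + 3 theta)^p. As p theta <= 1/8,
    the power is at most exp(1) <= 3, and the extra factor theta, due to the + 1, supplies veps. *)
Lemma sum_pattern_exp (L veps : R) : (0 < p)%N -> 0 < veps < 1 ->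
  expR (- L) = veps / (2 * p%:R) ->
  \sum_g 2 * expR (- (3 * (pattern_size g).+1%:R * L)) <= veps.
Proof.
move=> p0 /andP[v0 v1] eL; set theta := expR (- L) ^+ 3.
have P1 : 1 <= p%:R :> R by rewrite ler1n.
have e0 : 0 <= expR (- L) by exact: expR_ge0.
have e1 : expR (- L) <= veps / 2.
  by rewrite eL ler_pdivrMr ?mulr_gt0 ?(lt_le_trans _ P1)//; nra.
have e2 : expR (- L) * p%:R = veps / 2.
  by rewrite eL; field; rewrite gt_eqF// (lt_le_trans _ P1).
have th0 : 0 <= theta by rewrite exprn_ge0.
have sq1 : expR (- L) ^+ 2 <= 1 / 4.
  by rewrite expr2; nra.
have thp : theta * p%:R <= 1 / 8.
  have -> : theta * p%:R = expR (- L) ^+ 2 * (expR (- L) * p%:R) by rewrite /theta; ring.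
  rewrite e2.
  by have := ler_wpM2r (_ : 0 <= veps / 2) sq1; rewrite divr_ge0 ?(ltW v0)// => /(_ isT); lra.
have th1 : theta <= veps / 8.
  have -> : theta = expR (- L) ^+ 2 * expR (- L) by rewrite /theta; ring.
  by have := ler_wpM2r e0 sq1; lra.
rewrite (eq_bigr (fun g => 2 * theta * theta ^+ pattern_size g)); last first.
  move=> g _; rewrite -[RHS]mulrA -[theta * _]exprS /theta -!expRM_natl.
  by congr (2 * expR _); ring.
rewrite -mulr_sumr sum_pattern_weights !card_option card_bool/=.
have : (1 + 3 * theta) ^+ p <= 3.
  apply: le_trans expR1_le3.
  apply: (@le_trans _ _ (expR (3 * theta) ^+ p)).
    by rewrite lerXn2r ?nnegrE ?addr_ge0 ?mulr_ge0 ?expR_ge0// expR_ge1Dx.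
  by rewrite -expRM_natr ler_expR; lra.
move=> h; have := ler_wpM2l (mulr_ge0 (ler0n R 2) th0) h; lra.
Qed.

End patterns.

Section assumptions.
Context {R : realType} {n p : nat} {d : measure_display} {Omega : measurableType d}.
Variables (P : probability Omega R).
Variables (xi : Omega -> 'cV[R]_n) (W : Omega -> 'M[R]_(n, p)).

Lemma subgaussian_mgf_le (f : Omega -> R) (sigma sw : R) :
  0 <= sigma -> sigma <= sw -> subgaussian P f (sigma ^+ 2) ->
  forall t, ('E_P[(fun w => expR (t * f w))%R] <= (expR (t ^+ 2 * sw ^+ 2 / 2))%:E)%E.
Proof.
move=> s0 ss [_ h] t; apply: le_trans (h t) _; rewrite lee_fin ler_expR.
rewrite ler_pM2r// ler_wpM2l ?sqr_ge0// ler_sqr ?nnegrE//; exact: le_trans ss.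
Qed.

Lemma subgaussian_vec_mgf_le (sigma sw : R) :
  0 <= sigma -> sigma <= sw ->
  (forall i, subgaussian_vec P (fun w => row i (W w)) (sigma ^+ 2)) ->
  forall i (u : 'cV[R]_p) (t : R),
  ('E_P[(fun w => expR (t * (W w *m u) i 0))%R] <=
   (expR (t ^+ 2 * (sw * norm2 u) ^+ 2 / 2))%:E)%E.
Proof.
move=> s0 ss h i u t; have [->|u0] := eqVneq u 0.
  rewrite norm2_0 mulr0 expr0n/= mulr0 mul0r.
  rewrite (_ : (fun w => _) = cst (expR 0)) ?expectation_cst//.
  by apply/funext => w; rewrite mulmx0 mxE mulr0.
have nu0 : norm2 u != 0 by apply: contra_neq u0; exact: norm2_eq0.
have n1 : norm2 ((norm2 u)^-1 *: u) = 1.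
  by rewrite norm2Z ger0_norm ?invr_ge0 ?norm2_ge0// mulVf.
have := subgaussian_mgf_le s0 ss (h i _ n1) (t * norm2 u).
rewrite (_ : (t * norm2 u) ^+ 2 * sw ^+ 2 = t ^+ 2 * (sw * norm2 u) ^+ 2); last by ring.
rewrite (_ : (fun w => expR (t * norm2 u * _)) = fun w => expR (t * (W w *m u) i 0))//.
apply/funext => w; congr expR; rewrite -scalemxAr [X in _ * X]mxE -row_mul [row _ _ _ _]mxE.
by field.
Qed.

Lemma uncorrelated_neq : (forall i (j k : 'I_p), (j < k)%N ->
    ('E_P[(fun w => W w i j * W w i k)%R] = 0)%E) ->
  forall i (j k : 'I_p), j != k -> ('E_P[(fun w => W w i j * W w i k)%R] = 0)%E.
Proof.
move=> h i j k jk; have [jk'|kj|/val_inj jk'] := ltngtP j k; first exact: h.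
  by rewrite -(h i _ _ kj); congr expectation; apply/funext => w; rewrite mulrC.
by rewrite jk' eqxx in jk.
Qed.

Lemma independent_mx_uncorrelated (sw sx : R) : 0 < sw -> 0 < sx ->
  random_mx W -> random_mx xi -> independent_mx P W xi ->
  (forall i j, ('E_P[(fun w => W w i j)%R] = 0)%E) ->
  (forall i j t, ('E_P[(fun w => expR (t * W w i j))%R] <= (expR (t ^+ 2 * sw ^+ 2 / 2))%:E)%E) ->
  (forall i t, ('E_P[(fun w => expR (t * xi w i 0))%R] <= (expR (t ^+ 2 * sx ^+ 2 / 2))%:E)%E) ->
  forall i j, ('E_P[(fun w => W w i j * xi w i 0)%R] = 0)%E.
Proof.
move=> sw0 sx0 mW mxi ind EW hW hxi i j.
pose gen (m k : nat) (N : Omega -> 'M[R]_(m, k)) : set_system Omega :=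
  [set A | exists a b, exists2 B : set R, measurable B & A = (fun w => N w a b) @^-1` B].
have genm (m k : nat) (N : Omega -> 'M[R]_(m, k)) : random_mx N -> gen m k N `<=` measurable.
  by move=> mN _ [a [c [B mB ->]]]; rewrite -[_ @^-1` _]setTI; exact: mN.
have genf (m k : nat) (N : Omega -> 'M[R]_(m, k)) a c :
    measurable_fun setT ((fun w => N w a c) : g_sigma_algebraType (gen m k N) -> R).
  by move=> _ B mB; rewrite setTI; apply: sub_gen_smallest; exists a, c, B.
apply: (independent_uncorrelated (genm _ _ _ mW) (genm _ _ _ mxi) ind (genf _ _ W i j) (genf _ _ xi i 0)) => //.
- exact: mgf_Lfun1 (mW i j) (hW i j).
- exact: mgf_Lfun1 (mxi i 0) (hxi i).
- exact: (subgaussian_mul_Lfun1 _ _ sw0 sx0 (hW i j) (hxi i)).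
Qed.

End assumptions.

(** * The event on which all deviations are controlled *)

Section good_event.
Context {R : realType} {n p : nat} {d : measure_display} {Omega : measurableType d}.
Variables (P : probability Omega R) (X : 'M[R]_(n, p)) (beta0 : 'cV[R]_p).
Variables (xi : Omega -> 'cV[R]_n) (W : Omega -> 'M[R]_(n, p)).
Variables (sw sx veps : R) (s : nat).
Hypotheses (n0 : (0 < n)%N) (p0 : (0 < p)%N) (s0 : (0 < s)%N).
Hypotheses (sw0 : 0 < sw) (sx0 : 0 < sx) (veps01 : 0 < veps < 1).
Hypothesis sparse : (norm0 beta0 <= s)%N.
Hypothesis model : eiv_model P X beta0 xi W.
Hypothesis mgf_W : forall i (u : 'cV[R]_p) (t : R),
  ('E_P[(fun w => expR (t * (W w *m u) i 0))%R] <=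
   (expR (t ^+ 2 * (sw * norm2 u) ^+ 2 / 2))%:E)%E.
Hypothesis mgf_xi : forall i (t : R),
  ('E_P[(fun w => expR (t * xi w i 0))%R] <= (expR (t ^+ 2 * sx ^+ 2 / 2))%:E)%E.
Hypothesis uncor_W : forall i (j k : 'I_p), j != k ->
  ('E_P[(fun w => W w i j * W w i k)%R] = 0)%E.
Hypothesis uncor_Wxi : forall i j,
  ('E_P[(fun w => W w i j * xi w i 0)%R] = 0)%E.

Let q := Num.sqrt (m2 X).
Let L := ln (2 * p%:R / veps).
Let L2 := ln (2 * p%:R ^+ 2 / veps).
Let l := Num.sqrt (L / n%:R).
Let lam := Num.sqrt (2 * L2 / n%:R).
Let Gam := Gamma P W.
Let K (T : {set 'I_p}) := (#|T| + s)%N.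

Let veps0 : 0 < veps. Proof. by case/andP: veps01. Qed.
Let P1 : 1 <= p%:R :> R. Proof. by rewrite ler1n. Qed.
Let N0 : 0 < n%:R :> R. Proof. by rewrite ltr0n. Qed.

Let arg1 : 1 < 2 * p%:R / veps.
Proof. by case/andP: veps01 => _ v1; rewrite ltr_pdivlMr//; move: P1; lra. Qed.

Let arg2 : 2 * p%:R / veps <= 2 * p%:R ^+ 2 / veps.
Proof. by rewrite ler_pM2r ?invr_gt0// ler_pM2l// ler_eXnr. Qed.

Let L0 : 0 < L. Proof. exact: ln_gt0. Qed.

Let LL2 : L <= L2.
Proof. by rewrite ler_ln ?posrE ?(lt_trans ltr01)// (lt_le_trans arg1). Qed.

Let L20 : 0 < L2. Proof. exact: lt_le_trans LL2. Qed.

Let eL : expR (- L) = veps / (2 * p%:R).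
Proof. by rewrite expRN lnK ?posrE ?(lt_trans ltr01)// invf_div. Qed.

Let eL2 : expR (- L2) = veps / (2 * p%:R ^+ 2).
Proof.
by rewrite expRN lnK ?posrE ?(lt_trans ltr01 (lt_le_trans arg1 arg2))// invf_div.
Qed.

Let l_ge0 : 0 <= l. Proof. exact: sqrtr_ge0. Qed.
Let lam_ge0 : 0 <= lam. Proof. exact: sqrtr_ge0. Qed.

Let l2 : n%:R * l ^+ 2 = L.
Proof. by rewrite sqr_sqrtr ?divr_ge0 ?(ltW L0)// mulrC divfK ?gt_eqF. Qed.

Let lam2 : n%:R * lam ^+ 2 = 2 * L2.
Proof.
by rewrite sqr_sqrtr ?divr_ge0 ?mulr_ge0 ?(ltW L20)// mulrC divfK ?gt_eqF.
Qed.

Lemma noise_level_le : l <= lam.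
Proof.
rewrite ler_wsqrtr// ler_pM2r ?invr_gt0//; apply: le_trans LL2 _.
by rewrite ler_peMl ?(ltW L20)// ler1n.
Qed.

Lemma noise_level_gt0 : 0 < lam.
Proof. by rewrite sqrtr_gt0 divr_gt0// mulr_gt0. Qed.

Let sqrt_le (x c : R) : 0 <= c -> x <= c ^+ 2 -> Num.sqrt x <= c.
Proof. by move=> c0 xc; rewrite -(ger0_norm c0) -sqrtr_sqr ler_wsqrtr. Qed.

Let col_norm (j : 'I_p) : norm2 (col j X) <= Num.sqrt n%:R * q.
Proof.
have m20 : 0 <= m2 X.
  by apply: le_trans (norm2_col_le X j); rewrite mulr_ge0 ?invr_ge0 ?sqr_ge0.
rewrite -ler_sqr ?nnegrE ?norm2_ge0 ?mulr_ge0 ?sqrtr_ge0//.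
rewrite exprMn (sqr_sqrtr (ler0n _ _)) (sqr_sqrtr m20).
by rewrite -ler_pdivrMl ?norm2_col_le.
Qed.

Let col_sqrt (j : 'I_p) (c x : R) : 0 <= x -> 0 <= c -> c <= n%:R * x ^+ 2 ->
  norm2 (col j X) * Num.sqrt c <= n%:R * (q * x).
Proof.
move=> x0 c0 cx.
have -> : n%:R * (q * x) = (Num.sqrt n%:R * q) * (Num.sqrt n%:R * x).
  by rewrite -{1}(sqr_sqrtr (ler0n R n)); ring.
apply: ler_pM; rewrite ?norm2_ge0 ?sqrtr_ge0//; apply: sqrt_le.
  by rewrite mulr_ge0 ?sqrtr_ge0.
by rewrite exprMn (sqr_sqrtr (ler0n _ _)).
Qed.

Let quad_dev (c : R) (x : R) : 0 <= x -> 0 <= c -> c <= n%:R * x ^+ 2 ->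
  60 * Num.sqrt (n%:R * c) + 12 * c <= n%:R * (60 * x + 12 * x ^+ 2).
Proof.
move=> x0 c0 cx; have h : Num.sqrt (n%:R * c) <= n%:R * x.
  apply: sqrt_le; first by rewrite mulr_ge0.
  by rewrite exprMn expr2 -mulrA ler_wpM2l.
lra.
Qed.

Let entry (m a b : nat) (A : 'M[R]_(m, a)) (B : 'M[R]_(m, b)) j i :
  (A^T *m B) j i = dot (col j A) (col i B).
Proof. by rewrite mxE; apply: eq_bigr => k _; rewrite !mxE. Qed.

Let entryv (m a : nat) (A : 'M[R]_(m, a)) (u : 'cV[R]_m) j :
  (A^T *m u) j 0 = dot (col j A) u.
Proof. by rewrite mxE; apply: eq_bigr => k _; rewrite !mxE. Qed.

Let dot_delta (j : 'I_p) (u : 'cV[R]_p) : dot (delta_mx j 0) u = u j 0.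
Proof.
rewrite /dot (bigD1 j)//= big1 ?addr0; first by rewrite mxE !eqxx mul1r.
by move=> k kj; rewrite mxE (negbTE kj) mul0r.
Qed.

(** Entrywise Gram errors range over p^2 pairs, at level [L2]; the four families for the noise
    vector range over p coordinates, at level [L]. Each family has probability at most veps, and
    with the three pattern families this is the origin of 9 veps. *)
Let bad_XW := \bigcup_(ji in [set: 'I_p * 'I_p])
  [set w | sw * norm2 (delta_mx ji.2 0 : 'cV[R]_p) * norm2 (col ji.1 X) * Num.sqrt (2 * L2)
    < `|dot (col ji.1 X) (W w *m delta_mx ji.2 0)|].
Let bad_WW := \bigcup_(ji in [set: 'I_p * 'I_p])
  [set w | sw ^+ 2 * norm2 (delta_mx ji.1 0 : 'cV[R]_p) * norm2 (delta_mx ji.2 0 : 'cV[R]_p) *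
      (60 * Num.sqrt (n%:R * L2) + 12 * L2)
    < `|dot (W w *m delta_mx ji.1 0) (W w *m delta_mx ji.2 0)
        - n%:R * dot (delta_mx ji.1 0) (Gam *m delta_mx ji.2 0)|].
Let bad_Xxi := \bigcup_(j in [set: 'I_p])
  [set w | sx * norm2 (col j X) * Num.sqrt (2 * L) < `|dot (col j X) (xi w)|].
Let bad_Wxi := \bigcup_(j in [set: 'I_p])
  [set w | sw * sx * (60 * Num.sqrt (n%:R * L) + 12 * L)
    < `|dot (W w *m delta_mx j 0) (xi w)|].
Let bad_XWb := \bigcup_(j in [set: 'I_p])
  [set w | sw * norm2 beta0 * norm2 (col j X) * Num.sqrt (2 * L)
    < `|dot (col j X) (W w *m beta0)|].
Let bad_WWb := \bigcup_(j in [set: 'I_p])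
  [set w | sw ^+ 2 * norm2 (delta_mx j 0 : 'cV[R]_p) * norm2 beta0 *
      (60 * Num.sqrt (n%:R * L) + 12 * L)
    < `|dot (W w *m delta_mx j 0) (W w *m beta0)
        - n%:R * dot (delta_mx j 0) (Gam *m beta0)|].
Let pattern := {ffun 'I_p -> option (option bool)}.
(** The size of the selected support is random, so no level can be fixed beforehand: each pattern
    gets one that follows its own size. *)
Let Lg (g : pattern) := 3 * (pattern_size g).+1%:R * L.
Let bad_WX_sign := \bigcup_(g in [set: pattern])
  [set w | sw * norm2 (pattern_sign g : 'cV[R]_p) * norm2 (X *m pattern_missed g beta0) *
      Num.sqrt (2 * Lg g)
    < `|dot (X *m pattern_missed g beta0) (W w *m pattern_sign g)|].
Let bad_XW_sign := \bigcup_(g in [set: pattern])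
  [set w | sw * norm2 (pattern_missed g beta0) * norm2 (X *m pattern_sign g) *
      Num.sqrt (2 * Lg g)
    < `|dot (X *m pattern_sign g) (W w *m pattern_missed g beta0)|].
Let bad_WW_sign := \bigcup_(g in [set: pattern])
  [set w | sw ^+ 2 * norm2 (pattern_sign g : 'cV[R]_p) * norm2 (pattern_missed g beta0) *
      (60 * Num.sqrt (n%:R * Lg g) + 12 * Lg g)
    < `|dot (W w *m pattern_sign g) (W w *m pattern_missed g beta0)
        - n%:R * dot (pattern_sign g) (Gam *m pattern_missed g beta0)|].

Let Lg0 g : 0 < Lg g. Proof. by rewrite !mulr_gt0. Qed.

Let measurable_WW (u v : 'cV[R]_p) (c : R) :
  measurable_fun setT (fun w => dot (W w *m u) (W w *m v) - c).
Proof. by apply: measurable_funB => //; exact: measurable_dot_WW model u v. Qed.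

Let pair_level : #|{: 'I_p * 'I_p}|%:R * (2 * expR (- L2)) <= veps.
Proof.
rewrite card_prod card_ord eL2 natrM le_eqVlt; apply/orP; left; apply/eqP.
by field; rewrite gt_eqF// (lt_le_trans _ P1).
Qed.

Let single_level : #|{: 'I_p}|%:R * (2 * expR (- L)) <= veps.
Proof.
rewrite card_ord eL le_eqVlt; apply/orP; left; apply/eqP.
by field; rewrite gt_eqF// (lt_le_trans _ P1).
Qed.

Let bad := bad_XW `|` bad_WW `|` bad_Xxi `|` bad_Wxi `|` bad_XWb `|` bad_WWb
  `|` bad_WX_sign `|` bad_XW_sign `|` bad_WW_sign.

Let small_bad : small P bad (9 * veps).
Proof.
have -> : 9 * veps = veps + veps + veps + veps + veps + veps + veps + veps + veps by ring.
have mW (a : 'cV[R]_n) (u : 'cV[R]_p) := measurable_dot_W model a u.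
have pat := sum_pattern_exp p0 veps01 eL.
repeat apply: smallU.
- apply: small_const_bigcup pair_level => ji; split.
    exact/measurable_abs_gt/mW.
  exact: (event_dot_W sw0 model mgf_W).
- apply: small_const_bigcup pair_level => ji; split.
    exact/measurable_abs_gt/measurable_WW.
  exact: (event_dot_WW n0 sw0 model mgf_W uncor_W).
- apply: small_const_bigcup single_level => j; split.
    exact/measurable_abs_gt/(measurable_dot_xi model).
  exact: (event_dot_xi sx0 model mgf_xi).
- apply: small_const_bigcup single_level => j; split.
    exact/measurable_abs_gt/(measurable_dot_Wxi model).
  exact: (event_dot_Wxi n0 sw0 sx0 model mgf_W mgf_xi uncor_Wxi).
- apply: small_const_bigcup single_level => j; split.
    exact/measurable_abs_gt/mW.
  exact: (event_dot_W sw0 model mgf_W).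
- apply: small_const_bigcup single_level => j; split.
    exact/measurable_abs_gt/measurable_WW.
  exact: (event_dot_WW n0 sw0 model mgf_W uncor_W).
- apply: small_bigcup pat => g; split.
    exact/measurable_abs_gt/mW.
  exact: (event_dot_W sw0 model mgf_W).
- apply: small_bigcup pat => g; split.
    exact/measurable_abs_gt/mW.
  exact: (event_dot_W sw0 model mgf_W).
- apply: small_bigcup pat => g; split.
    exact/measurable_abs_gt/measurable_WW.
  exact: (event_dot_WW n0 sw0 model mgf_W uncor_W).
Qed.

(** One summand for each of X^T xi, W^T xi, X^T W beta0 and the centred W^T W beta0, all divided by
    n; 3/2 is an upper bound for sqrt(2). *)
Definition noise_bound : R :=
  sx * (q * (3 / 2 * l)) + sw * sx * (60 * l + 12 * l ^+ 2)
  + sw * norm2 beta0 * (q * (3 / 2 * l)) + sw ^+ 2 * norm2 beta0 * (60 * l + 12 * l ^+ 2).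

(** The last three bounds hold for all supports and signs at once, so that they can be instantiated
    at the support selected at [w]. *)
Record good (w : Omega) : Prop := Good {
  good_XW : forall j i, `|(X^T *m W w) j i| <= n%:R * (sw * q * lam);
  good_WW : forall j i, `|((W w)^T *m W w) j i - n%:R * Gam j i| <=
    n%:R * (sw ^+ 2 * (45 * lam + 6 * lam ^+ 2));
  good_noise : forall j,
    `|(n%:R^-1 *: ((X + W w)^T *m (xi w - W w *m beta0)) + Gam *m beta0) j 0|
      <= noise_bound;
  good_WX_sign : forall T sg, let u := sign_vector T sg in
    let e := restr (~: T)%SET beta0 in
    `|dot (W w *m u) (X *m e)| <=
      sw * norm2 u * norm2 (X *m e) * (Num.sqrt (12 * ((K T)%:R * n%:R)) * l);
  good_XW_sign : forall T sg, let u := sign_vector T sg in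
    let e := restr (~: T)%SET beta0 in
    `|dot (X *m u) (W w *m e)| <=
      sw * norm2 e * norm2 (X *m u) * (Num.sqrt (12 * ((K T)%:R * n%:R)) * l);
  good_WW_sign : forall T sg, let u := sign_vector T sg in
    let e := restr (~: T)%SET beta0 in
    `|dot (W w *m u) (W w *m e)| <= sw ^+ 2 * norm2 u * norm2 e *
      (n%:R * (60 * (Num.sqrt (6 * (K T)%:R) * l) + 72 * ((K T)%:R * l ^+ 2)))
}.

Let not_bigcup (I : finType) (f : I -> Omega -> R) (c : I -> R) w :
  ~ (\bigcup_(i in [set: I]) [set w | c i < `|f i w|]) w -> forall i, `|f i w| <= c i.
Proof. by move=> h i; rewrite leNgt; apply/negP => lt; apply: h; exists i. Qed.

(** The size m is at most K, and m + 1 <= 2 K because s >= 1. *)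
Let L_pattern T sg : Lg (pattern_of T beta0 sg) <= 6 * (K T)%:R * L.
Proof.
rewrite /Lg ler_pM2r//.
have h : ((pattern_size (pattern_of T beta0 sg)).+1 <= 2 * K T)%N.
  have h1 : (pattern_size (pattern_of T beta0 sg) <= K T)%N.
    by apply: leq_trans (pattern_of_size T beta0 sg) _; rewrite leq_add2l.
  by rewrite mul2n -addnn -addn1 leq_add// (leq_trans s0)// leq_addl.
by have : (pattern_size (pattern_of T beta0 sg)).+1%:R <= (2 * K T)%N%:R :> R;
  [rewrite ler_nat|rewrite natrM => ?; lra].
Qed.

Let sqrt_pattern T sg : Num.sqrt (2 * Lg (pattern_of T beta0 sg)) <=
  Num.sqrt (12 * ((K T)%:R * n%:R)) * l.
Proof.
apply: sqrt_le; first by rewrite mulr_ge0 ?sqrtr_ge0.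
rewrite exprMn sqr_sqrtr ?mulr_ge0// -!mulrA l2.
by have := L_pattern T sg; lra.
Qed.

Lemma good_of_not_bad w : ~ bad w -> good w.
Proof.
move=> nb.
have h1 : ~ bad_XW w by move=> h; apply: nb; do 8 left.
have h2 : ~ bad_WW w by move=> h; apply: nb; do 7 left; right.
have h3 : ~ bad_Xxi w by move=> h; apply: nb; do 6 left; right.
have h4 : ~ bad_Wxi w by move=> h; apply: nb; do 5 left; right.
have h5 : ~ bad_XWb w by move=> h; apply: nb; do 4 left; right.
have h6 : ~ bad_WWb w by move=> h; apply: nb; do 3 left; right.
have h7 : ~ bad_WX_sign w by move=> h; apply: nb; do 2 left; right.
have h8 : ~ bad_XW_sign w by move=> h; apply: nb; left; right.
have h9 : ~ bad_WW_sign w by move=> h; apply: nb; right.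
clear nb.
split.
- move=> j i; have := not_bigcup h1 (j, i).
  rewrite /= mulmx_delta -entry norm2_delta mulr1 => /le_trans; apply.
  have -> : n%:R * (sw * q * lam) = sw * (n%:R * (q * lam)) by ring.
  rewrite -mulrA ler_pM2l//; apply: col_sqrt => //; last by rewrite lam2.
  by rewrite mulr_ge0// (ltW L20).
- move=> j i; have := not_bigcup h2 (j, i).
  rewrite /= !mulmx_delta -entry dot_delta !norm2_delta !mulr1 [(col i Gam) j 0]mxE.
  move=> /le_trans; apply.
  rewrite [leRHS]mulrCA ler_wpM2l ?sqr_ge0//.
  (* Here n lam^2 = 2 L2 and 1/2 <= 9/16; then 60 * 3/4 = 45 and 12 L2 = 6 n lam^2. *)
  have h : Num.sqrt (n%:R * L2) <= n%:R * (3 / 4 * lam).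
    apply: sqrt_le; first by rewrite mulr_ge0// mulr_ge0.
    have -> : (n%:R * (3 / 4 * lam)) ^+ 2 = n%:R * (9 / 16 * (n%:R * lam ^+ 2)) by field.
    by rewrite lam2 ler_pM2l//; move: (ltW L20); lra.
  have := lam2; lra.
- move=> j.
  have -> : (n%:R^-1 *: ((X + W w)^T *m (xi w - W w *m beta0)) + Gam *m beta0) j 0 =
      n%:R^-1 * (dot (col j X) (xi w) + dot (W w *m delta_mx j 0) (xi w)
        - dot (col j X) (W w *m beta0)
        - (dot (W w *m delta_mx j 0) (W w *m beta0)
           - n%:R * dot (delta_mx j 0) (Gam *m beta0))).
    rewrite add_colE scale_colE entryv mulmx_delta dot_delta.
    have -> : col j (X + W w) = col j X + col j (W w) by rewrite linearD.
    by rewrite dotDl !dotBr; field; rewrite gt_eqF.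
  have b3 := not_bigcup h3 j; have b4 := not_bigcup h4 j.
  have b5 := not_bigcup h5 j; have b6 := not_bigcup h6 j.
  have cL : 2 * L <= n%:R * (3 / 2 * l) ^+ 2.
    by rewrite exprMn mulrCA l2; move: (ltW L0); lra.
  have x0 : 0 <= 3 / 2 * l by rewrite mulr_ge0.
  have c0 : 0 <= 2 * L by rewrite mulr_ge0// ltW.
  have qd := quad_dev l_ge0 (ltW L0) (_ : L <= n%:R * l ^+ 2).
  rewrite l2 in qd; have {}qd := qd (lexx _).
  have cs := col_sqrt j x0 c0 cL.
  have a3 : `|dot (col j X) (xi w)| <= n%:R * (sx * (q * (3 / 2 * l))).
    by apply: le_trans b3 _; rewrite -mulrA [leRHS]mulrCA ler_pM2l.
  have a4 : `|dot (W w *m delta_mx j 0) (xi w)| <= n%:R * (sw * sx * (60 * l + 12 * l ^+ 2)).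
    by apply: le_trans b4 _; rewrite [leRHS]mulrCA ler_wpM2l ?mulr_ge0 ?(ltW sw0) ?(ltW sx0).
  have a5 : `|dot (col j X) (W w *m beta0)| <= n%:R * (sw * norm2 beta0 * (q * (3 / 2 * l))).
    apply: le_trans b5 _; rewrite -mulrA [leRHS]mulrCA ler_wpM2l//.
    by rewrite mulr_ge0 ?norm2_ge0 ?(ltW sw0).
  have a6 : `|dot (W w *m delta_mx j 0) (W w *m beta0)
      - n%:R * dot (delta_mx j 0) (Gam *m beta0)| <=
      n%:R * (sw ^+ 2 * norm2 beta0 * (60 * l + 12 * l ^+ 2)).
    apply: le_trans b6 _; rewrite norm2_delta mulr1 [leRHS]mulrCA ler_wpM2l//.
    by rewrite mulr_ge0 ?norm2_ge0 ?sqr_ge0.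
  rewrite normrM (gtr0_norm (_ : 0 < n%:R^-1)) ?invr_gt0// ler_pdivrMl//.
  apply: le_trans (ler_normB _ _) _; apply: le_trans (lerD (ler_normB _ _) (lexx _)) _.
  apply: le_trans (lerD (lerD (ler_normD _ _) (lexx _)) (lexx _)) _.
  apply: le_trans (lerD (lerD (lerD a3 a4) a5) a6) _.
  by rewrite /noise_bound !mulrDr.
- move=> T sg /=; have := not_bigcup h7 (pattern_of T beta0 sg).
  rewrite pattern_of_sign pattern_of_missed dotC => /le_trans; apply.
  rewrite ler_wpM2l ?sqrt_pattern// !mulr_ge0 ?norm2_ge0// ltW//.
- move=> T sg /=; have := not_bigcup h8 (pattern_of T beta0 sg).
  rewrite pattern_of_sign pattern_of_missed => /le_trans; apply.
  rewrite ler_wpM2l ?sqrt_pattern// !mulr_ge0 ?norm2_ge0// ltW//.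
- move=> T sg /=; have := not_bigcup h9 (pattern_of T beta0 sg).
  have dG : is_diag_mx Gam by case: model.
  rewrite dot_pattern_diag// mulr0 subr0 pattern_of_sign pattern_of_missed.
  move=> /le_trans; apply; rewrite ler_wpM2l//.
    by apply: mulr_ge0; rewrite ?norm2_ge0// mulr_ge0 ?sqr_ge0 ?norm2_ge0.
  set x := Num.sqrt (6 * (K T)%:R) * l.
  have x0 : 0 <= x by rewrite mulr_ge0 ?sqrtr_ge0.
  have x2 : x ^+ 2 = 6 * ((K T)%:R * l ^+ 2).
    by rewrite exprMn sqr_sqrtr ?mulr_ge0// mulrA.
  have -> : 72 * ((K T)%:R * l ^+ 2) = 12 * x ^+ 2 by rewrite x2; ring.
  apply: quad_dev => //; first exact: ltW.
  apply: le_trans (L_pattern T sg) _; rewrite x2 -l2 le_eqVlt; apply/orP; left; apply/eqP.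
  by ring.
Qed.

Lemma good_event : exists2 bad', small P bad' (9 * veps) &
  forall w, ~ bad' w -> good w.
Proof. by exists bad; [exact: small_bad|exact: good_of_not_bad]. Qed.

End good_event.

(** * Conclusion *)

Section final_scalars.
Context {R : realType}.

(** The quadratic terms are tamed by sw l <= q/4, which turns 12 sw l^2 into at most 3 q l; the
    products of sw and sx that occur are at most A^2 A2. *)
Lemma noise_scalar_bound (sw sx q l nb A A2 : R) :
  0 <= sw -> 0 <= sx -> 0 <= q -> 0 <= l -> 0 <= nb -> sw <= A -> sx <= A2 ->
  1 <= A -> 1 <= A2 -> sw * l <= q / 4 ->
  sx * (q * (3 / 2 * l)) + sw * sx * (60 * l + 12 * l ^+ 2)
    + sw * nb * (q * (3 / 2 * l)) + sw ^+ 2 * nb * (60 * l + 12 * l ^+ 2) <=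
  60 * (A ^+ 2 * A2) * (l * (1 + q) * (1 + nb)).
Proof.
move=> sw0 sx0 q0 l0 nb0 swA sxA A1 A21 swl; set G := A ^+ 2 * A2.
have A0 : 0 <= A by exact: le_trans A1.
have A20 : 0 <= A2 by exact: le_trans A21.
have AA : 1 <= A ^+ 2 by rewrite exprn_ege1.
have AA2 : A <= A ^+ 2 by rewrite ler_eXnr.
have G1 : sx <= G by apply: le_trans sxA _; rewrite ler_peMl.
have G2 : sx * sw <= G.
  by rewrite mulrC ler_pM// (le_trans swA).
have G3 : sw ^+ 2 <= G.
  apply: (@le_trans _ _ (A ^+ 2)); last by rewrite ler_peMr// exprn_ge0.
  by rewrite ler_sqr ?nnegrE.
have G4 : sw <= G.
  by apply: le_trans swA _; apply: le_trans AA2 _; rewrite ler_peMr// exprn_ge0.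
have G0 : 0 <= G by apply: le_trans G1.
have ql0 : 0 <= q * l by rewrite mulr_ge0.
have e1 : sw * l ^+ 2 <= q * l / 4 by rewrite expr2 mulrA; have := ler_wpM2r l0 swl; lra.
have t1 : sx * (q * l) <= G * (q * l) by rewrite ler_wpM2r.
have t2 : sx * sw * l <= G * l by rewrite ler_wpM2r.
have t3 : sw * (q * l) <= G * (q * l) by rewrite ler_wpM2r.
have t4 : sw ^+ 2 * l <= G * l by rewrite ler_wpM2r.
have t5 := ler_wpM2l sx0 e1.
have t6 := ler_wpM2l sw0 e1.
have Gq : 0 <= G * (q * l) by rewrite mulr_ge0.
have u1 : sx * (q * (3 / 2 * l)) + sw * sx * (60 * l + 12 * l ^+ 2) <=
  60 * G * (l * (1 + q)) by lra.
have u2 : sw * (q * (3 / 2 * l)) + sw ^+ 2 * (60 * l + 12 * l ^+ 2) <=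
  60 * G * (l * (1 + q)) by lra.
have := ler_wpM2r nb0 u2; lra.
Qed.

(** The excess of [sw] over sigma is scaled by 1 / (q + 1) so that its product with q stays below
    1/2: the constant must not depend on m_2. Twice that product, together with 45 sw^2 <= 45 A^2,
    fits into 2 (23 A^2 + 1). *)
Lemma threshold_scalar_bound (b q lam sigma A : R) : 0 <= q -> 0 <= sigma ->
  0 <= lam -> A = sigma + 1 ->
  let sw := sigma + (2 * (q + 1))^-1 in
  [/\ 0 < sw, sigma <= sw, sw <= A &
   b + 2 * (sw * q * lam) + 45 * sw ^+ 2 * lam <=
   b + 2 * (sigma * q + (23 * A ^+ 2 + 1)) * lam].
Proof.
move=> q0 sigma0 lam0 AE sw.
have i0 : 0 < (2 * (q + 1))^-1 by rewrite invr_gt0 mulr_gt0// ltr_pwDr.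
have iq : (2 * (q + 1))^-1 * (2 * (q + 1)) = 1.
  by rewrite mulVf// gt_eqF// -invr_gt0.
have iq0 : 0 <= (2 * (q + 1))^-1 * q by rewrite mulr_ge0// ltW.
rewrite /sw; set t := (2 * (q + 1))^-1 in i0 iq iq0 *.
have t1 : t * q <= 1 / 2 by lra.
have t2 : t <= 1 / 2 by lra.
split; [lra|lra|lra|].
have s2 : (sigma + t) ^+ 2 <= A ^+ 2 by rewrite ler_sqr ?nnegrE; lra.
have A0 := sqr_ge0 A.
have : 2 * ((sigma + t) * q) + 45 * (sigma + t) ^+ 2 <= 2 * (sigma * q + (23 * A ^+ 2 + 1)).
  by lra.
move=> h; have := ler_wpM2r lam0 h; lra.
Qed.

End final_scalars.

Section measurability.
Context {R : realType} {d : measure_display} {Omega : measurableType d}.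

Lemma measurable_norm_gt (p : nat) (G : Omega -> 'M[R]_p) (G0 : 'M[R]_p) (b : R) :
  0 <= b -> random_mx G -> measurable [set w | b < `|G w - G0|].
Proof.
move=> b0 mG.
rewrite (_ : [set w | _] = \bigcup_(ij in [set: 'I_p * 'I_p])
    [set w | b < `|(fun w => G w ij.1 ij.2 - G0 ij.1 ij.2) w|]).
  apply: fin_bigcup_measurable; first exact: finite_finset.
  by move=> ij _; apply: measurable_abs_gt; apply: measurable_funB => //; exact: mG.
apply/seteqP; split => w /=.
  (* A norm exceeding b >= 0 is non-zero, hence attained at some entry. *)
  move=> h; have : mx_norm (G w - G0) != 0 by rewrite gt_eqF// (le_lt_trans b0).
  by move=> /mx_norm_neq0[ij e]; exists ij => //=; move: h; rewrite [X in _ < X -> _]e !mxE.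
by move=> [ij _ /=] /lt_le_trans; apply; have := norm_mx_entry_le (G w - G0) ij.1 ij.2; rewrite !mxE.
Qed.

(** The right-hand side is random only through the finitely many values of [T], so the event is a
    finite union over them. *)
Lemma measurable_norm2_le (p : nat) (f : Omega -> 'cV[R]_p) (b0 : 'cV[R]_p)
    (T : Omega -> {set 'I_p}) (c : {set 'I_p} -> R) :
  random_mx f -> (forall J, measurable [set w | T w = J]) ->
  measurable [set w | norm2 (f w - b0) <= c (T w)].
Proof.
move=> mf mT.
have mn : measurable_fun setT (fun w => norm2 (f w - b0)).
  have ms : measurable_fun [set: R] (Num.sqrt : R -> R).
    by apply: continuous_measurable_fun; exact: sqrt_continuous.
  apply: (measurableT_comp ms).
  apply: measurable_sum => j; apply: measurable_funX.
  by under eq_fun do rewrite !mxE; apply: measurable_funB => //; exact: mf.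
rewrite (_ : [set w | _] = \bigcup_(J in [set: {set 'I_p}])
    ([set w | T w = J] `&` [set w | norm2 (f w - b0) <= c J])).
  apply: fin_bigcup_measurable; first exact: finite_finset.
  move=> J _; apply: measurableI => //.
  have := mn measurableT _ (measurable_itv `]-oo, c J]); rewrite setTI.
  by congr measurable; apply/seteqP; split => w /=; rewrite in_itv.
apply/seteqP; split => w /=; first by move=> h; exists (T w).
by move=> [J _ [<-]].
Qed.

End measurability.

Theorem theorem4 (R : realType) (sigma_w sigma_xi : R)
    (sigma_w_ge0 : 0 <= sigma_w) (sigma_xi_ge0 : 0 <= sigma_xi) :
  exists C_xiw c' : R, 0 < C_xiw /\ 0 < c' /\
  forall (alpha eps veps C : R) (l : nat -> R)
    (n p s : nat) (d : measure_display) (Omega : measurableType d)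
    (P : probability Omega R)
    (X : 'M[R]_(n, p)) (beta0 : 'cV[R]_p)
    (xi : Omega -> 'cV[R]_n) (W : Omega -> 'M[R]_(n, p))
    (hGamma : Omega -> 'M[R]_p) (b : R)
    (hT : Omega -> {set 'I_p}) (tbeta tt : Omega -> 'cV[R]_p),
  0 < alpha < 1 -> 0 < eps < 1 -> 0 < veps < 1 -> 0 < C ->
  (forall m, 2 <= l m) -> l @ \oo --> +oo ->
  (1 <= n)%N -> (1 <= p)%N -> (1 <= s)%N ->
  eiv_model P X beta0 xi W ->
  random_mx hGamma ->
  (forall J : {set 'I_p}, measurable [set omega | hT omega = J]) ->
  random_mx tbeta -> random_mx tt ->
  (forall omega, refit_solution (obs_y X beta0 xi omega) (obs_z X W omega)
                   (hGamma omega) (hT omega) (tbeta omega) (tt omega)) ->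
  condition_A P beta0 xi W s C sigma_w sigma_xi ->
  condition_B P X beta0 xi W hGamma b eps alpha (l n) ->
  {ae P, forall omega,
     b + 2 * (sigma_w * Num.sqrt (m2 X) + C_xiw)
           * Num.sqrt (2 * ln (2 * p%:R ^+ 2 / veps) / n%:R)
       <= phi_min X (#|hT omega| + s)%N / (2 * (#|hT omega| + s)%N%:R)} ->
  ((1 - 2 * eps - 9 * veps)%:E <=
   P [set omega |
        (norm2 (tbeta omega - beta0) <=
          Num.sqrt (#|hT omega| + s)%N%:R
            / (c' * phi_min X (#|hT omega| + s)%N)
            * ((1 + norm2 beta0) * (1 + Num.sqrt (m2 X))
                 * Num.sqrt (ln (2 * p%:R / veps) / n%:R)
               + b * `|beta0|)
          + norm2 (restr (~: hT omega) beta0)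
            * (Num.sqrt (phi_max X s)
               / Num.sqrt (phi_min X (#|hT omega| + s)%N)))%R])%E.
Proof.
pose A := sigma_w + 1; pose A2 := sigma_xi + 1.
have A1 : 1 <= A by rewrite lerDr.
have A21 : 1 <= A2 by rewrite lerDr.
have A20 : 0 < A2 by exact: lt_le_trans A21.
have AA0 : 0 < A ^+ 2 by rewrite exprn_gt0// (lt_le_trans _ A1).
(* 760 is 4 * 60 from [noise_scalar_bound] plus 520 from [refit_error_bound]. *)
have h760 : 0 < 760 :> R by rewrite ltr0n.
have c0 : 0 < 760 * (A ^+ 2 * A2) := mulr_gt0 h760 (mulr_gt0 AA0 A20).
exists (23 * A ^+ 2 + 1), (760 * (A ^+ 2 * A2))^-1.
split; first by rewrite addr_gt0// mulr_gt0.
split; first by rewrite invr_gt0 c0.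
move=> alpha eps veps C lseq n p s d Omega P X beta0 xi W hGamma b hT tbeta tt.
move=> _ /andP[eps0 eps1] veps01 _ _ _ n0 p0 s0 model mhG mhT mtb _ sol cA cB cond.
set q := Num.sqrt (m2 X) in cond *.
set lam := Num.sqrt (2 * ln (2 * p%:R ^+ 2 / veps) / n%:R) in cond.
set l := Num.sqrt (ln (2 * p%:R / veps) / n%:R).
have q0 : 0 <= q by exact: sqrtr_ge0.
have l0 : 0 <= l by exact: sqrtr_ge0.
have lam0 : 0 < lam by exact: noise_level_gt0.
have llam : l <= lam by exact: noise_level_le.
have := @threshold_scalar_bound R b q lam sigma_w A q0 sigma_w_ge0 (ltW lam0) erefl.
(* [sigma_w] may vanish, but the tail bounds need a positive parameter; the
   excess of [sw] over [sigma_w] is absorbed by [C_xiw]. *)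
set sw := sigma_w + _ => /= -[sw0 sigma_sw swA thr].
have b0 : 0 <= b.
  (* For b < 0 the event in [B_Gamma] is the whole space, of probability 1 > eps. *)
  rewrite leNgt; apply/negP => b0; have := B_Gamma cB.
  rewrite (_ : [set w | _] = setT) ?probability_setT ?lee_fin 1?leNgt ?eps1//.
  by apply/seteqP; split => // w _ /=; exact: lt_le_trans b0 _.
have [mxi mW _ dGam] := model.
have mgf_W := subgaussian_vec_mgf_le sigma_w_ge0 sigma_sw (A_w_subgaussian cA).
have sxA : sigma_xi <= A2 by rewrite lerDl.
have mgf_xi i := subgaussian_mgf_le sigma_xi_ge0 sxA (A_xi_subgaussian cA i).
have uncor_W := uncorrelated_neq (A_w_uncorrelated cA).
have e_delta w i j : (W w *m (delta_mx j 0 : 'cV[R]_p)) i 0 = W w i j.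
  by rewrite mulmx_delta mxE.
have uncor_Wxi : forall i j, ('E_P[(fun w => W w i j * xi w i 0)%R] = 0)%E.
  apply: (independent_mx_uncorrelated sw0 A20) => //.
  - exact: A_w_xi_indep cA.
  - move=> i j; have [+ _] := A_w_subgaussian cA i (norm2_delta j).
    rewrite (_ : (fun w => _) = fun w => W w i j)//.
    by apply/funext => w; rewrite -row_mul [row _ _ _ _]mxE e_delta.
  - move=> i j t; have := mgf_W i (delta_mx j 0) t; rewrite norm2_delta mulr1.
    by under [X in expectation _ X]eq_fun do rewrite e_delta.
have [bad small_bad good_bad] := good_event n0 p0 s0 sw0 A20 veps01 (A_sparse cA)
  model mgf_W mgf_xi uncor_W uncor_Wxi.
pose badG := [set w | b < `|hGamma w - Gamma P W|].
have small_G : small P badG eps by split; [exact: measurable_norm_gt|exact: B_Gamma cB].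
(* The threshold condition involves the random size of the support and holds almost everywhere; its
   exceptional null set joins the bad events. *)
have [N [mN PN condN]] := cond.
have small_N : small P N 0 by split; rewrite // PN.
have small_all := smallU (smallU small_bad small_G) small_N.
apply: (@le_trans _ _ (1 - (9 * veps + eps + 0))%:E); first by rewrite lee_fin; lra.
apply: (probability_ge_of_small small_all).
  pose c (J : {set 'I_p}) := Num.sqrt (#|J| + s)%N%:R
    / ((760 * (A ^+ 2 * A2))^-1 * phi_min X (#|J| + s)%N)
    * ((1 + norm2 beta0) * (1 + q) * l + b * `|beta0|)
    + norm2 (restr (~: J) beta0)
      * (Num.sqrt (phi_max X s) / Num.sqrt (phi_min X (#|J| + s)%N)).
  exact: (@measurable_norm2_le R d Omega p tbeta beta0 hT c mtb mhT).
move=> w nw /=.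
have nbad : ~ bad w by move=> h; apply: nw; left; left.
have nG : `|hGamma w - Gamma P W| <= b.
  by rewrite leNgt; apply/negP => h; apply: nw; left; right.
have {}cond : b + 2 * (sigma_w * q + (23 * A ^+ 2 + 1)) * lam <=
    phi_min X (#|hT w| + s) / (2 * (#|hT w| + s)%:R).
  by apply: contrapT => h; apply: nw; right; exact: condN.
have [gXW gWW gnoise gWX gXWs gWWs] := good_bad w nbad.
set K := (#|hT w| + s)%N in cond *; set phi := phi_min X K in cond *.
have K0 : 0 < K%:R :> R by rewrite ltr0n addn_gt0 s0 orbT.
have cond' := le_trans thr cond.
(* The threshold inequality itself forces this: its left-hand side is positive. *)
have phi0 : 0 < phi.
  have : 0 < phi / (2 * K%:R).
    apply: lt_le_trans cond; apply: ltr_wpDl => //; rewrite mulr_gt0// mulr_gt0//.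
    by rewrite ltr_wpDl ?mulr_ge0// ltr_wpDl// mulr_ge0// ltW.
  by rewrite pmulr_lgt0// invr_gt0 mulr_gt0.
have phiq : phi <= q ^+ 2.
  have h : phi <= m2 X by apply: phi_min_le_m2; rewrite // addn_gt0 s0 orbT.
  by rewrite sqr_sqrtr// (le_trans _ h)// ltW.
have k1 : #|hT w|%:R + 1 <= K%:R :> R by rewrite natrD lerD2l ler1n.
have [swl _ _] := error_budget b0 q0 lam0 sw0 phi0 phiq (ler0n R #|hT w|) k1 cond'.
have swl' : sw * l <= q / 4.
  apply: le_trans swl; apply: (@le_trans _ _ (sw * lam)).
    by rewrite ler_wpM2l// ltW.
  by rewrite ler_peMr ?ler1n ?addn_gt0 ?s0 ?orbT// mulr_ge0// ltW.
set nb := noise_bound X beta0 sw A2 veps in gnoise.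
have nb0 : 0 <= nb := le_trans (normr_ge0 _) (gnoise (Ordinal p0)).
have nb_le : nb <= 60 * (A ^+ 2 * A2) * (l * (1 + q) * (1 + norm2 beta0)).
  exact: (noise_scalar_bound (ltW sw0) (ltW A20) q0 l0 (norm2_ge0 beta0) swA (lexx A2)).
apply: le_trans (refit_error_bound n0 p0 s0 (A_sparse cA) b0 sw0 lam0 l0 llam nb0
  swA A1 phi0 (B_diag cB w) dGam nG cond' gXW gWW gnoise (gWX (hT w)) (gXWs (hT w))
  (gWWs (hT w)) (sol w)) _.
(* The term in |e| is the same on both sides, with constant 1; only the noise terms remain to be
   compared. *)
rewrite lerD2r -/K -/phi -/q.
set G := A ^+ 2 * A2 in c0 nb_le *.
have -> : Num.sqrt K%:R / ((760 * G)^-1 * phi) = Num.sqrt K%:R / phi * (760 * G).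
  by rewrite invfM invrK; ring.
rewrite -[leRHS]mulrA; apply: ler_wpM2l.
  by rewrite divr_ge0 ?sqrtr_ge0// ltW.
have AG : A ^+ 2 <= G by rewrite ler_peMr// ltW.
have G1 : 1 <= G by apply: le_trans AG; rewrite exprn_ege1.
set t := l * (1 + q).
have t0 : 0 <= t by rewrite mulr_ge0// addr_ge0.
have tb0 : 0 <= t * norm2 beta0 by rewrite mulr_ge0 ?norm2_ge0.
have bb0 : 0 <= b * `|beta0| by rewrite mulr_ge0.
have h1 : A ^+ 2 * (t * norm2 beta0) <= G * (t * norm2 beta0) by rewrite ler_wpM2r.
have h2 : b * `|beta0| <= G * (b * `|beta0|) by rewrite ler_peMl.
have h3 : 0 <= G * t by rewrite mulr_ge0// (le_trans ler01).
have -> : (1 + norm2 beta0) * (1 + q) * l = t + t * norm2 beta0 by rewrite /t; ring.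
have -> : 520 * A ^+ 2 * (1 + q) * l * norm2 beta0 = 520 * (A ^+ 2 * (t * norm2 beta0)).
  by rewrite /t; ring.
have nb2 : nb <= 60 * (G * t) + 60 * (G * (t * norm2 beta0)).
  by apply: le_trans nb_le _; rewrite le_eqVlt; apply/orP; left; apply/eqP; rewrite /t; ring.
have -> : 760 * G * (t + t * norm2 beta0 + b * `|beta0|) =
    760 * (G * t) + 760 * (G * (t * norm2 beta0)) + 760 * (G * (b * `|beta0|)) by ring.
clear -nb2 h1 h2 h3 bb0 tb0; lra.
Qed.
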